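(* Let $B$ be a sieving set such that $\langle B\rangle$ has index $\alpha\in(0,1)$. There is a constant $c>0$ depending only on $\alpha$ such that for every positive integer $k$, \[ C_{k,B}(H) = \mu_k\, C_{2,B}(H)^{\frac k2} + O_k\!\left(H^{\frac{k\alpha}{2}-\frac ck}\right). \]
   Context: A sieving set is a non-empty set $B \subset \{2,3,\dots\}$ of pairwise coprime integers with $\sum_{b\in B}1/b<\infty$. A positive integer is $B$-free if divisible by no element of $B$. $\langle B\rangle$ is the multiplicative semigroup generated by $B$ (including $1$). For $J\subset\mathbb{N}$, $N_J(x)=|\{n\le x:n\in J\}|$, and $J$ has index $\alpha$ if $N_J(x)=x^{\alpha+o(1)}$. Let $\mathcal{M}_B=\prod_{b\in B}(1-1/b)$, $N_{B\text{-free}}(n,H)$ the number of $B$-free integers in $(n,n+H]$, and $C_{k,B}(H)=\lim_{X\to\infty}\frac1X\sum_{n\le X}(N_{B\text{-free}}(n,H)-\mathcal{M}_BH)^k$ (which exists under the hypothesis). $\mu_k=1\cdot3\cdots(k-1)$ for $k$ even and $\mu_k=0$ for $k$ odd. Implicit constants may also depend on $B$. *)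

(* Defs.v *)
From HB Require Import structures.
From mathcomp Require Export all_boot all_order all_algebra.
From mathcomp Require Export finmap.
From mathcomp Require Export all_classical all_reals all_analysis.
Export Order.TTheory GRing.Theory Num.Theory.
Export numFieldNormedType.Exports.

Set Implicit Arguments.
Unset Strict Implicit.
Unset Printing Implicit Defensive.

Local Open Scope classical_set_scope.
Local Open Scope ring_scope.

Definition sieving_set (R : realType) (B : set nat) : Prop :=
  [/\ B !=set0,
      (forall b, B b -> (2 <= b)%N),
      (forall a b, B a -> B b -> a != b -> coprime a b)
    & (\esum_(b in B) (b%:R^-1 : R)%:E < +oo)%E].

Definition Bfree (B : set nat) : set nat :=
  [set n | (0 < n)%N /\ forall b, B b -> ~~ (b %| n)%N].

Definition mul_semigroup (B : set nat) : set nat :=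
  smallest [set S : set nat | S 1%N /\ forall m n, S m -> S n -> S (m * n)%N] B.

Section Counting.
Variable R : realType.
Implicit Types (J B : set nat) (x a b H X : R).

(* The set below is always finite, so [fset_set] is not at its default value. *)
Definition count_in J a b : nat :=
  #|` fset_set [set n : nat | J n /\ a < n%:R <= b]|.

Definition N_le J x : nat := count_in J 0 x.

(* N_J(x) = x^(alpha + o(1)) as x -> oo, with [e] as the o(1). *)
Definition has_index J (alpha : R) : Prop :=
  exists e : R -> R, e x @[x --> +oo] --> (0 : R) /\
    \forall x \near +oo, (N_le J x)%:R = x `^ (alpha + e x).

(* The Euler product, as the limit of its partial products over b < n. *)
Definition M_ B : R :=
  lim ((fun n : nat => \prod_(0 <= b < n | b \in B) (1 - b%:R^-1 : R)) @ \oo).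

Definition N_free B (n : nat) H : nat := count_in (Bfree B) n%:R (n%:R + H).

Definition C_ (k : nat) B H : R :=
  lim ((X^-1 * \sum_(1 <= n < (Num.truncn X).+1)
          ((N_free B n H)%:R - M_ B * H) ^+ k) @[X --> +oo]).

End Counting.

Arguments M_ R B : clear implicits.

(* Moments of the standard Gaussian: 1 * 3 * ... * (k - 1) for even k. *)
Definition mu_ (k : nat) : nat :=
  if odd k then 0%N else (\prod_(1 <= i < k | odd i) i)%N.

(* Main.v *)
(** Write N(n) for the deviation of the number of B-free integers in (n, n+H]
    from its mean.  Truncating B to a finite family with product Q makes N
    periodic modulo Q, with Fourier coefficients bounded at the frequency r/Q,
    of reduced denominator d and numerator y (in absolute value), by
    min(H/d, 1/y).  The k-th moment is then a sum over k-tuples of nonzero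
    frequencies with zero sum.  The tuples in which the first frequency cancels with
    exactly one other one give the Gaussian recursion
    M_(k+2) = (k+1) M_2 M_k + error.

    For fixed denominators, the constraint that the frequencies add up to 0 is
    relaxed to a chain of congruences, one per coordinate, so that the
    coordinates can be summed one after the other, once from each end of the
    tuple; taking the geometric mean of the two bounds gives the order of
    magnitude H^(k alpha/2), since every b dividing a denominator divides at
    least two of them.  A power of H is saved when some denominator is small or
    when the elements b dividing three or more denominators have a large
    product.  Otherwise some pair of denominators has a large part v shared with
    no other one; unless the two frequencies cancel, v divides a nonzero
    combination of their numerators, which is again rare.

    Only the convergence of the sum of b^(-s) over B for s > alpha is used, and
    all bounds are uniform in the truncation, so one may pass to the limit. *)
Require Import Defs.
From mathcomp Require Import ring lra zify complex.

Set Implicit Arguments.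
Unset Strict Implicit.
Unset Printing Implicit Defensive.

Local Open Scope ring_scope.

(** * Powers and Dirichlet sums *)

Section RealBounds.
Variable R : realType.
Implicit Types (s t x y : R).

(** The saving in the exponent is only of order 1/k because of a pigeonhole step: a first
    denominator above H^(1/2) is only known to share a factor H^(1/(2k)) with some other one, and
    this factor splits into a part private to the pair and a part of multiplicity at least three,
    whence the threshold T = H^(1/(4k)).

    The obstacle is the private part v. The bound for pairs that do not cancel rests on counting the
    divisors v of a nonzero integer. It is free of H, but it ignores all other congruences, so it
    decays neither in v nor in the other denominators. It is therefore interpolated with the bound
    from the two ends, taken at an exponent s1 well above alpha: the power of H comes down to the
    right one, and a surplus of decay in v is left to be traded for a power of T.

    As the Dirichlet series over B is only known to converge to the right of alpha, alpha is
    replaced throughout by alpha + et, with et of order 1/k^2 so that the loss H^(k et/2) stays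
    below the saving. *)

Lemma ler_powR2 x y s : 0 <= s -> 0 <= x -> x <= y -> x `^ s <= y `^ s.
Proof. by move=> s0 x0 xy; apply: ge0_ler_powR; rewrite ?nnegrE// (le_trans x0). Qed.

Lemma powR_prod (T : Type) (r : seq T) (P : pred T) (F : T -> R) s :
  (forall i, P i -> 0 <= F i) ->
  (\prod_(i <- r | P i) F i) `^ s = \prod_(i <- r | P i) (F i `^ s).
Proof.
move=> F0; elim: r => [|i r IH]; first by rewrite !big_nil powR1.
rewrite !big_cons; case: ifP => // Pi.
by rewrite powRM ?F0 ?IH// prodr_ge0.
Qed.

Lemma powR_le1 x s : 1 <= x -> s <= 0 -> x `^ s <= 1.
Proof. by move=> x1 s0; rewrite -(powRr0 x); apply: ler_powR. Qed.

Lemma powR_ge1 x s : 1 <= x -> 0 <= s -> 1 <= x `^ s.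
Proof. by move=> x1 s0; rewrite -(powRr0 x); apply: ler_powR. Qed.

Lemma powR_expD x s t : 0 < x -> x `^ (s + t) = x `^ s * x `^ t.
Proof. by move=> x0; rewrite powRD// (gt_eqF x0) implybT. Qed.

Lemma powR_exprn x s n : (x `^ s) ^+ n = x `^ (s * n%:R).
Proof. by rewrite powRrM powR_mulrn// powR_ge0. Qed.

Lemma powR_sqr_half x : 0 <= x -> (x ^+ 2) `^ 2^-1 = x.
Proof. by move=> x0; rewrite -powR_mulrn// -powRrM mulfV ?powRr1. Qed.

Lemma powRV x s : 0 <= x -> x^-1 `^ s = (x `^ s)^-1.
Proof. by move=> x0; rewrite -powR_inv1// -powRrM mulN1r powRN. Qed.

Lemma ler_npowR2 x y s : s <= 0 -> 0 < x -> x <= y -> y `^ s <= x `^ s.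
Proof.
move=> s0 x0 xy; have y0 : 0 < y by exact: lt_le_trans xy.
rewrite -[s]opprK !(powRN _ (- s)) lef_pV2 ?posrE ?powR_gt0//.
by apply: ler_powR2; rewrite ?oppr_ge0// ltW.
Qed.

(** Dyadic blocks: on [2^j, 2^(j+1)) each term is at most 2^(-js), and the counting hypothesis at
    the upper endpoint turns the blocks into a geometric series of ratio 2^(s'-s) < 1. *)
Lemma dirichlet_sum_bounded (P : pred nat) (C s s' : R) :
  0 <= s -> s' < s ->
  (forall j, (\sum_(0 <= n < 2 ^ j | P n) 1)%N%:R <= C * (2 ^ j)%:R `^ s') ->
  exists K, 0 <= K /\
    forall N, \sum_(1 <= n < N | P n) n%:R `^ (- s) <= K.
Proof.
move=> s0 ss' cnt.
have C0 : 0 <= C.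
  have := cnt 0%N; rewrite expn0 powR1 mulr1; apply: le_trans; exact: ler0n.
pose q : R := 2 `^ (s' - s).
have q0 : 0 <= q by exact: powR_ge0.
have q1 : q < 1.
  rewrite /q /powR pnatr_eq0 /= -[ltRHS]expR0 ltr_expR.
  by rewrite nmulr_rlt0 ?subr_lt0//; apply: ln_gt0; rewrite ltr1n.
have tn j : (2 ^ j)%:R = (2 : R) `^ j%:R by rewrite powR_mulrn// natrX.
have step j : \sum_(2 ^ j <= n < 2 ^ j.+1 | P n) n%:R `^ (- s) <= C * 2 `^ s' * q ^+ j.
  apply: (@le_trans _ _ (\sum_(2 ^ j <= n < 2 ^ j.+1 | P n) (2 ^ j)%:R `^ (- s))).
    rewrite big_nat_cond [leRHS]big_nat_cond; apply: ler_sum => n /andP[/andP[jn _] _].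
    rewrite !powRN lef_pV2 ?posrE ?powR_gt0 ?ltr0n ?expn_gt0//; last first.
      by rewrite (leq_trans _ jn)// expn_gt0.
    by apply: ler_powR2 => //; rewrite ler_nat.
  rewrite big_const_seq iter_addr_0 -[_ *+ count _ _]mulr_natl.
  have : (count P (index_iota (2 ^ j) (2 ^ j.+1)))%:R <= C * (2 ^ j.+1)%:R `^ s'.
    apply: le_trans (cnt j.+1); rewrite ler_nat.
    rewrite (big_cat_nat (n := 2 ^ j)) ?leq_exp2l//=.
    by rewrite -sum1_count; exact: leq_addl.
  move=> /(@ler_wpM2r _ ((2 ^ j)%:R `^ (- s)) (powR_ge0 _ _)) h.
  apply: (le_trans h); rewrite -!mulrA ler_wpM2l// !tn.
  rewrite -!powRrM -[j.+1]addn1 natrD -powR_mulrn// /q -powRrM -!powR_expD//.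
  by rewrite le_eqVlt; apply/orP; left; apply/eqP; congr (_ `^ _); ring.
exists (C * 2 `^ s' / (1 - q)); split.
  by rewrite divr_ge0 ?mulr_ge0 ?powR_ge0// subr_ge0 (ltW q1).
have geo J : \sum_(1 <= n < 2 ^ J | P n) n%:R `^ (- s) <= C * 2 `^ s' * ((1 - q ^+ J) / (1 - q)).
  elim: J => [|J IH].
    by rewrite big_geq// expr0 subrr mul0r mulr0.
  rewrite (big_cat_nat (n := 2 ^ J)) ?leq_exp2l ?expn_gt0//=.
  apply: le_trans (lerD IH (step J)) _.
  rewrite le_eqVlt; apply/orP; left; apply/eqP; rewrite exprS; field.
  by rewrite subr_eq0 gt_eqF.
move=> N.
have NJ : (N <= 2 ^ N)%N by exact/ltnW/ltn_expl.
apply: (@le_trans _ _ (\sum_(1 <= n < 2 ^ N | P n) n%:R `^ (- s))).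
  have [N1|N1] := leqP 1 N.
    rewrite (big_cat_nat (m := 1%N) (n := N) (p := (2 ^ N)%N))//= lerDl.
    by apply: sumr_ge0 => *; exact: powR_ge0.
  rewrite big_geq; last exact: ltnW.
  by apply: sumr_ge0 => *; exact: powR_ge0.
apply: le_trans (geo N) _.
rewrite ler_wpM2l ?mulr_ge0 ?powR_ge0//.
rewrite -[leRHS]mul1r ler_wpM2r ?invr_ge0 ?subr_ge0 ?(ltW q1)//.
by rewrite lerBlDr lerDl exprn_ge0.
Qed.

Lemma p_series_bounded (e : R) : 0 < e ->
  exists K, 0 < K /\ forall N, \sum_(1 <= n < N) n%:R `^ (- (1 + e)) <= K.
Proof.
move=> e0.
have [||j|K [K0 h]] := @dirichlet_sum_bounded xpredT 1 (1 + e) 1.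
- lra.
- lra.
- by rewrite mul1r powRr1// sum1_size size_iota subn0.
by exists (1 + K); split=> [|N]; [lra|apply: le_trans (h N) _; lra].
Qed.

(** A small power of d is as good as the logarithm here, and follows from 1/n <= n^(-(1+e)) d^e. *)
Lemma harmonic_sum_bounded (e : R) : 0 < e ->
  exists K, 0 < K /\
    forall d, (0 < d)%N -> \sum_(1 <= n < d.+1) (n%:R)^-1 <= K * d%:R `^ e.
Proof.
move=> e0; have [K [K0 h]] := p_series_bounded e0; exists K; split=> // d d0.
apply: le_trans (ler_wpM2r (powR_ge0 _ _) (h d.+1)).
rewrite mulr_suml big_nat_cond [leRHS]big_nat_cond; apply: ler_sum => n /andP[/andP[n1 nd] _].
have n0 : (0 : R) < n%:R by rewrite ltr0n.
rewrite -powR_inv1 ?(ltW n0)// (_ : -1 = - (1 + e) + e :> R); last by ring.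
rewrite powR_expD//; apply: ler_wpM2l; rewrite ?powR_ge0//; apply: ler_powR2; rewrite ?(ltW e0) ?(ltW n0)//.
by rewrite ler_nat.
Qed.

(** Hoelder with exponents 1/(1-t) and 1/t. Dividing by the bounds A and C first lets Young's
    inequality be applied termwise. *)
Lemma hoelder_sum (T : finType) (P : pred T) (a c : T -> R) (t : R) :
  0 < t < 1 -> (forall i, P i -> 0 <= a i) -> (forall i, P i -> 0 <= c i) ->
  forall A C, 0 < A -> 0 < C -> \sum_(i | P i) a i <= A -> \sum_(i | P i) c i <= C ->
  \sum_(i | P i) a i `^ (1 - t) * c i `^ t <= A `^ (1 - t) * C `^ t.
Proof.
move=> /andP[t0 t1] a0 c0 A C A0 C0 hA hC.
have ts : 0 < 1 - t by lra.
have D0 : 0 < A `^ (1 - t) * C `^ t by rewrite mulr_gt0 ?powR_gt0.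
rewrite -[leRHS]mulr1 -ler_pdivrMl// mulr_sumr.
apply: (@le_trans _ _ (\sum_(i | P i) ((1 - t) * (a i / A) + t * (c i / C)))).
  apply: ler_sum => i Pi.
  have aA : 0 <= a i / A by rewrite divr_ge0 ?a0// ltW.
  have cC : 0 <= c i / C by rewrite divr_ge0 ?c0// ltW.
  have := @conjugate_powR R ((a i / A) `^ (1 - t)) ((c i / C) `^ t) (1 - t)^-1 t^-1
    (powR_ge0 _ _) (powR_ge0 _ _).
  rewrite !invr_gt0 !invrK => /(_ ts t0) h.
  have /h : 1 - t + t = 1 by ring.
  rewrite -!powRrM !mulfV ?gt_eqF// !powRr1// => {h} h.
  apply: le_trans (le_trans h _); last by rewrite lerD// mulrC.
  rewrite !powRM ?a0 ?c0 ?invr_ge0 ?(ltW A0) ?(ltW C0)//.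
  rewrite !powRV ?(ltW A0) ?(ltW C0)// invfM.
  by rewrite [X in _ <= X]mulrACA mulrC.
rewrite big_split /= -!mulr_sumr -!mulr_suml.
rewrite [leRHS](_ : 1 = (1 - t) * 1 + t * 1); last by ring.
by apply: lerD; rewrite ler_wpM2l ?(ltW t0) ?(ltW ts)// ler_pdivrMr// mul1r.
Qed.

(** Multiplying the bounds from the two ends of a tuple acts as one bound for the modulus l l'. For
    c < 1 and x, y <= 1, (c + x)(c + y) <= 3c + xy. *)
Lemma min1_two_ends (c l l' : R) : 0 <= c -> 1 <= l -> 1 <= l' ->
  Num.min 1 (c + l^-1) * Num.min 1 (c + l'^-1) <= 3 * Num.min 1 (c + (l * l')^-1).
Proof.
move=> c0 l1 l1'.
have i0 : 0 < l^-1 by rewrite invr_gt0; lra.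
have i0' : 0 < l'^-1 by rewrite invr_gt0; lra.
have i1 : l^-1 <= 1 by rewrite invf_le1//; lra.
have i1' : l'^-1 <= 1 by rewrite invf_le1//; lra.
rewrite invfM; move: i0 i0' i1 i1'; move: l^-1 l'^-1 => x y x0 y0 x1 y1.
have xy0 : 0 < x * y by rewrite mulr_gt0.
have [c1|c1] := leP 1 c.
  rewrite !min_l; lra.
apply: (@le_trans _ _ (Num.min 1 ((c + x) * (c + y)))).
  rewrite le_min; apply/andP; split.
    rewrite -[leRHS]mulr1; apply: ler_pM; rewrite ?ge_min ?lexx// le_min ler01 /=; lra.
  apply: ler_pM; rewrite ?ge_min ?lexx ?orbT// le_min ler01 /=; lra.
case: (leP 1 (c + x * y)) => _; rewrite ge_min; apply/orP; [left; lra|right; nra].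
Qed.

(** Here u m is a denominator, u its part seen from one of the two ends and m the rest. Put v = h/u.
    If v >= m^(1/2) the bound 1 suffices; otherwise the two terms are v/m and v/h, and v^(1-s) is at
    most m^((1-s)/2) in the first and h^(1-s) in the second. *)
Lemma min1_mid_saving (h u m s : R) : 1 <= h -> 1 <= u -> 1 <= m -> 0 <= s <= 1 ->
  Num.min 1 (h / (u * m) + u^-1) <= 2 * (h / u) `^ s * Num.min m h `^ (- (s / 2)).
Proof.
move=> h1 u1 m1 /andP[s0 s1].
have [h0 u0 m0] : [/\ 0 < h, 0 < u & 0 < m] by split; lra.
set t := Num.min m h.
have t0 : 0 < t by rewrite lt_min m0 h0.
have v0 : 0 < h / u by rewrite divr_gt0.
set v := h / u in v0 *.
have tm : m `^ (- (s / 2)) <= t `^ (- (s / 2)).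
  by apply: ler_npowR2 => //; [lra|rewrite ge_min lexx].
have th : h `^ (- (s / 2)) <= t `^ (- (s / 2)).
  by apply: ler_npowR2 => //; [lra|rewrite ge_min lexx orbT].
have vs0 : 0 <= v `^ s by exact: powR_ge0.
have [c1|c1] := leP (m `^ 2^-1) v.
  apply: (@le_trans _ _ 1); first by rewrite ge_min lexx.
  have : 1 <= v `^ s * t `^ (- (s / 2)).
    apply: le_trans (ler_wpM2l vs0 tm).
    have one : m `^ (s / 2) * m `^ (- (s / 2)) = 1 by rewrite -powR_expD// subrr powRr0.
    rewrite -[leLHS]one.
    apply: ler_wpM2r; first exact: powR_ge0.
    rewrite [s / 2]mulrC powRrM; apply: ler_powR2 => //; exact: powR_ge0.
  lra.
rewrite ge_min; apply/orP; right.
have vv : v = v `^ s * v `^ (1 - s).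
  by rewrite -powR_expD// (_ : s + (1 - s) = 1) ?powRr1//; [exact: ltW|ring].
have e1 : h / (u * m) <= v `^ s * t `^ (- (s / 2)).
  rewrite invfM mulrA -/v {1}vv -mulrA; apply: ler_wpM2l => //; apply: le_trans tm.
  apply: (@le_trans _ _ (m `^ (2^-1 * (1 - s)) / m)).
    rewrite ler_wpM2r ?invr_ge0 ?(ltW m0)// powRrM; apply: ler_powR2 => //; [lra|exact: ltW|exact: ltW].
  rewrite -[X in _ / X](powRr1 (ltW m0)) -powRN -powR_expD//; apply: ler_powR => //; lra.
have e2 : u^-1 <= v `^ s * t `^ (- (s / 2)).
  have -> : u^-1 = v / h by rewrite /v; field; rewrite !gt_eqF.
  rewrite {1}vv -mulrA; apply: ler_wpM2l => //; apply: le_trans th.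
  apply: (@le_trans _ _ (h `^ (1 - s) / h)).
    rewrite ler_wpM2r ?invr_ge0 ?(ltW h0)//; apply: ler_powR2; [lra|exact: ltW|].
    by rewrite /v ler_pdivrMr// ler_peMr// ltW.
  rewrite -[X in _ / X](powRr1 (ltW h0)) -powRN -powR_expD//; apply: ler_powR => //; lra.
lra.
Qed.

Lemma min_prod_ge (T : Type) (r : seq T) (F : T -> R) (h : R) : 1 <= h ->
  (forall i, 1 <= F i) ->
  Num.min (\prod_(i <- r) F i) h <= \prod_(i <- r) Num.min (F i) h.
Proof.
move=> h1 F1; elim: r => [|i r IH]; first by rewrite !big_nil ge_min lexx.
rewrite !big_cons.
have m1 : 1 <= Num.min (F i) h by rewrite le_min F1 h1.
have p1 : 1 <= \prod_(j <- r) F j by elim/big_rec: _ => // j x _ x1; rewrite mulr_ege1.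
have q1 : 1 <= \prod_(j <- r) Num.min (F j) h.
  by elim/big_rec: _ => // j x _ x1; rewrite mulr_ege1// le_min F1 h1.
have [hF|Fh] := leP h (F i).
  apply: (@le_trans _ _ h); first by rewrite ge_min lexx orbT.
  by rewrite ler_peMr//; lra.
move: IH; rewrite ge_min => /orP[IH|IH]; rewrite ge_min; apply/orP; [left|right].
  by rewrite ler_wpM2l//; have := F1 i; lra.
by apply: (le_trans IH); rewrite ler_peMl//; have := F1 i; lra.
Qed.

End RealBounds.

(** * Coprime families and their denominators *)

Definition coprime_family (I : finType) (b : I -> nat) : Prop :=
  (forall i, (1 < b i)%N) /\ (forall i j, i != j -> coprime (b i) (b j)).

Section Family.
Import fintype boot.finset.
Variables (I : finType) (b : I -> nat).
Hypothesis hb : coprime_family b.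
Implicit Types (D E U V : {set I}).

Definition pr D : nat := \prod_(i in D) b i.

Lemma b_gt0 i : (0 < b i)%N.
Proof. by have [h _] := hb; exact: ltnW. Qed.

Lemma pr_gt0 D : (0 < pr D)%N.
Proof. by rewrite /pr; apply: prodn_gt0 => i; exact: b_gt0. Qed.

Lemma pr_setU D E : [disjoint D & E] -> pr (D :|: E) = (pr D * pr E)%N.
Proof. by move=> dis; rewrite /pr -bigU//; apply: eq_bigl => i; rewrite !inE. Qed.

Lemma pr_dvd D n : (pr D %| n)%N = [forall (i | i \in D), b i %| n]%N.
Proof.
rewrite /pr; apply/idP/forall_inP => [h i iD|h].
  by apply: dvdn_trans h; rewrite (bigD1 i)//= dvdn_mulr.
have {h} : forall i, i \in enum D -> (b i %| n)%N by move=> i; rewrite mem_enum; exact: h.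
rewrite -big_enum /=; have := enum_uniq D.
elim: (enum D) => [|i s IH]; first by rewrite big_nil dvd1n.
rewrite big_cons /= => /andP[nis us] h.
rewrite Gauss_dvd ?h ?mem_head//=; first by apply: IH => // j js; rewrite h// inE js orbT.
rewrite big_seq; elim/big_rec: _ => [|j x js cx]; first exact: coprimen1.
rewrite coprimeMr cx andbT; have [_ ->]// := hb.
by apply: contraNneq nis => ->.
Qed.

Lemma pr_subset D E : D \subset E -> (pr D %| pr E)%N.
Proof.
move=> /subsetP DE; rewrite pr_dvd; apply/forall_inP => i iD.
by rewrite /pr (bigD1 i) ?DE//= dvdn_mulr.
Qed.

Lemma pr_le D E : D \subset E -> (pr D <= pr E)%N.
Proof. by move=> DE; apply: dvdn_leq; [exact: pr_gt0|exact: pr_subset]. Qed.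

Lemma pr_coprime D E : [disjoint D & E] -> coprime (pr D) (pr E).
Proof.
move=> dis; rewrite /pr; elim/big_rec: _ => [|i x iD cx]; first exact: coprime1n.
rewrite coprimeMl cx andbT; elim/big_rec: _ => [|j y jE cy]; first exact: coprimen1.
rewrite coprimeMr cy andbT; have [_ ->]// := hb.
by apply: contraTneq jE => <-; rewrite (disjointFr dis iD).
Qed.

Definition Q : nat := pr [set: I].

Lemma Q_gt0 : (0 < Q)%N. Proof. exact: pr_gt0. Qed.

Lemma prC D : (pr D * pr (~: D))%N = Q.
Proof. by rewrite -pr_setU ?setUCr// -setI_eq0 setICr. Qed.

(* The support of the frequency r/Q: in lowest terms r/Q has denominator [pr (supp r)]. *)
Definition supp (r : nat) : {set I} := [set i | ~~ (b i %| r)%N].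

Lemma supp_dvd r : (pr (~: supp r) %| r)%N.
Proof. by rewrite pr_dvd; apply/forall_inP => i; rewrite !inE negbK. Qed.

Lemma b_dvd_Q i : (b i %| Q)%N.
Proof. by have := dvdnn Q; rewrite {1}/Q pr_dvd => /forall_inP; apply; rewrite inE. Qed.

Section Real.
Variable R : realType.

Lemma pr_powR D (s : R) : (pr D)%:R `^ s = \prod_(i in D) (b i)%:R `^ s.
Proof. by rewrite natr_prod powR_prod. Qed.

Lemma pr_ge1 D : 1 <= (pr D)%:R :> R.
Proof. by rewrite ler1n; exact: pr_gt0. Qed.

Lemma sum_sets_prod (F : I -> R) :
  \sum_(U : {set I}) \prod_(i in U) F i = \prod_i (F i + 1).
Proof.
rewrite bigA_distr; apply: eq_big => // U _.
by rewrite big_mkcond.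
Qed.

(** The sum is an Euler product, and 1 + x <= exp x bounds it independently of the size of the
    family. *)
Lemma sum_sets_bound (A S s : R) : 0 <= A -> \sum_i (b i)%:R `^ (- s) <= S ->
  \sum_(U : {set I}) A ^+ #|U| * (pr U)%:R `^ (- s) <= expR (A * S).
Proof.
move=> A0 hS.
under eq_bigr => U _ do rewrite pr_powR -prodr_const -big_split /=.
rewrite sum_sets_prod.
apply: (@le_trans _ _ (\prod_i expR (A * (b i)%:R `^ (- s)))).
  apply: ler_prod => i _; rewrite addr_ge0 ?mulr_ge0 ?powR_ge0//= addrC.
  exact: expR_ge1Dx.
rewrite -expR_sum ler_expR -mulr_sumr; exact: ler_wpM2l.
Qed.

Definition tcup k (D : {ffun 'I_k -> {set I}}) : {set I} := \bigcup_i D i.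

(** A set U is the union of at most (2^k)^#|U| tuples, each component being a subset of U; this is
    the case A = 2^k of [sum_sets_bound]. *)
Lemma sum_tuples_bound k (S s : R) : \sum_i (b i)%:R `^ (- s) <= S ->
  \sum_(D : {ffun 'I_k -> {set I}}) (pr (tcup D))%:R `^ (- s) <= expR ((2 ^ k)%:R * S).
Proof.
move=> hS.
apply: le_trans (sum_sets_bound (ler0n _ (2 ^ k)) hS).
rewrite (partition_big (@tcup k) xpredT)//=; apply: ler_sum => U _.
rewrite (eq_bigr (fun=> (pr U)%:R `^ (- s))); last by move=> D /eqP ->.
rewrite sumr_const -[leLHS]mulr_natl; apply: ler_wpM2r; first exact: powR_ge0.
rewrite -natrX ler_nat.
rewrite -expnM mulnC expnM.
have -> : ((2 ^ #|U|) ^ k)%N = #|[set D : {ffun 'I_k -> {set I}} | D \in ffun_on (mem (powerset U))]|.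
  by rewrite cardsE card_ffun_on card_powerset card_ord.
apply: subset_leq_card; apply/subsetP => D; rewrite unfold_in => DU0.
have DU : tcup D = U by apply/eqP.
rewrite inE; apply/ffun_onP => i; rewrite powersetE -DU; exact: bigcup_sup.
Qed.

End Real.
End Family.

(** * Divisor bound for coprime families *)

Section DivisorBound.
Import fintype boot.finset.

Lemma coprime_family_inj (I : finType) (b : I -> nat) : coprime_family b -> injective b.
Proof.
move=> [b1 bc] i j ij; apply/eqP; apply: contraT => /bc.
by rewrite ij /coprime gcdnn => /eqP h; move: (b1 j); rewrite h.
Qed.

(** The classical divisor bound. The members below N number at most N, by injectivity, and
    contribute the constant 2^N; each member b >= N satisfies 2 <= b^e, so the others contribute at
    most L^e. *)
Lemma divisor_sets_bound (R : realType) (e : R) : 0 < e ->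
  exists K, 0 < K /\ forall (I : finType) (b : I -> nat), coprime_family b ->
    forall L, (0 < L)%N ->
    (#|[set V : {set I} | pr b V %| L]|)%N%:R <= K * L%:R `^ e :> R.
Proof.
move=> e0; pose N := (Num.truncn ((2 : R) `^ e^-1)).+1.
exists ((2 : R) ^+ N); split=> [|I b hb L L0]; first by rewrite exprn_gt0.
pose G := [set i | b i %| L]%N.
have sub : [set V : {set I} | pr b V %| L]%N \subset powerset G.
  apply/subsetP => V; rewrite inE pr_dvd// powersetE => /forall_inP h.
  by apply/subsetP => i iV; rewrite inE h.
apply: (@le_trans _ _ ((2 ^ #|G|)%:R)).
  by rewrite ler_nat -card_powerset subset_leq_card.
rewrite natrX.
pose S := [set i in G | (b i < N)%N]; pose B := [set i in G | (N <= b i)%N].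
have -> : G = S :|: B by apply/setP => i; rewrite !inE -andb_orr ltnNge orNb andbT.
rewrite cardsU (_ : S :&: B = set0) ?cards0 ?subn0; last first.
  by apply/setP => i; rewrite !inE ltnNge; case: (_ %| _)%N => //=; case: leqP.
rewrite exprD ler_pM ?exprn_ge0//.
  rewrite ler_eXn2l ?ltr1n//.
  have <- : #|(fun i => inord (b i) : 'I_N) @: S| = #|S|.
    apply: card_in_imset => i j; rewrite !inE => /andP[_ iN] /andP[_ jN].
    move=> /(congr1 val) /=; rewrite !inordK//; exact: coprime_family_inj.
  by rewrite -[leqRHS]card_ord max_card.
apply: (@le_trans _ _ ((pr b B)%:R `^ e)).
  rewrite pr_powR -prodr_const; apply: ler_prod => i; rewrite inE => /andP[_ iN].
  rewrite ler0n /=; apply: (@le_trans _ _ ((2 `^ e^-1) `^ e)).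
    by rewrite -powRrM mulVf ?gt_eqF// powRr1.
  apply: ler_powR2; rewrite ?powR_ge0 ?(ltW e0)//.
  apply: ltW; apply: lt_le_trans (_ : N%:R <= _); last by rewrite ler_nat.
  by rewrite /N truncnS_gt.
apply: ler_powR2; rewrite ?(ltW e0)// ler_nat; apply: dvdn_leq => //.
by rewrite pr_dvd//; apply/forall_inP => i; rewrite !inE => /andP[].
Qed.
End DivisorBound.

(** * Sums over frequencies *)

Section FiniteSums.
Import fintype boot.finset.
Variable R : realType.

Lemma ler_sum_inj (A B : finType) (P : pred A) (f : A -> B) (F : A -> R) (G : B -> R) :
  {in P &, injective f} -> (forall a, P a -> F a <= G (f a)) -> (forall c, 0 <= G c) ->
  \sum_(a | P a) F a <= \sum_c G c.
Proof.
move=> finj FG G0; apply: (@le_trans _ _ (\sum_(a in P) G (f a))); first exact: ler_sum.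
rewrite -(big_imset G finj) /=.
rewrite [leRHS](bigID (mem (f @: P))) /= lerDl.
by apply: sumr_ge0.
Qed.

Lemma ler_sum_atmost1 (A : finType) (P : pred A) (F : A -> R) (B : R) :
  0 <= B -> {in P &, forall x y, x = y} -> (forall a, P a -> F a <= B) ->
  \sum_(a | P a) F a <= B.
Proof.
move=> B0 uniqP FB; case: (pickP P) => [a Pa|P0]; last by rewrite big_pred0.
rewrite (bigD1 a)//= big_pred0 ?addr0 ?FB// => c.
by apply/negP => /andP[Pc]; rewrite (uniqP c a)// eqxx.
Qed.

(** Each block [j l, (j+1) l) contains at most one x satisfying P. Block 0 contributes at most
    min(1, c) since x >= 1, and block j >= 1 at most 1/(l j). *)
Lemma residue_sum (P : pred nat) (l d : nat) (c : R) : (0 < l)%N -> 0 <= c ->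
  (forall x y, P x -> P y -> x = y %[mod l]) ->
  \sum_(1 <= x < d | P x) Num.min c (x%:R)^-1
    <= Num.min 1 c + (l%:R)^-1 * \sum_(1 <= j < d.+1) (j%:R)^-1.
Proof.
move=> l0 c0 modP.
have m0 x : 0 <= Num.min c (x%:R^-1 : R) by rewrite le_min c0 invr_ge0 ler0n.
pose B (j : nat) : R := if j is 0%N then Num.min 1 c else (l%:R)^-1 * (j%:R)^-1.
have B0 j : 0 <= B j.
  by case: j => [|j]; rewrite /B ?le_min ?ler01 ?c0// mulr_ge0 ?invr_ge0.
have -> : \sum_(1 <= x < d | P x) Num.min c (x%:R^-1 : R)
        = \sum_(x < d | (0 < x)%N && P x) Num.min c (x%:R)^-1.
  rewrite -(big_mkord (fun x => (0 < x)%N && P x) (fun x => Num.min c (x%:R)^-1)).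
  case: d => [|d]; first by rewrite !big_geq.
  by rewrite [RHS]big_ltn_cond//= [RHS]big_nat_cond [LHS]big_nat_cond;
     apply: eq_bigl => x; case: x.
apply: (@le_trans _ _ (\sum_(j < d.+1) B j)); last first.
  rewrite big_ord_recl /= lerD2l mulr_sumr big_add1 /= big_mkord.
  by apply: ler_sum => j _.
have jl (x : 'I_d) : (x %/ l < d.+1)%N.
  by rewrite ltnS (leq_trans (leq_div _ _))// ltnW.
rewrite (partition_big (fun x => Ordinal (jl x)) xpredT)//=.
apply: ler_sum => j _; apply: ler_sum_atmost1 => // [x y|x].
  rewrite !unfold_in => /andP[/andP[_ Px] /eqP[<-]] /andP[/andP[_ Py] /eqP[yj]].
  by apply: val_inj; rewrite /= (divn_eq x l) (divn_eq y l) yj (modP x y).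
move=> /andP[/andP[x0 Px] /eqP <-]; rewrite /B /=.
case E: (x %/ l)%N => [|q].
  rewrite le_min !ge_min lexx orTb andbT; apply/orP; right.
  by rewrite invf_le1 ?ltr0n// ler1n.
rewrite ge_min; apply/orP; right.
rewrite -invfM lef_pV2 ?posrE ?mulr_gt0 ?ltr0n// -natrM ler_nat -E mulnC.
exact: leq_trunc_div.
Qed.

Definition ins (T : finType) n (j : 'I_n.+1) (x : T) (g : {ffun 'I_n -> T}) :
  {ffun 'I_n.+1 -> T} := [ffun i => if unlift j i is Some i' then g i' else x].

Lemma ins_id (T : finType) n (j : 'I_n.+1) (x : T) g : ins j x g j = x.
Proof. by rewrite ffunE unlift_none. Qed.

Lemma ins_lift (T : finType) n (j : 'I_n.+1) (x : T) g i : ins j x g (lift j i) = g i.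
Proof. by rewrite ffunE liftK. Qed.

Lemma sum_ins (S : nmodType) (T : finType) n (j : 'I_n.+1) (G : {ffun 'I_n.+1 -> T} -> S) :
  \sum_f G f = \sum_x \sum_g G (ins j x g).
Proof.
rewrite pair_big /= (reindex (fun p : T * {ffun 'I_n -> T} => ins j p.1 p.2))//=.
exists (fun f => (f j, [ffun i => f (lift j i)])) => [[x g] _|f _] /=.
  by rewrite ins_id; congr pair; apply/ffunP => i; rewrite ffunE ins_lift.
apply/ffunP => i; rewrite ffunE; case: unliftP => [i' ->|->//].
by rewrite ffunE.
Qed.

(** The i-th factor sees the preceding coordinates only through their sum, and its total over the
    i-th coordinate is bounded whatever that sum is. The induction peels off the last coordinate. *)
Lemma sequential_sum (T : finType) (v : T -> nat) k (F : 'I_k -> nat -> T -> R) (U : 'I_k -> R) :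
  (forall i s x, 0 <= F i s x) -> (forall i s, \sum_x F i s x <= U i) ->
  \sum_(f : {ffun 'I_k -> T}) \prod_i F i (\sum_(j < k | (j < i)%N) v (f j))%N (f i)
    <= \prod_i U i.
Proof.
elim: k F U => [|k IH] F U F0 FU.
  rewrite big_ord0 (eq_bigr (fun=> 1)); last by move=> f _; rewrite big_ord0.
  by rewrite sumr_const card_ffun card_ord expn0.
have U0 i : 0 <= U i by apply: le_trans (FU i 0%N); apply: sumr_ge0.
have lm (i : 'I_k) : lift ord_max i = widen_ord (leqnSn k) i.
  by apply: val_inj; rewrite /= /bump leqNgt ltn_ord.
rewrite (sum_ins ord_max) exchange_big /= big_ord_recr /=.
have -> : \prod_(i < k) U (widen_ord (leqnSn k) i) = \prod_(i < k) U (lift ord_max i).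
  by apply: eq_bigr => i _; rewrite lm.
apply: (@le_trans _ _ (\sum_(g : {ffun 'I_k -> T})
   (\prod_(i < k) F (lift ord_max i) (\sum_(j < k | (j < i)%N) v (g j))%N (g i)) * U ord_max)).
  apply: ler_sum => g _.
  rewrite (eq_bigr (fun x => (\prod_(i < k) F (lift ord_max i)
     (\sum_(j < k | (j < i)%N) v (g j))%N (g i)) * F ord_max (\sum_(j < k) v (g j))%N x)).
    by rewrite -mulr_sumr; apply: ler_wpM2l => //; apply: prodr_ge0.
  move=> x _; rewrite big_ord_recr /= ins_id; congr (_ * F _ _ _).
    apply: eq_bigr => i _; rewrite -lm ins_lift; congr (F _ _ _).
    rewrite [LHS]big_mkcond big_ord_recr /= [(k < i)%N]ltnNge (ltnW (ltn_ord i)) addn0.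
    by rewrite [RHS]big_mkcond; apply: eq_bigr => a _; rewrite -lm ins_lift.
  rewrite [LHS]big_mkcond big_ord_recr /= ltnn addn0.
  by apply: eq_bigr => a _; rewrite -lm ins_lift ltn_ord.
rewrite -mulr_suml; apply: ler_wpM2r => //.
exact: (IH (fun i => F (lift ord_max i)) (fun i => U (lift ord_max i))).
Qed.

End FiniteSums.

(** * Weights of the frequencies and their sums over congruence classes *)

Section Weights.
Import fintype boot.finset.
Variable R : realType.

Section Def.
Variables (I : finType) (b : I -> nat) (h : nat).
Implicit Types (D E : {set I}).

(* |r| d / Q for the representative of r modulo Q closest to 0, where d is the denominator of r/Q. *)
Definition numer (r : nat) : nat :=
  let d := pr b (supp b r) in let x := (r %/ pr b (~: supp b r))%N in minn x (d - x).

(** Majorant of the Fourier coefficient at r/Q, see [cf_bound]. It vanishes at 0 because the mean is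
    subtracted. *)
Definition wt (r : nat) : R :=
  if r == 0%N then 0
  else Num.min (h%:R / (pr b (supp b r))%:R) ((numer r)%:R)^-1.

Lemma wt_ge0 r : 0 <= wt r.
Proof.
by rewrite /wt; case: ifP.
Qed.

Definition tsum k (D : {ffun 'I_k -> {set I}}) (P : pred {ffun 'I_k -> 'I_(Q b)}) : R :=
  \sum_(r : {ffun 'I_k -> 'I_(Q b)} |
      [&& [forall i, supp b (r i) == D i], (Q b %| \sum_i r i)%N & P r])
    \prod_i wt (r i).

Definition tlast k (D : {ffun 'I_k -> {set I}}) (i : 'I_k) : {set I} :=
  [set x in D i | [forall j : 'I_k, (i < j)%N ==> (x \notin D j)]].

Definition tfirst k (D : {ffun 'I_k -> {set I}}) (i : 'I_k) : {set I} :=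
  [set x in D i | [forall j : 'I_k, (j < i)%N ==> (x \notin D j)]].

End Def.

(** Write r = x m with x < d and m the product outside D. As m is coprime to l = pr E, the condition
    on s + r fixes x modulo l, and [residue_sum] applies. *)
Lemma coset_sum (e : R) : 0 < e ->
  exists K, 0 < K /\ forall (I : finType) (b : I -> nat), coprime_family b ->
  forall (h : nat) (D E : {set I}) (s : nat), E \subset D ->
  \sum_(r < Q b | (supp b r == D) && (pr b E %| s + r)%N) wt b h r
   <= K * (pr b D)%:R `^ e * Num.min 1 (h%:R / (pr b D)%:R + ((pr b E)%:R)^-1).
Proof.
move=> e0; have [K1 [K10 harm]] := harmonic_sum_bounded e0.
exists (4 * (1 + K1)); split=> [|I b hb h D E s ED]; first lra.
set d := pr b D; set m := pr b (~: D); set l := pr b E.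
have d0 : (0 < d)%N by exact: pr_gt0.
have m0 : (0 < m)%N by exact: pr_gt0.
have l0 : (0 < l)%N by exact: pr_gt0.
have Qdm : Q b = (d * m)%N by rewrite -(prC b D).
have clm : coprime l m.
  by apply: pr_coprime => //; rewrite -subsets_disjoint.
pose c : R := h%:R / d%:R.
have c0 : 0 <= c by rewrite divr_ge0 ?ler0n.
pose P (x : nat) := (l %| s + x * m)%N.
have modP x y : P x -> P y -> x = y %[mod l].
  wlog yx : x y / (y <= x)%N => [hw|px py].
    by case/orP: (leq_total y x) => xy px py; [apply: hw|apply/esym/hw].
  apply/eqP; rewrite eqn_mod_dvd// -(Gauss_dvdl _ clm) mulnBl.
  by rewrite -(subnDl s) dvdn_sub.
have min0 (x : nat) : 0 <= Num.min c (x%:R)^-1 by rewrite le_min c0 invr_ge0 ler0n.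
(* [numer] is the smaller of x and d - x, so the weight is at most the sum of the terms for both;
   this leads to two residue sums. *)
pose G (x : nat) : R := if P x && (0 < x)%N then
   Num.min c (x%:R)^-1 + Num.min c ((d - x)%:R)^-1 else 0.
have G0 x : 0 <= G x by rewrite /G; case: ifP => // _; rewrite addr_ge0.
apply: (@le_trans _ _ (\sum_(x < d) G x)).
  have lt (r : 'I_(Q b)) : ((r %/ m) %% d < d)%N by rewrite ltn_pmod.
  have xd (r : 'I_(Q b)) : ((r %/ m) %% d = r %/ m)%N.
    by rewrite modn_small// ltn_divLR// -Qdm.
  have rm (r : 'I_(Q b)) : supp b r == D -> (r %/ m * m = r)%N.
    by move=> /eqP rD; apply: divnK; rewrite /m -rD supp_dvd.
  apply: (@ler_sum_inj _ _ _ _ (fun r => Ordinal (lt r)) _ (fun x => G x)) => //.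
    move=> r r' /andP[rD _] /andP[rD' _] /(congr1 val) /=; rewrite !xd => rr.
    by apply: val_inj; rewrite /= -(rm r)// -(rm r')// rr.
  move=> r /andP[rD lr] /=; rewrite /wt; case: eqP => [_|/eqP r0]; first exact: G0.
  rewrite xd /G /P (rm r)// lr /=.
  have x0 : (0 < r %/ m)%N.
    by rewrite lt0n; apply: contraNneq r0 => x0; rewrite -(rm r)// x0.
  rewrite x0 /numer (eqP rD) -/d -/m -/c.
  by rewrite /minn; case: ifP => _; rewrite ?lerDl ?lerDr.
have -> : \sum_(x < d) G x = \sum_(1 <= x < d | P x) Num.min c (x%:R)^-1 +
    \sum_(1 <= x < d | P (d - x)%N && (x < d)%N) Num.min c (x%:R)^-1.
  have -> : \sum_(x < d) G x = \sum_(1 <= x < d) G x.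
    by rewrite -(big_mkord xpredT G) big_ltn// {1}/G ltnn andbF add0r.
  rewrite [X in _ + X]big_nat_rev /= [X in X + _]big_mkcond [X in _ + X]big_mkcond /=.
  rewrite -big_split /= big_nat [RHS]big_nat; apply: eq_bigr => x /andP[x1 xd].
  rewrite add1n subSS subKn; last exact: ltnW.
  rewrite /G x1 andbT; case: (P x) => /=; last by rewrite addr0.
  by rewrite ltn_subrL x1 d0.
have h1 := @residue_sum R P l d c l0 c0 modP.
have h2 := @residue_sum R (fun x => P (d - x)%N && (x < d)%N) l d c l0 c0.
have {}h2 := h2 _.
apply: le_trans (lerD h1 (h2 _)) _.
  move=> x y /andP[px xd] /andP[py yd].
  have := modP _ _ px py => /eqP; rewrite -(eqn_modDr (x + y)).
  rewrite {1}addnA subnK; last exact: ltnW.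
  by rewrite (addnC x) addnA subnK ?eqn_modDl; [move=> /eqP|exact: ltnW].
have hd := harm d d0.
have de : 1 <= d%:R `^ e by apply: powR_ge1; rewrite ?ler1n// ltW.
have li : (0 : R) <= l%:R^-1 by rewrite invr_ge0.
have li1 : l%:R^-1 <= 1 :> R by rewrite invf_le1 ?ltr0n// ler1n.
have m2 : Num.min 1 c + l%:R^-1 <= 2 * Num.min 1 (c + l%:R^-1).
  by rewrite !minEle; case: ifP => h1c; case: ifP => h2c; lra.
have hh : l%:R^-1 * (\sum_(1 <= j < d.+1) (j%:R)^-1) <= l%:R^-1 * (K1 * d%:R `^ e).
  exact: ler_wpM2l.
have mc0 : 0 <= Num.min 1 c by rewrite le_min ler01 c0.
have mc1 : 0 <= Num.min 1 (c + l%:R^-1) by rewrite le_min ler01 addr_ge0.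
apply: (@le_trans _ _ (2 * ((1 + K1) * d%:R `^ e * (Num.min 1 c + l%:R^-1)))).
  have e1 : 0 <= Num.min 1 c * (d%:R `^ e - 1) by rewrite mulr_ge0// subr_ge0.
  have e2 : 0 <= K1 * d%:R `^ e * Num.min 1 c by rewrite !mulr_ge0 ?powR_ge0// ltW.
  have e3 : 0 <= d%:R `^ e * l%:R^-1 by rewrite mulr_ge0 ?powR_ge0.
  lra.
have e4 : 0 <= (1 + K1) * d%:R `^ e by rewrite mulr_ge0 ?powR_ge0//; lra.
have := ler_wpM2l e4 m2; rewrite -/c; lra.
Qed.

End Weights.
Arguments tsum R {I} b h {k} D P.

(** * Tuples of frequencies with prescribed denominators *)

Section TupleBounds.
Import fintype boot.finset.
Variable R : realType.
Variables (I : finType) (b : I -> nat).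
Hypothesis hb : coprime_family b.
Variables (h k : nat).
Implicit Types (D : {ffun 'I_k -> {set I}}).

Lemma tsum_ge0 D P : 0 <= tsum R b h D P.
Proof. by apply: sumr_ge0 => r _; apply: prodr_ge0 => i _; exact: wt_ge0. Qed.

Lemma tsum_le D (P P' : pred {ffun 'I_k -> 'I_(Q b)}) :
  subpred P P' -> tsum R b h D P <= tsum R b h D P'.
Proof.
move=> PP'; rewrite /tsum big_mkcond [leRHS]big_mkcond /=; apply: ler_sum => r _.
case: ifP => [/and3P[-> -> /PP' ->]//|_]; case: ifP => // _.
by apply: prodr_ge0 => i _; exact: wt_ge0.
Qed.

Section Eps.
Variables (e K : R).
Hypothesis K0 : 0 < K.
Hypothesis hK : forall (D E : {set I}) (s : nat), E \subset D ->
  \sum_(r < Q b | (supp b r == D) && (pr b E %| s + r)%N) wt R b h r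
   <= K * (pr b D)%:R `^ e * Num.min 1 (h%:R / (pr b D)%:R + ((pr b E)%:R)^-1).

Definition cosetU (D E : {set I}) : R :=
  K * (pr b D)%:R `^ e * Num.min 1 (h%:R / (pr b D)%:R + ((pr b E)%:R)^-1).

(* Elements of [tlast D i] divide r_j for j > i, hence also the partial sum up to i. *)
Lemma tsum_forward D : tsum R b h D xpredT <= \prod_i cosetU (D i) (tlast D i).
Proof.
pose F (i : 'I_k) (s : nat) (x : 'I_(Q b)) : R :=
  if (supp b x == D i) && (pr b (tlast D i) %| s + x)%N then wt R b h x else 0.
have F0 i s x : 0 <= F i s x by rewrite /F; case: ifP => // _; exact: wt_ge0.
have FU i s : \sum_x F i s x <= cosetU (D i) (tlast D i).
  rewrite /F -big_mkcond; apply: hK.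
  by apply/subsetP => x; rewrite inE => /andP[].
apply: le_trans (sequential_sum (@nat_of_ord _) F0 FU).
rewrite /tsum big_mkcond /=; apply: ler_sum => r _.
case: ifP => [|_]; last by apply: prodr_ge0.
rewrite andbT => /andP[/forallP rD Qr].
rewrite le_eqVlt; apply/orP; left; apply/eqP; apply: eq_bigr => i _.
rewrite /F rD; case: ifP => // /negbT /negP[] /=.
rewrite pr_dvd//; apply/forall_inP => a; rewrite inE => /andP[aD /forallP al].
have : (b a %| \sum_j r j)%N by apply: dvdn_trans Qr; exact: b_dvd_Q.
rewrite (bigID (fun j : 'I_k => (j < i)%N)) /= [X in (_ + X)%N](bigD1 i) ?ltnn//= addnA dvdn_addl//.
apply: dvdn_sum => j /andP[]; rewrite -leqNgt leq_eqVlt => /orP[/eqP ij|ij].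
  by move=> /negP[]; apply/eqP/esym/val_inj.
move=> _; have := al j; rewrite ij /= -(eqP (rD j)) inE negbK//.
Qed.

Lemma tsum_rev D :
  tsum R b h D xpredT = tsum R b h [ffun i => D (rev_ord i)] xpredT.
Proof.
pose rv (T : Type) (f : {ffun 'I_k -> T}) : {ffun 'I_k -> T} := [ffun i => f (rev_ord i)].
have rvK T : involutive (@rv T).
  by move=> f; apply/ffunP => i; rewrite !ffunE rev_ordK.
rewrite /tsum [LHS](reindex_inj (inv_inj (@rvK 'I_(Q b)))) /=.
apply: eq_big => [r|r _].
  congr (_ && (_ && _)).
    apply/forallP/forallP => hr i; have := hr (rev_ord i); rewrite !ffunE ?rev_ordK//.
  congr (_ %| _)%N; rewrite [RHS](reindex_inj rev_ord_inj).
  by apply: eq_bigr => i _; rewrite ffunE.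
by rewrite [RHS](reindex_inj rev_ord_inj); apply: eq_bigr => i _; rewrite ffunE.
Qed.

Lemma tsum_backward D : tsum R b h D xpredT <= \prod_i cosetU (D i) (tfirst D i).
Proof.
rewrite tsum_rev; apply: (le_trans (tsum_forward _)).
rewrite [leRHS](reindex_inj rev_ord_inj).
rewrite le_eqVlt; apply/orP; left; apply/eqP; apply: eq_bigr => i _.
rewrite ffunE; congr cosetU.
apply/setP => a; rewrite !inE ffunE; congr (_ && _).
apply/forallP/forallP => hj j; apply/implyP => ij.
  have := hj (rev_ord j); rewrite ffunE rev_ordK => /implyP; apply.
  by move: ij (ltn_ord i) (ltn_ord j) => /=; lia.
rewrite ffunE; have /implyP := hj (rev_ord j); apply.
by move: ij (ltn_ord i) (ltn_ord j) => /=; lia.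
Qed.

Definition covered D : bool :=
  [forall a, [forall i, (a \in D i) ==> [exists j, (j != i) && (a \in D j)]]].

(* An element b dividing exactly one of the denominators divides that of the sum. *)
Lemma tsum_uncovered D P : ~~ covered D -> tsum R b h D P = 0.
Proof.
rewrite negb_forall => /existsP[a]; rewrite negb_forall => /existsP; case=> i.
rewrite negb_imply => /andP[ai]; rewrite negb_exists => /forallP aj.
rewrite /tsum big_pred0// => r; apply/negP => /and3P[/forallP rD Qr _].
have : (b a %| \sum_j r j)%N by apply: dvdn_trans Qr; exact: b_dvd_Q.
rewrite (bigD1 i)//= dvdn_addl.
  by apply/negP; move: ai; rewrite -(eqP (rD i)) inE.
apply: dvdn_sum => j ji; have := aj j; rewrite ji /= -(eqP (rD j)) inE negbK//.
Qed.

Definition tends D i : {set I} := tlast D i :|: tfirst D i.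
Definition tmult D a : nat := #|[set i | a \in D i]|.

(** An element that is both first and last at i occurs in no other coordinate. *)
Lemma tends_disjoint D i : covered D -> [disjoint tlast D i & tfirst D i].
Proof.
move=> /forallP cD; rewrite -setI_eq0; apply/eqP/setP => a; rewrite !inE.
apply/negP => /andP[/andP[ai /forallP l] /andP[_ /forallP f]].
have /forallP /(_ i) /implyP /(_ ai) /existsP[j /andP[ji aj]] := cD a.
have := l j; have := f j; rewrite aj /= !implybF -!leqNgt => ij ji'.
by move/negP: ji; apply; apply/eqP/val_inj/eqP; rewrite eqn_leq ij ji'.
Qed.

Lemma tlast_uniq D a i j : a \in tlast D i -> a \in tlast D j -> i = j.
Proof.
rewrite !inE => /andP[ai /forallP li] /andP[aj /forallP lj].
have := li j; have := lj i; rewrite ai aj /= !implybF -!leqNgt => ij ji.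
by apply/val_inj/eqP; rewrite eqn_leq ij ji.
Qed.

Lemma tfirst_uniq D a i j : a \in tfirst D i -> a \in tfirst D j -> i = j.
Proof.
rewrite !inE => /andP[ai /forallP li] /andP[aj /forallP lj].
have := li j; have := lj i; rewrite ai aj /= !implybF -!leqNgt => ij ji.
by apply/val_inj/eqP; rewrite eqn_leq ij ji.
Qed.

Lemma prod_pr_exchange (F : 'I_k -> {set I}) :
  (forall a i j, a \in F i -> a \in F j -> i = j) ->
  (\prod_i pr b (F i))%N = pr b (\bigcup_i F i).
Proof.
move=> uF; rewrite /pr (exchange_big_dep (mem (\bigcup_i F i))) /=; last first.
  by move=> i a _ ai; apply/bigcupP; exists i.
apply: eq_bigr => a /bigcupP[i _ ai]; rewrite (big_pred1 i)// => j /=.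
by apply/idP/eqP => [aj|->//]; exact: (uF a).
Qed.

Lemma bigcup_tlast D : \bigcup_i tlast D i = tcup D.
Proof.
apply/setP => a; apply/bigcupP/bigcupP => -[i _ ai]; first by exists i => //; move: ai; rewrite inE => /andP[].
have [j aj jmax] := arg_maxnP (fun j : 'I_k => val j) (P := [pred j | a \in D j]) ai.
have {}aj : a \in D j by [].
exists j => //; rewrite inE aj /=; apply/forallP => l; apply/implyP; apply: contraTN => al.
by rewrite -leqNgt; exact: jmax.
Qed.

Lemma bigcup_tfirst D : \bigcup_i tfirst D i = tcup D.
Proof.
apply/setP => a; apply/bigcupP/bigcupP => -[i _ ai]; first by exists i => //; move: ai; rewrite inE => /andP[].
have [j aj jmin] := arg_minnP (fun j : 'I_k => val j) (P := [pred j | a \in D j]) ai.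
have {}aj : a \in D j by [].
exists j => //; rewrite inE aj /=; apply/forallP => l; apply/implyP; apply: contraTN => al.
by rewrite -leqNgt; exact: jmin.
Qed.

(** Each element of the union is last in exactly one coordinate and first in exactly one. The square
    is what the geometric mean of the two bounds takes out. *)
Lemma prod_tends D : covered D -> (\prod_i pr b (tends D i) = pr b (tcup D) ^ 2)%N.
Proof.
move=> cD; rewrite expnS expn1 -{1}bigcup_tlast -bigcup_tfirst.
rewrite -(prod_pr_exchange (@tlast_uniq D)) -(prod_pr_exchange (@tfirst_uniq D)).
by rewrite -big_split /=; apply: eq_bigr => i _; rewrite pr_setU// tends_disjoint.
Qed.

Lemma tends_sub D i : tends D i \subset D i.
Proof. by apply/subsetP => a; rewrite !inE => /orP[]/andP[]. Qed.

(** The elements of [D i] that occur both in an earlier and in a later coordinate. *)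
Definition tmid D i : {set I} := D i :\: tends D i.

Lemma pr_tmid D i : pr b (D i) = (pr b (tends D i) * pr b (tmid D i))%N.
Proof.
rewrite -pr_setU; first by rewrite /tmid -{1}(setID (D i) (tends D i)) (setIidPr (tends_sub D i)).
by rewrite -setI_eq0; apply/eqP/setP => a; rewrite !in_setI !in_setD in_set0; case: (a \in _).
Qed.

Lemma pr_setU_le (A B : {set I}) : (pr b (A :|: B) <= pr b A * pr b B)%N.
Proof.
have -> : A :|: B = A :|: (B :\: A) by apply/setP => a; rewrite !inE; case: (a \in A).
rewrite pr_setU; first by rewrite leq_mul2l pr_le ?orbT// subsetDl.
by rewrite -setI_eq0; apply/eqP/setP => a; rewrite !in_setI !in_setD in_set0; case: (a \in _).
Qed.

Lemma pr_bigcup_le (F : 'I_k -> {set I}) : (pr b (\bigcup_i F i) <= \prod_i pr b (F i))%N.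
Proof.
elim/big_rec2: _ => [|i m A _ IH]; first by rewrite /pr big_set0.
by apply: (leq_trans (pr_setU_le _ _)); rewrite leq_mul2l IH orbT.
Qed.

Definition triple D : {set I} := [set a | (2 < tmult D a)%N].

(** An element is an end in at most two coordinates, so with multiplicity at least three it lies in
    some [tmid D i]. *)
Lemma triple_le D : (pr b (triple D) <= \prod_i pr b (tmid D i))%N.
Proof.
apply: leq_trans (pr_bigcup_le (tmid D)); apply: pr_le => //.
apply/subsetP => a; rewrite inE => a3; apply/bigcupP.
have le2 : (#|[set i | a \in tends D i]| <= 2)%N.
  have -> : [set i | a \in tends D i] = [set i | a \in tlast D i] :|: [set i | a \in tfirst D i].
    by apply/setP => i; rewrite !inE.
  apply: (leq_trans (leq_card_setU _ _)); rewrite -[2%N]/(1 + 1)%N leq_add//.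
    by apply/card_le1_eqP => i j; rewrite !inE => ai aj; apply: (@tlast_uniq D a); rewrite inE.
  by apply/card_le1_eqP => i j; rewrite !inE => ai aj; apply: (@tfirst_uniq D a); rewrite inE.
have : ~~ ([set i | a \in D i] \subset [set i | a \in tends D i]).
  by apply: contraL a3 => /subset_leq_card /leq_trans /(_ le2); rewrite -leqNgt.
by move=> /subsetPn; case=> i; rewrite inE => ai; rewrite inE => ni; exists i; rewrite // inE ni ai.
Qed.

(* The geometric mean of [tsum_forward] and [tsum_backward]. *)
Lemma tsum_saving D (s : R) (t : 'I_k -> R) : (0 < h)%N -> 0 <= e ->
  (forall i, 1 <= t i) ->
  (forall i, Num.min 1 (h%:R / (pr b (D i))%:R + ((pr b (tends D i))%:R)^-1)
      <= 2 * (h%:R / (pr b (tends D i))%:R) `^ s * t i `^ (- (s / 2))) ->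
  tsum R b h D xpredT <=
   (3 * K) ^+ k * h%:R `^ (k%:R * s / 2) * (pr b (tcup D))%:R `^ (k%:R * e - s)
     * (\prod_i t i) `^ (- (s / 4)).
Proof.
move=> h0 e0 t1 hq.
have hh0 : (0 : R) < h%:R by rewrite ltr0n.
have r1 : (1 : R) <= (pr b (tcup D))%:R by exact: pr_ge1.
have r0 : (0 : R) < (pr b (tcup D))%:R by lra.
have T0 : 0 < \prod_i t i by apply: prodr_gt0 => i _; apply: lt_le_trans (t1 i).
have [cD|/tsum_uncovered ->] := boolP (covered D); last first.
  by rewrite !mulr_ge0 ?powR_ge0 ?exprn_ge0 ?mulr_ge0 ?(ltW K0).
rewrite -(@ler_pXn2r _ 2)// ?nnegrE ?tsum_ge0//; last first.
  by rewrite !mulr_ge0 ?powR_ge0 ?exprn_ge0 ?mulr_ge0 ?(ltW K0).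
rewrite expr2.
apply: (@le_trans _ _ (\prod_i (cosetU (D i) (tlast D i) * cosetU (D i) (tfirst D i)))).
  by rewrite big_split /=; apply: ler_pM; rewrite ?tsum_ge0// ?tsum_forward ?tsum_backward.
apply: (@le_trans _ _ (\prod_(i < k) ((3 * K) ^+ 2 * (pr b (tcup D))%:R `^ (2 * e)
    * (h%:R `^ s * (pr b (tends D i))%:R `^ (- s)) * t i `^ (- (s / 2))))).
  apply: ler_prod => i _.
  have l1 : (1 : R) <= (pr b (tlast D i))%:R by exact: pr_ge1.
  have f1 : (1 : R) <= (pr b (tfirst D i))%:R by exact: pr_ge1.
  have u1 : (1 : R) <= (pr b (tends D i))%:R by exact: pr_ge1.
  have d1 : (1 : R) <= (pr b (D i))%:R by exact: pr_ge1.
  have c0 : (0 : R) <= h%:R / (pr b (D i))%:R by rewrite divr_ge0.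
  have U0 E : 0 <= cosetU (D i) E.
    by rewrite !mulr_ge0 ?powR_ge0 ?(ltW K0)// le_min ler01 addr_ge0.
  rewrite mulr_ge0//=.
  have := min1_two_ends c0 l1 f1; rewrite -natrM -pr_setU ?tends_disjoint// -/(tends D i).
  move=> /le_trans /(_ (ler_wpM2l (ler0n R 3) (hq i))) hm.
  have de : (pr b (D i))%:R `^ e * (pr b (D i))%:R `^ e <= (pr b (tcup D))%:R `^ (2 * e) :> R.
    rewrite -powR_expD; last lra.
    rewrite (_ : e + e = 2 * e); last by ring.
    apply: ler_powR2; rewrite ?mulr_ge0// ler_nat pr_le//; exact: bigcup_sup.
  have -> : cosetU (D i) (tlast D i) * cosetU (D i) (tfirst D i) =
     K ^+ 2 * ((pr b (D i))%:R `^ e * (pr b (D i))%:R `^ e) *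
     (Num.min 1 (h%:R / (pr b (D i))%:R + (pr b (tlast D i))%:R^-1) *
      Num.min 1 (h%:R / (pr b (D i))%:R + (pr b (tfirst D i))%:R^-1)) by rewrite /cosetU; ring.
  apply: (@le_trans _ _ (K ^+ 2 * (pr b (tcup D))%:R `^ (2 * e) *
    (3 * (2 * (h%:R / (pr b (tends D i))%:R) `^ s * t i `^ (- (s / 2)))))).
    apply: ler_pM => //; rewrite ?mulr_ge0 ?exprn_ge0 ?powR_ge0 ?(ltW K0)//.
    by apply: ler_wpM2l => //; rewrite exprn_ge0// ltW.
  rewrite powRM ?invr_ge0// powRV// -powRN.
  set A := _ `^ (2 * e); set B := h%:R `^ s; set C := _ `^ (- s); set E := _ `^ (- (s / 2)).
  (* The factors 3 of [min1_two_ends] and 2 of the hypothesis [hq] give 6, rounded up to the 9 of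
     (3K)^2. *)
  have -> : K ^+ 2 * A * (3 * (2 * (B * C) * E)) = 6 * (K ^+ 2 * A * (B * C) * E) by ring.
  have -> : (3 * K) ^+ 2 * A * (B * C) * E = 9 * (K ^+ 2 * A * (B * C) * E) by ring.
  apply: ler_wpM2r; last by rewrite ler_nat.
  by rewrite !mulr_ge0 ?powR_ge0 ?exprn_ge0 ?(ltW K0).
rewrite !big_split /= !prodr_const !card_ord.
rewrite -!powR_prod; [|by move=> i _; exact: le_trans (t1 i)|by []].
rewrite -natr_prod prod_tends// natrX.
rewrite le_eqVlt; apply/orP; left; apply/eqP.
rewrite !exprMn !powR_exprn -(powR_mulrn 2 (ltW r0)) -powRrM.
have -> : (pr b (tcup D))%:R `^ ((k%:R * e - s) * 2) =
   (pr b (tcup D))%:R `^ (2 * e * k%:R) * (pr b (tcup D))%:R `^ (2 * - s) :> R.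
  by rewrite -powR_expD//; congr (_ `^ _); ring.
have -> : k%:R * s / 2 * 2 = s * k%:R by field.
have -> : - (s / 4) * 2 = - (s / 2) by field.
by rewrite ?(exprAC _ 2 k); ring.
Qed.

(** [tsum_saving] with t i the size of [tmid D i] truncated at h; by [triple_le] the truncated
    product still dominates the truncated product of the elements of multiplicity at least three. *)
Lemma tsum_mid D (s : R) : (0 < h)%N -> 0 <= e -> 0 <= s <= 1 ->
  tsum R b h D xpredT <=
   (3 * K) ^+ k * h%:R `^ (k%:R * s / 2) * (pr b (tcup D))%:R `^ (k%:R * e - s)
     * Num.min (pr b (triple D))%:R h%:R `^ (- (s / 4)).
Proof.
move=> h0 e0 s01; have h1 : (1 : R) <= h%:R by rewrite ler1n.
have P1 (E : {set I}) : (1 : R) <= (pr b E)%:R by exact: pr_ge1.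
have t1 i : (1 : R) <= Num.min (pr b (tmid D i))%:R h%:R by rewrite le_min P1 h1.
have h2 i : Num.min 1 (h%:R / (pr b (D i))%:R + ((pr b (tends D i))%:R)^-1)
      <= 2 * (h%:R / (pr b (tends D i))%:R) `^ s
         * Num.min (pr b (tmid D i))%:R h%:R `^ (- (s / 2)) :> R.
  by rewrite pr_tmid natrM; apply: min1_mid_saving.
apply: (le_trans (tsum_saving h0 e0 t1 h2)).
apply: ler_wpM2l.
  by rewrite !mulr_ge0 ?powR_ge0 ?exprn_ge0 ?mulr_ge0 ?(ltW K0).
apply: ler_npowR2; first lra.
  by rewrite lt_min !(lt_le_trans ltr01).
apply: le_trans (min_prod_ge _ h1 (fun i => P1 (tmid D i))).
rewrite le_min !ge_min lexx orbT andbT -natr_prod ler_nat triple_le//.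
Qed.

(** [tsum_saving] with t = h at i0 and 1 elsewhere. At i0 the ends have product u <= h^(1/2), so
    (h/u)^s h^(-s/2) >= 1 and the trivial bound 1 already has the required form. *)
Lemma tsum_small D (s : R) i0 : (0 < h)%N -> 0 <= e -> 0 <= s <= 1 ->
  (pr b (D i0))%:R <= h%:R `^ 2^-1 :> R ->
  tsum R b h D xpredT <=
   (3 * K) ^+ k * h%:R `^ (k%:R * s / 2) * (pr b (tcup D))%:R `^ (k%:R * e - s)
     * h%:R `^ (- (s / 4)).
Proof.
move=> h0 e0 s01 dh; have h1 : (1 : R) <= h%:R by rewrite ler1n.
have P1 (E : {set I}) : (1 : R) <= (pr b E)%:R by exact: pr_ge1.
pose t (i : 'I_k) : R := if i == i0 then h%:R else 1.
have t1 i : 1 <= t i by rewrite /t; case: ifP.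
have h2 i : Num.min 1 (h%:R / (pr b (D i))%:R + ((pr b (tends D i))%:R)^-1)
      <= 2 * (h%:R / (pr b (tends D i))%:R) `^ s * t i `^ (- (s / 2)) :> R.
  rewrite /t; case: eqP => [->|_]; last first.
    rewrite pr_tmid natrM; apply: (le_trans (min1_mid_saving h1 (P1 _) (P1 _) s01)).
    apply: ler_wpM2l; first by rewrite mulr_ge0 ?powR_ge0.
    by rewrite powR1; apply: powR_le1; [rewrite le_min P1 h1|lra].
  apply: (@le_trans _ _ 1); first by rewrite ge_min lexx.
  suff : 1 <= (h%:R / (pr b (tends D i0))%:R) `^ s * h%:R `^ (- (s / 2)) :> R by lra.
  have one : h%:R `^ (s / 2) * h%:R `^ (- (s / 2)) = 1 :> R.
    by rewrite -powR_expD ?subrr ?powRr0//; lra.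
  rewrite -[leLHS]one; apply: ler_wpM2r; first exact: powR_ge0.
  rewrite [s / 2]mulrC powRrM; apply: ler_powR2; [lra|exact: powR_ge0|].
  rewrite ler_pdivlMr; last by rewrite (lt_le_trans ltr01).
  apply: (@le_trans _ _ (h%:R `^ 2^-1 * h%:R `^ 2^-1)).
    apply: ler_wpM2l; first exact: powR_ge0.
    by apply: le_trans dh; rewrite ler_nat pr_le// tends_sub.
  by rewrite -powR_expD ?(lt_le_trans ltr01)// (_ : 2^-1 + 2^-1 = 1) ?powRr1//; field.
apply: (le_trans (tsum_saving h0 e0 t1 h2)).
rewrite le_eqVlt; apply/orP; left; apply/eqP; congr (_ * _ `^ _).
by rewrite (bigD1 i0)//= {1}/t eqxx big1 ?mulr1// => i /negbTE ii; rewrite /t ii.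
Qed.

Lemma tsum_basic D (s : R) : (0 < h)%N -> 0 <= e -> 0 <= s <= 1 ->
  tsum R b h D xpredT <=
   (3 * K) ^+ k * h%:R `^ (k%:R * s / 2) * (pr b (tcup D))%:R `^ (k%:R * e - s).
Proof.
move=> h0 e0 s01; apply: (le_trans (tsum_mid D h0 e0 s01)).
rewrite -[leRHS]mulr1; apply: ler_wpM2l.
  by rewrite !mulr_ge0 ?powR_ge0 ?exprn_ge0 ?mulr_ge0 ?(ltW K0).
apply: powR_le1; last lra.
by rewrite le_min pr_ge1// ler1n.
Qed.

End Eps.
Lemma tuple_sum_partition (P : pred {ffun 'I_k -> 'I_(Q b)}) :
  \sum_(r : {ffun 'I_k -> 'I_(Q b)} | (Q b %| \sum_i r i)%N && P r) \prod_i wt R b h (r i)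
  = \sum_(D : {ffun 'I_k -> {set I}}) tsum R b h D P.
Proof.
rewrite (partition_big (fun r : {ffun 'I_k -> 'I_(Q b)} => [ffun i => supp b (r i)]) xpredT)//=.
apply: eq_bigr => D _; apply: eq_bigl => r.
rewrite andbC; congr (_ && _).
apply/eqP/forallP => [<- i|rD]; first by rewrite ffunE.
by apply/ffunP => i; rewrite ffunE; exact/eqP.
Qed.

End TupleBounds.

(** * Pairs of frequencies that do not cancel *)

Section TwoCoordinates.
Import fintype boot.finset.
Variable R : realType.

Lemma sum_two_coords (T : finType) k (F : 'I_k -> T -> R) (p q : 'I_k) (c : rel T) : p != q ->
  \sum_(f : {ffun 'I_k -> T} | c (f p) (f q)) \prod_i F i (f i)
  = (\sum_x \sum_(y | c x y) F p x * F q y) * \prod_(i | (i != p) && (i != q)) \sum_z F i z.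
Proof.
move=> pq.
(* The indicators pin the coordinates p and q to x and y, so that the sum over all tuples factors by
   distributivity. *)
pose G x y (i : 'I_k) z : R := if i == p then (z == x)%:R * F p z
  else if i == q then (z == y)%:R * F q z else F i z.
have qp : (q == p) = false by rewrite eq_sym (negbTE pq).
transitivity (\sum_x \sum_(y | c x y) \prod_i \sum_z G x y i z); last first.
  rewrite mulr_suml; apply: eq_bigr => x _; rewrite mulr_suml; apply: eq_bigr => y _.
  have one (u : T) (H : T -> R) : \sum_z (z == u)%:R * H z = H u.
    by rewrite (bigD1 u)//= eqxx mul1r big1 ?addr0// => z /negbTE ->; rewrite mul0r.
  rewrite (bigD1 p)//= (bigD1 q) ?qp//= mulrA; congr (_ * _ * _).
  - by rewrite /G eqxx one.
  - by rewrite /G qp eqxx one.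
  by apply: eq_bigr => i /andP[/negbTE ip /negbTE iq]; rewrite /G ip iq.
under [RHS]eq_bigr do (under eq_bigr do rewrite bigA_distr_bigA).
under [RHS]eq_bigr do rewrite exchange_big /=.
rewrite [RHS]exchange_big /= big_mkcond; apply: eq_bigr => f _ /=.
have Gf x y : \prod_i G x y i (f i) = (f p == x)%:R * ((f q == y)%:R * \prod_i F i (f i)).
  rewrite [in RHS](bigD1 p)//= [in RHS](bigD1 q) ?qp//= (bigD1 p)//= (bigD1 q) ?qp//=.
  rewrite {1}/G eqxx {1}/G qp eqxx.
  rewrite (eq_bigr (fun i => F i (f i))); first ring.
  by move=> i /andP[/negbTE ip /negbTE iq]; rewrite /G ip iq.
rewrite (bigD1 (f p))//= [X in _ + X]big1 ?addr0; last first.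
  by move=> x xp; apply: big1 => y _; rewrite Gf eq_sym (negbTE xp) mul0r.
case: ifP => [cf|ncf].
  rewrite (bigD1 (f q))//= [X in _ + X]big1 ?addr0; last first.
    by move=> y /andP[_ yq]; rewrite Gf [f q == y]eq_sym (negbTE yq) mul0r mulr0.
  by rewrite Gf !eqxx !mul1r.
apply/esym/big1 => y cy; rewrite Gf; have [E|] := eqVneq (f q) y; last by rewrite mul0r mulr0.
by move: ncf; rewrite E cy.
Qed.

End TwoCoordinates.

Definition adist (m n : nat) : nat := ((m - n) + (n - m))%N.

Lemma dvd_adist v N a c : (c <= N)%N -> (v %| N)%N -> (v %| a + (N - c))%N -> (v %| adist a c)%N.
Proof.
move=> cN vN; rewrite /adist; have [ca|ac] := leqP c a.
  have -> : (a + (N - c) = N + (a - c))%N by lia.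
  by rewrite dvdn_addr// => h; rewrite (_ : c - a = 0)%N ?addn0//; lia.
have -> : (a + (N - c) = N - (c - a))%N by lia.
by rewrite dvdn_subr//; [move=> h; rewrite (_ : a - c = 0)%N ?add0n//; lia|lia].
Qed.

Lemma dvd_sub_sum v N a c : (a <= N)%N -> (c <= N)%N -> (v %| N)%N ->
  (v %| (N - a) + (N - c))%N -> (v %| a + c)%N.
Proof.
move=> aN cN vN; have -> : ((N - a) + (N - c) = (N + N) - (a + c))%N by lia.
by rewrite dvdn_subr//; [lia|rewrite dvdn_add].
Qed.

Section PairBound.
Import fintype boot.finset.
Variable R : realType.

(* The sign of the representative of r modulo Q closest to 0. *)
Definition lowhalf (I : finType) (b : I -> nat) (r : nat) : bool :=
  let x := (r %/ pr b (~: supp b r))%N in (x <= pr b (supp b r) - x)%N.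

(** Absolute value of the numerator, over the common denominator v fp fq, of the sum of the signed
    fractions n/(v fp) and n'/(v fq); the booleans are the signs. *)
Definition crossdist (s s' : bool) (n n' fp fq : nat) : nat :=
  if s == s' then (n * fq + n' * fp)%N else adist (n * fq) (n' * fp).

(** Majorant for the pairs that do not cancel: signs and numerators whose combination is nonzero and
    divisible by v. The exponent 1 + e, in place of 1, makes the sums over n and n' converge at the
    cost of d^e. *)
Definition pairsum (N : nat) (e : R) (v fp fq : nat) : R :=
  \sum_(x : (bool * 'I_N) * (bool * 'I_N))
    if [&& (0 < x.1.2)%N, (0 < x.2.2)%N, (0 < crossdist x.1.1 x.2.1 x.1.2 x.2.2 fp fq)%N
       & (v %| crossdist x.1.1 x.2.1 x.1.2 x.2.2 fp fq)%N]
    then (x.1.2)%:R `^ (- (1 + e)) * (x.2.2)%:R `^ (- (1 + e)) else 0.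

Lemma pairsum_ge0 N e v fp fq : 0 <= pairsum N e v fp fq.
Proof. by apply: sumr_ge0 => x _; case: ifP => // _; rewrite mulr_ge0 ?powR_ge0. Qed.

Section Fam.
Variables (I : finType) (b : I -> nat).
Hypothesis hb : coprime_family b.

(** A nonzero frequency is recovered from its denominator, its sign and its numerator, which gives
    the injectivity in [pair_wt_sum]. *)
Lemma numerE r : (r < Q b)%N -> r != 0%N ->
  let d := pr b (supp b r) in let m := pr b (~: supp b r) in
  [/\ (0 < numer b r)%N, (numer b r < d)%N &
      r = ((if lowhalf b r then numer b r else d - numer b r) * m)%N].
Proof.
move=> rQ r0 d m; have rm : (r %/ m * m = r)%N by apply: divnK; exact: supp_dvd.
have xd : (r %/ m < d)%N by rewrite ltn_divLR ?pr_gt0// prC.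
have x0 : (0 < r %/ m)%N by rewrite lt0n; apply: contraNneq r0 => h; rewrite -rm h.
rewrite /numer /lowhalf -/d -/m; move: x0 xd rm; set x := (r %/ m)%N => x0 xd rm.
clearbody x; split; [lia|lia|rewrite -[LHS]rm; congr (_ * _)%N].
by case: leqP => ?; lia.
Qed.

Lemma wt_le_numer h e r : 0 < e -> (r < Q b)%N ->
  wt R b h r <= (if r == 0%N then 0 else
     (pr b (supp b r))%:R `^ e * (numer b r)%:R `^ (- (1 + e))).
Proof.
move=> e0 rQ; rewrite /wt; case: eqP => // /eqP r0.
have [n0 nd _] := numerE rQ r0; rewrite ge_min; apply/orP; right.
have n0' : (0 : R) < (numer b r)%:R by rewrite ltr0n.
rewrite -powR_inv1 ?(ltW n0')// (_ : -1 = e - (1 + e)); last by ring.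
rewrite powR_expD//; apply: ler_wpM2r; first exact: powR_ge0.
by apply: ler_powR2; rewrite ?(ltW e0) ?(ltW n0')// ler_nat ltnW.
Qed.

(** Let M = fp mp = fq mq, so that Q = v M with v and M coprime. Then fp fq (x + y) = M (X fq + Y
    fp), hence v divides X fq + Y fp. Passing from X, Y to the signed numerators changes this by
    multiples of v fp fq. *)
Lemma cross_dvd (Dp Dq V : {set I}) x y : V \subset Dp -> V \subset Dq ->
  (x < Q b)%N -> (y < Q b)%N -> x != 0%N -> y != 0%N ->
  supp b x = Dp -> supp b y = Dq -> (pr b V %| x + y)%N -> ~~ (Q b %| x + y)%N ->
  let L := crossdist (lowhalf b x) (lowhalf b y) (numer b x) (numer b y)
             (pr b (Dp :\: V)) (pr b (Dq :\: V)) in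
  (0 < L)%N && (pr b V %| L)%N.
Proof.
move=> Vp Vq xQ yQ x0 y0 xD yD vxy nQ.
have [n0 nd xE] := numerE xQ x0; have [n0' nd' yE] := numerE yQ y0.
rewrite xD in nd xE; rewrite yD in nd' yE.
set v := pr b V in vxy *; set fp := pr b (Dp :\: V); set fq := pr b (Dq :\: V).
set n := numer b x in n0 nd xE *; set n' := numer b y in n0' nd' yE *.
have dE (D : {set I}) : V \subset D -> pr b D = (v * pr b (D :\: V))%N.
  move=> VD; rewrite -pr_setU; first by rewrite -{1}(setID D V) (setIidPr VD).
  by rewrite -setI_eq0; apply/eqP/setP => a; rewrite !in_setI !in_setD in_set0; case: (a \in V).
have dp := dE _ Vp; have dq := dE _ Vq; rewrite -/fp in dp; rewrite -/fq in dq.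
have v0 : (0 < v)%N by exact: pr_gt0.
have fp0 : (0 < fp)%N by exact: pr_gt0.
have fq0 : (0 < fq)%N by exact: pr_gt0.
set mp := pr b (~: Dp) in xE; set mq := pr b (~: Dq) in yE.
have Qp : Q b = (v * (fp * mp))%N by rewrite mulnA -dp prC.
have Qq : Q b = (v * (fq * mq))%N by rewrite mulnA -dq prC.
have MM : (fp * mp = fq * mq)%N by apply/eqP; rewrite -(eqn_pmul2l v0) -Qp Qq.
have cM : coprime v (fp * mp).
  have -> : (fp * mp)%N = pr b (~: V).
    by apply/eqP; rewrite -(eqn_pmul2l v0) -Qp /v prC.
  by apply: pr_coprime => //; rewrite -setI_eq0 setICr.
set X := (if lowhalf b x then n else pr b Dp - n)%N in xE.
set Y := (if lowhalf b y then n' else pr b Dq - n')%N in yE.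
have key : (fp * fq * (x + y) = (fp * mp) * (X * fq + Y * fp))%N.
  rewrite xE yE !mulnDr; congr (_ + _)%N; first by lia.
  by rewrite MM; lia.
have vL : (v %| X * fq + Y * fp)%N.
  rewrite -(Gauss_dvdr _ cM) -key; exact: dvdn_mull.
(* Equality would mean x + y = Q. This excludes a zero difference when the signs are opposite; with
   equal signs the sum is positive anyway. *)
have nE : (X * fq + Y * fp != v * fp * fq)%N.
  apply: contraNneq nQ => E; apply/dvdnP; exists 1%N; rewrite mul1n.
  have ff : (0 < fp * fq)%N by rewrite muln_gt0 fp0.
  by apply/eqP; rewrite -(eqn_pmul2l ff) key E Qp; apply/eqP; lia.
rewrite /crossdist -/v.
have le1 : (n * fq <= v * fp * fq)%N by rewrite -dp leq_mul2r ltnW ?orbT.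
have le2 : (n' * fp <= v * fp * fq)%N.
  by rewrite -mulnA (mulnC fp) mulnA -dq leq_mul2r ltnW ?orbT.
have X2 : ((pr b Dp - n) * fq = v * fp * fq - n * fq)%N by rewrite mulnBl dp.
have Y2 : ((pr b Dq - n') * fp = v * fp * fq - n' * fp)%N by rewrite mulnBl dq -mulnA (mulnC fq) mulnA.
have vN : (v %| v * fp * fq)%N by rewrite -mulnA dvdn_mulr.
move: vL nE; rewrite /X /Y; case: (lowhalf b x); case: (lowhalf b y) => /= vL nE.
- by rewrite vL andbT addn_gt0 !muln_gt0 n0 fq0.
- rewrite Y2 in vL nE.
  rewrite (dvd_adist le2 vN vL) andbT /adist.
  by move: nE le2; clear; lia.
- rewrite X2 in vL nE; rewrite addnC in vL.
  have := dvd_adist le1 vN vL; rewrite /adist addnC => ->; rewrite andbT.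
  by move: nE le1; clear; lia.
- rewrite addn_gt0 !muln_gt0 n0 fq0 /=.
  by rewrite X2 Y2 in vL; exact: dvd_sub_sum le1 le2 vN vL.
Qed.

Lemma pair_wt_sum h e (Dp Dq V : {set I}) : 0 < e -> V \subset Dp -> V \subset Dq ->
  \sum_(x < Q b) \sum_(y < Q b | (pr b V %| x + y)%N && ~~ (Q b %| x + y)%N)
     (if supp b x == Dp then wt R b h x else 0) * (if supp b y == Dq then wt R b h y else 0)
  <= (pr b Dp)%:R `^ e * (pr b Dq)%:R `^ e *
     pairsum (Q b) e (pr b V) (pr b (Dp :\: V)) (pr b (Dq :\: V)).
Proof.
move=> e0 Vp Vq; rewrite pair_big_dep /= /pairsum mulr_sumr.
rewrite (bigID (fun p : 'I_(Q b) * 'I_(Q b) => [&& supp b p.1 == Dp, supp b p.2 == Dq,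
   p.1 != 0%N :> nat & p.2 != 0%N :> nat])) /= [X in _ + X]big1 ?addr0; last first.
  move=> [x y] /= /andP[_]; rewrite /wt.
  case: eqP => _; last by rewrite mul0r.
  case: eqP => _; last by rewrite mulr0.
  case: eqP => _ /=; first by rewrite mul0r.
  by case: eqP => _ //=; rewrite mulr0.
have Qn r : (r < Q b)%N -> r != 0%N -> (numer b r < Q b)%N.
  move=> rQ r0; have [_ nd _] := numerE rQ r0; apply: (leq_trans nd).
  by apply: pr_le => //; apply: subsetT.
(* The reduction modulo Q only serves to form an ordinal: [numer] is already below Q for nonzero
   frequencies. *)
have lt r : (numer b r %% Q b < Q b)%N by rewrite ltn_pmod// Q_gt0.
apply: (@ler_sum_inj _ _ _ _ (fun p : 'I_(Q b) * 'I_(Q b) =>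
   ((lowhalf b p.1, Ordinal (lt p.1)), (lowhalf b p.2, Ordinal (lt p.2))))).
- move=> [x y] [x' y'] /andP[_ /= /and4P[/eqP xp /eqP yq x0 y0]].
  move=> /andP[_ /= /and4P[/eqP xp' /eqP yq' x0' y0']] [] lx nx ly ny.
  have inj (r r' : 'I_(Q b)) : supp b r = supp b r' -> r != 0%N :> nat -> r' != 0%N :> nat ->
     lowhalf b r = lowhalf b r' -> (numer b r %% Q b = numer b r' %% Q b)%N -> r = r'.
    move=> sE r0 r0' lE; rewrite !modn_small ?Qn// => nE; apply: val_inj => /=.
    have [_ _ ->] := numerE (ltn_ord r) r0; have [_ _ ->] := numerE (ltn_ord r') r0'.
    by rewrite lE nE sE.
  by congr pair; [apply: inj; rewrite ?xp ?xp'|apply: inj; rewrite ?yq ?yq'].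
- move=> [x y] /= /andP[/andP[vxy nQ] /and4P[/eqP xp /eqP yq x0 y0]].
  rewrite !modn_small ?Qn//.
  have := cross_dvd Vp Vq (ltn_ord x) (ltn_ord y) x0 y0 xp yq vxy nQ.
  have [nx _ _] := numerE (ltn_ord x) x0; have [ny _ _] := numerE (ltn_ord y) y0.
  rewrite nx ny /= => /andP[-> ->] /=; rewrite xp yq !eqxx mulrACA.
  apply: ler_pM; rewrite ?wt_ge0//.
    by have := wt_le_numer h e0 (ltn_ord x); rewrite (negbTE x0) xp.
  by have := wt_le_numer h e0 (ltn_ord y); rewrite (negbTE y0) yq.
- move=> x; rewrite mulr_ge0 ?powR_ge0 ?mulr_ge0 ?powR_ge0//.
  by case: ifP => // _; rewrite mulr_ge0 ?powR_ge0.
Qed.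

End Fam.
End PairBound.

(** * Summation over the denominators *)

Lemma crossdist_le s s' n n' fp fq : (0 < n)%N -> (0 < n')%N -> (0 < fp)%N -> (0 < fq)%N ->
  (crossdist s s' n n' fp fq <= 2 * (n * n') * (fp * fq))%N.
Proof.
move=> n0 n0' p0 q0; apply: (@leq_trans (n * fq + n' * fp)%N).
  by rewrite /crossdist /adist; case: ifP => // _; lia.
have le1 : (n * fq <= n * n' * (fp * fq))%N.
  by rewrite (mulnC fp) mulnACA leq_pmulr// muln_gt0 n0'.
have le2 : (n' * fp <= n * n' * (fp * fq))%N.
  by rewrite (mulnC fp) mulnACA leq_pmull// muln_gt0 n0.
by rewrite -mulnA mul2n -addnn leq_add.
Qed.

Section PairTotals.
Import fintype boot.finset.
Variable R : realType.

(** For fixed signs and numerators the sum over V counts divisors of a nonzero L <= 2 n n' fp fq, at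
    most of order L^(e/2). This leaves the exponent 1 + e/2 on n and n', still convergent. *)
Lemma pairsum_total (e : R) : 0 < e ->
  exists K, 1 <= K /\ forall (I : finType) (b : I -> nat), coprime_family b ->
  forall N fp fq, (0 < fp)%N -> (0 < fq)%N ->
  \sum_(V : {set I}) pairsum N e (pr b V) fp fq <= K * (fp * fq)%:R `^ e.
Proof.
move=> e0; have e20 : 0 < e / 2 by lra.
have [Kd [Kd0 hKd]] := divisor_sets_bound e20.
have [Kp [Kp0 hKp]] := p_series_bounded e20.
(* 4 Kp^2 is the square of two signs times the sum over numerators; the 1 makes the constant at
   least 1, as [pair_total] requires. *)
exists (1 + Kd * 2 `^ (e / 2) * (4 * Kp ^+ 2)); split.
  by rewrite lerDl !mulr_ge0 ?powR_ge0 ?exprn_ge0 ?(ltW Kd0) ?(ltW Kp0).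
move=> I b hb N fp fq p0 q0.
have f1 : (1 : R) <= (fp * fq)%:R by rewrite ler1n muln_gt0 p0.
rewrite /pairsum exchange_big /=.
pose A : R := Kd * 2 `^ (e / 2) * (fp * fq)%:R `^ e.
have A0 : 0 <= A by rewrite !mulr_ge0 ?powR_ge0 ?(ltW Kd0).
pose g (n : nat) : R := if (0 < n)%N then n%:R `^ (- (1 + e / 2)) else 0.
apply: (@le_trans _ _ (\sum_(x : (bool * 'I_N) * (bool * 'I_N)) A * (g x.1.2 * g x.2.2))).
  apply: ler_sum => -[[s n] [s' n']] _ /=; rewrite /g.
  case: ltnP => [n0|_] /=; last by rewrite big1 ?mul0r ?mulr0.
  case: ltnP => [n0'|_] /=; last by rewrite big1 ?mulr0.
  case: ltnP => [L0|_] /=; last first.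
    by rewrite big1//; apply: mulr_ge0 => //; rewrite mulr_ge0 ?powR_ge0.
  set L := crossdist _ _ _ _ _ _ in L0 *.
  rewrite -big_mkcond /= sumr_const -[leLHS]mulr_natl.
  have n1 : (0 : R) < n%:R by rewrite ltr0n.
  have n1' : (0 : R) < n'%:R by rewrite ltr0n.
  have cL : (#|[pred V : {set I} | pr b V %| L]%N|)%:R <= Kd * L%:R `^ (e / 2).
    by have := hKd I b hb L L0; rewrite cardsE.
  apply: (@le_trans _ _ ((Kd * L%:R `^ (e / 2)) * (n%:R `^ (- (1 + e)) * n'%:R `^ (- (1 + e))))).
    by apply: ler_wpM2r => //; rewrite mulr_ge0 ?powR_ge0.
  have LL : L%:R `^ (e / 2) <= 2 `^ (e / 2) * (n%:R `^ (e / 2) * n'%:R `^ (e / 2)) * (fp * fq)%:R `^ e.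
    apply: (@le_trans _ _ ((2 * (n * n') * (fp * fq))%:R `^ (e / 2))).
      by apply: ler_powR2; rewrite ?(ltW e20)// ler_nat crossdist_le.
    rewrite natrM powRM// natrM powRM// [(n * n')%:R]natrM powRM//; apply: ler_wpM2l.
      by rewrite !mulr_ge0 ?powR_ge0.
    by apply: ler_powR => //; lra.
  apply: (@le_trans _ _ (Kd * (2 `^ (e / 2) * (n%:R `^ (e / 2) * n'%:R `^ (e / 2)) * (fp * fq)%:R `^ e)
     * (n%:R `^ (- (1 + e)) * n'%:R `^ (- (1 + e))))).
    apply: ler_wpM2r; first by rewrite mulr_ge0 ?powR_ge0.
    by apply: ler_wpM2l => //; exact: ltW.
  rewrite /A le_eqVlt; apply/orP; left; apply/eqP.
  have sp (x : R) : 0 < x -> x `^ (- (1 + e / 2)) = x `^ (e / 2) * x `^ (- (1 + e)).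
    by move=> x0; rewrite -powR_expD//; congr (_ `^ _); field.
  by rewrite (sp n%:R)// (sp n'%:R)//; ring.
rewrite -mulr_sumr.
have gs : \sum_(x : bool * 'I_N) g x.2 <= 2 * Kp.
  have -> : \sum_(x : bool * 'I_N) g x.2 = \sum_(s : bool) \sum_(n < N) g n.
    by rewrite pair_big.
  rewrite sumr_const card_bool -[leLHS]mulr_natl; apply: ler_wpM2l => //.
  apply: le_trans (hKp N); rewrite -(big_mkord xpredT g).
  have [->|N0] := posnP N; first by rewrite !big_geq.
  rewrite big_ltn// {1}/g /= add0r big_nat [leRHS]big_nat; apply: ler_sum => n /andP[n0 _].
  by rewrite /g n0.
have gs0 : 0 <= \sum_(x : bool * 'I_N) g x.2.
  by apply: sumr_ge0 => x _; rewrite /g; case: ifP => // _; exact: powR_ge0.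
have -> : \sum_(x : (bool * 'I_N) * (bool * 'I_N)) g x.1.2 * g x.2.2 =
    (\sum_(x : bool * 'I_N) g x.2) * (\sum_(x : bool * 'I_N) g x.2).
  by rewrite big_distrlr /= pair_big.
apply: (@le_trans _ _ (A * ((2 * Kp) * (2 * Kp)))).
  by apply: ler_wpM2l => //; apply: ler_pM.
rewrite /A.
have Z0 : 0 <= (fp * fq)%:R `^ e by exact: powR_ge0.
have -> : Kd * 2 `^ (e / 2) * (fp * fq)%:R `^ e * (2 * Kp * (2 * Kp)) =
   Kd * 2 `^ (e / 2) * (4 * Kp ^+ 2) * (fp * fq)%:R `^ e by ring.
by rewrite [leRHS]mulrDl [X in _ <= X + _]mul1r lerDr.
Qed.

Section Fam.
Variables (I : finType) (b : I -> nat).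
Hypothesis hb : coprime_family b.
Variables (h k : nat) (p q : 'I_k).
Hypothesis pq : p != q.
Implicit Types (D : {ffun 'I_k -> {set I}}).

Definition pairset D : {set I} :=
  [set a in D p :&: D q | [forall i, (i != p) ==> (i != q) ==> (a \notin D i)]].

Definition notopp (r : {ffun 'I_k -> 'I_(Q b)}) : bool := ~~ (Q b %| r p + r q)%N.

Section Eps.
Variables (e K : R).
Hypothesis e0 : 0 < e.
Hypothesis K1 : 1 <= K.
Hypothesis hK : forall (D E : {set I}) (s : nat), E \subset D ->
  \sum_(r < Q b | (supp b r == D) && (pr b E %| s + r)%N) wt R b h r
   <= K * (pr b D)%:R `^ e * Num.min 1 (h%:R / (pr b D)%:R + ((pr b E)%:R)^-1).

(** The elements of V divide every r_i with i different from p and q, hence also r_p + r_q. Only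
    this congruence is kept, and the other coordinates are summed freely. *)
Lemma tsum_pair D (V : {set I}) : V \subset pairset D ->
  tsum R b h D notopp <= K ^+ k * (pr b (tcup D))%:R `^ (k%:R * e) *
    pairsum (Q b) e (pr b V) (pr b (D p :\: V)) (pr b (D q :\: V)).
Proof.
move=> VD; have K0 : 0 < K by exact: lt_le_trans ltr01 K1.
have [Vp Vq] : V \subset D p /\ V \subset D q.
  by split; apply: (subset_trans VD); apply/subsetP => a; rewrite !inE => /andP[/andP[]].
pose F i (z : 'I_(Q b)) : R := if supp b z == D i then wt R b h z else 0.
have F0 i z : 0 <= F i z by rewrite /F; case: ifP => // _; exact: wt_ge0.
pose c (x y : 'I_(Q b)) := (pr b V %| x + y)%N && ~~ (Q b %| x + y)%N.
apply: (@le_trans _ _ (\sum_(r : {ffun 'I_k -> 'I_(Q b)} | c (r p) (r q)) \prod_i F i (r i))).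
  rewrite /tsum big_mkcond [leRHS]big_mkcond /=; apply: ler_sum => r _.
  case: ifP => [/and3P[/forallP rD Qr nr]|_]; last first.
    by case: ifP => // _; apply: prodr_ge0.
  have -> : c (r p) (r q).
    rewrite /c -[~~ _]/(notopp r) nr andbT pr_dvd//; apply/forall_inP => a /(subsetP VD).
    rewrite !inE => /andP[/andP[ap aq] /forallP ai].
    have : (b a %| \sum_j r j)%N by apply: dvdn_trans Qr; exact: b_dvd_Q.
    rewrite (bigD1 p)//= (bigD1 q) ?(eq_sym q)//= addnA dvdn_addl//.
    apply: dvdn_sum => j /andP[jp jq]; have := ai j; rewrite jp jq /=.
    by rewrite -(eqP (rD j)) inE negbK.
  rewrite le_eqVlt; apply/orP; left; apply/eqP; apply: eq_bigr => i _.
  by rewrite /F rD.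
rewrite sum_two_coords//.
set r := (pr b (tcup D))%:R; have r1 : (1 : R) <= r by exact: pr_ge1.
have r0 : 0 < r by lra.
have dr i : (pr b (D i))%:R `^ e <= r `^ e.
  apply: ler_powR2; rewrite ?(ltW e0)// ler_nat pr_le//; exact: bigcup_sup.
have Fi i : \sum_z F i z <= K * r `^ e.
  apply: (@le_trans _ _ (K * (pr b (D i))%:R `^ e)); last by apply: ler_wpM2l => //; lra.
  have := hK 0 (sub0set (D i)); rewrite {1}/pr big_set0.
  rewrite (eq_bigl (fun z : 'I_(Q b) => supp b z == D i)); last by move=> z; rewrite dvd1n andbT.
  rewrite /F -big_mkcond => /le_trans; apply.
  rewrite -[leRHS]mulr1; apply: ler_wpM2l; first by rewrite mulr_ge0 ?powR_ge0 ?(ltW K0).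
  by rewrite ge_min lexx.
have Kr : 1 <= K * r `^ e by rewrite mulr_ege1// powR_ge1// ltW.
apply: (@le_trans _ _ (((r `^ e * r `^ e) * pairsum (Q b) e (pr b V) (pr b (D p :\: V)) (pr b (D q :\: V)))
   * \prod_(i | (i != p) && (i != q)) (K * r `^ e))).
  apply: ler_pM.
  - by apply: sumr_ge0 => x _; apply: sumr_ge0 => y _; rewrite mulr_ge0.
  - by apply: prodr_ge0 => i _; apply: sumr_ge0.
  - apply: le_trans (pair_wt_sum hb h e0 Vp Vq) _.
    apply: ler_wpM2r; first exact: pairsum_ge0.
    by apply: ler_pM; rewrite ?powR_ge0.
  - by apply: ler_prod => i _; rewrite sumr_ge0 ?Fi.
have -> : K ^+ k * r `^ (k%:R * e) = \prod_(i < k) (K * r `^ e).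
  by rewrite prodr_const card_ord exprMn powR_exprn [e * _]mulrC.
rewrite [in leRHS](bigD1 p)//= [in leRHS](bigD1 q) ?(eq_sym q)//=.
set P := \prod_(i | _) _; set S := pairsum _ _ _ _ _.
have P0 : 0 <= P by apply: prodr_ge0 => i _; lra.
have S0 : 0 <= S by exact: pairsum_ge0.
have rK : r `^ e <= K * r `^ e by rewrite ler_peMl ?powR_ge0.
rewrite [leLHS](_ : _ = (r `^ e * r `^ e) * (P * S)); last by ring.
rewrite [leRHS](_ : _ = (K * r `^ e * (K * r `^ e)) * (P * S)); last by ring.
apply: ler_wpM2r; first by rewrite mulr_ge0.
by apply: ler_pM; rewrite ?powR_ge0.
Qed.

(** Undoes the removal of [pairset] from the two denominators, so that a sum over tuples becomes a
    sum over pairs (D, V) with V disjoint from D. *)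
Definition tjoin (D : {ffun 'I_k -> {set I}}) (V : {set I}) : {ffun 'I_k -> {set I}} :=
  [ffun i => if (i == p) || (i == q) then D i :|: V else D i].

Lemma tcup_join D V : tcup (tjoin D V) = tcup D :|: V.
Proof.
apply/setP => a; rewrite inE; apply/bigcupP/orP.
  move=> [i _]; rewrite ffunE; case: ifP => _; last by move=> ai; left; apply/bigcupP; exists i.
  by rewrite inE => /orP[ai|->]; [left; apply/bigcupP; exists i|right].
case=> [/bigcupP[i _ ai]|aV].
  by exists i => //; rewrite ffunE; case: ifP; rewrite // inE ai.
by exists p => //; rewrite ffunE eqxx inE aV orbT.
Qed.

(* Hoelder interpolation between [tsum_basic] and [tsum_pair]. *)
Lemma pair_total (K2 s1 t sg S T : R) : (0 < h)%N -> 0 < t < 1 -> 0 <= s1 <= 1 -> 1 <= K2 ->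
  1 <= T ->
  (forall N fp fq, (0 < fp)%N -> (0 < fq)%N ->
     \sum_(V : {set I}) pairsum N e (pr b V) fp fq <= K2 * (fp * fq)%:R `^ e) ->
  \sum_i (b i)%:R `^ (- sg) <= S ->
  (k%:R + 2) * e <= s1 * t - sg -> 0 <= s1 - k%:R * e / t - sg ->
  \sum_(D | T <= (pr b (pairset D))%:R) tsum R b h D notopp
   <= (3 * K) ^+ k * K2 * expR S * expR ((2 ^ k)%:R * S) *
      h%:R `^ (k%:R * (s1 * t) / 2) * T `^ (- ((s1 - k%:R * e / t - sg) * t)).
Proof.
move=> h0 /andP[t0 t1] s01 K21 T1 hK2 hS hsg kap0.
have K0 : 0 < K by exact: lt_le_trans ltr01 K1.
have h1 : (1 : R) <= h%:R by rewrite ler1n.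
pose G (x : {ffun 'I_k -> {set I}} * {set I}) : R :=
  if [disjoint x.2 & tcup x.1] && (T <= (pr b x.2)%:R)
  then tsum R b h (tjoin x.1 x.2) notopp else 0.
pose del (D : {ffun 'I_k -> {set I}}) : {ffun 'I_k -> {set I}} := [ffun i => D i :\: pairset D].
have joinK D : tjoin (del D) (pairset D) = D.
  apply/ffunP => i; rewrite !ffunE.
  have cu (A : {set I}) : pairset D \subset A -> A :\: pairset D :|: pairset D = A.
    by move=> sA; rewrite setUC -{2}(setID A (pairset D)) (setIidPr sA).
  have [->|ip] /= := eqVneq i p.
    by apply: cu; apply/subsetP => a; rewrite !inE => /andP[/andP[]].
  have [->|iq] /= := eqVneq i q.
    by apply: cu; apply/subsetP => a; rewrite !inE => /andP[/andP[]].
  apply/setP => a; rewrite !in_setD; case: (boolP (a \in D i)) => [ai|]; last by rewrite andbF.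
  rewrite andbT; apply/negP; rewrite inE => /andP[_ /forallP /(_ i)].
  by rewrite ip iq ai.
apply: (@le_trans _ _ (\sum_x G x)).
  apply: (@ler_sum_inj _ _ _ _ (fun D => (del D, pairset D))).
  - by move=> D D' _ _ [E1 E2]; rewrite -(joinK D) -(joinK D') E1 E2.
  - move=> D TD; rewrite /G /= TD andbT joinK ifT//.
    rewrite -setI_eq0; apply/eqP/setP => a; rewrite in_setI in_set0; apply/negP => /andP[aV].
    by move=> /bigcupP[i _]; rewrite ffunE in_setD aV.
  - by move=> x; rewrite /G; case: ifP => // _; exact: tsum_ge0.
rewrite -(pair_bigA _ (fun D V => G (D, V))) /=.
(* Interpolation with weight t on [tsum_basic] leaves the power v^(k e - s1 t), the t-th power of
   v^(-(sg + kap)). The part sg makes the sum over V converge, and the surplus kap gives the power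
   of T. *)
set s := s1 * t in hsg *; set kap := s1 - k%:R * e / t - sg in kap0 *.
have s1E : s1 = s / t by rewrite /s; field; rewrite gt_eqF.
pose C : R := (3 * K) ^+ k * h%:R `^ (k%:R * s / 2) * (K2 * (expR S * T `^ (- (kap * t)))).
have C0 : 0 <= C.
  by rewrite !mulr_ge0 ?powR_ge0 ?exprn_ge0 ?mulr_ge0 ?expR_ge0 ?(ltW K0)//; lra.
have S0 : 0 <= S by apply: le_trans hS; apply: sumr_ge0 => i _; exact: powR_ge0.
have main D : \sum_V G (D, V) <= C * (pr b (tcup D))%:R `^ (- sg).
  set Z : R := (pr b (tcup D))%:R; have Z1 : 1 <= Z by exact: pr_ge1.
  have Z0 : 0 < Z by lra.
  pose P (V : {set I}) := [disjoint V & tcup D] && (T <= (pr b V)%:R).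
  pose a (V : {set I}) : R := pairsum (Q b) e (pr b V) (pr b (D p)) (pr b (D q)).
  pose c (V : {set I}) : R := (pr b V)%:R `^ (- (sg + kap)).
  have a0 V : 0 <= a V by exact: pairsum_ge0.
  have c0 V : 0 <= c V by exact: powR_ge0.
  have bound V : P V -> tsum R b h (tjoin D V) notopp <=
     (3 * K) ^+ k * h%:R `^ (k%:R * s / 2) * Z `^ (k%:R * e - s) * (a V `^ (1 - t) * c V `^ t).
    move=> /andP[dis TV]; set v : R := (pr b V)%:R.
    have v1 : 1 <= v by exact: pr_ge1.
    have v0 : 0 < v by lra.
    set n := tsum _ _ _ _ _; have n0 : 0 <= n by exact: tsum_ge0.
    have rE : (pr b (tcup (tjoin D V)))%:R = Z * v.
      by rewrite tcup_join pr_setU ?natrM// disjoint_sym.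
    have nA : n <= (3 * K) ^+ k * h%:R `^ (k%:R * s1 / 2) * (Z * v) `^ (k%:R * e - s1).
      apply: (@le_trans _ _ (tsum R b h (tjoin D V) xpredT)); first exact: tsum_le.
      by rewrite -rE; apply: (tsum_basic hb K0 hK) => //; exact: ltW.
    have nB : n <= (3 * K) ^+ k * ((Z * v) `^ (k%:R * e) * a V).
      have Vsub : V \subset pairset (tjoin D V).
        apply/subsetP => x xV; rewrite !inE !ffunE !eqxx orbT /= !inE xV !orbT /=.
        apply/forallP => i; apply/implyP => ip; apply/implyP => iq.
        rewrite ffunE (negbTE ip) (negbTE iq) /=; apply/negP => xi.
        by have := disjointFr dis xV; move=> /negP; apply; apply/bigcupP; exists i.
      apply: le_trans (tsum_pair Vsub) _.
      rewrite rE -mulrA.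
      have DV i : (i == p) || (i == q) -> tjoin D V i :\: V = D i.
        move=> ipq; rewrite ffunE ipq setDUl setDv setU0; apply/setDidPl.
        rewrite disjoint_sym; apply: disjointWr dis; exact: bigcup_sup.
      rewrite DV ?eqxx// DV ?eqxx ?orbT// -/(a V).
      apply: ler_wpM2r; first by rewrite mulr_ge0 ?powR_ge0.
      by rewrite exprMn ler_peMl ?exprn_ge0 ?exprn_ege1 ?ler1n ?(ltW K0).
    have nn : n = n `^ (1 - t) * n `^ t.
      have [->|n1] := eqVneq n 0; first by rewrite !powR0 ?mulr0//; [rewrite gt_eqF|rewrite subr_eq0 gt_eqF].
      rewrite -powR_expD ?lt_neqAle ?(eq_sym 0) ?n1// (_ : 1 - t + t = 1) ?powRr1//; ring.
    rewrite nn; apply: (@le_trans _ _ (((3 * K) ^+ k * ((Z * v) `^ (k%:R * e) * a V)) `^ (1 - t) *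
       ((3 * K) ^+ k * h%:R `^ (k%:R * s1 / 2) * (Z * v) `^ (k%:R * e - s1)) `^ t)).
      by apply: ler_pM; rewrite ?powR_ge0//; apply: ler_powR2 => //; lra.
    have KK : 0 < (3 * K) ^+ k by rewrite exprn_gt0// mulr_gt0.
    have zv : 0 < Z * v by rewrite mulr_gt0.
    rewrite !powRM ?mulr_ge0 ?powR_ge0 ?(ltW KK)//.
    have K3 : (3 * K) ^+ k = ((3 * K) ^+ k) `^ (1 - t) * ((3 * K) ^+ k) `^ t.
      by rewrite -powR_expD// (_ : 1 - t + t = 1) ?powRr1 ?(ltW KK)//; ring.
    have ZE : Z `^ (k%:R * e - s) = Z `^ (k%:R * e * (1 - t)) * Z `^ ((k%:R * e - s1) * t).
      by rewrite -powR_expD//; congr (_ `^ _); rewrite /s; ring.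
    have vE : c V `^ t = v `^ (k%:R * e * (1 - t)) * v `^ ((k%:R * e - s1) * t).
      rewrite /c -powRrM -powR_expD//; congr (_ `^ _); rewrite /kap; field.
      by rewrite gt_eqF.
    rewrite [in leRHS]K3 vE -!powRrM.
    have -> : k%:R * s1 / 2 * t = k%:R * s / 2 by rewrite /s; ring.
    by rewrite ZE le_eqVlt; apply/orP; left; apply/eqP; ring.
  have -> : \sum_V G (D, V) = \sum_(V | P V) tsum R b h (tjoin D V) notopp.
    by rewrite [RHS]big_mkcond.
  apply: (le_trans (ler_sum _ bound)); rewrite -mulr_sumr.
  have A0 : 0 < K2 * Z `^ (2 * e) by rewrite mulr_gt0 ?powR_gt0//; lra.
  have Cc0 : 0 < expR S * T `^ (- kap) by rewrite mulr_gt0 ?expR_gt0 ?powR_gt0//; lra.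
  have sa : \sum_(V | P V) a V <= K2 * Z `^ (2 * e).
    apply: (@le_trans _ _ (\sum_V a V)).
      by rewrite big_mkcond; apply: ler_sum => V _; case: ifP.
    apply: le_trans (hK2 _ _ _ _ _) _; rewrite ?pr_gt0//.
    apply: ler_wpM2l; first lra.
    rewrite powRrM; apply: ler_powR2; rewrite ?(ltW e0)//.
    rewrite powR_mulrn ?(ltW Z0)// expr2 natrM; apply: ler_pM => //; rewrite ler_nat pr_le//; exact: bigcup_sup.
  have sc : \sum_(V | P V) c V <= expR S * T `^ (- kap).
    apply: (@le_trans _ _ (\sum_(V | P V) (pr b V)%:R `^ (- sg) * T `^ (- kap))).
      apply: ler_sum => V /andP[_ TV].
      have v0 : (0 : R) < (pr b V)%:R by apply: lt_le_trans TV; lra.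
      rewrite /c opprD powR_expD//; apply: ler_wpM2l; first exact: powR_ge0.
      by apply: ler_npowR2 => //; lra.
    rewrite -mulr_suml; apply: ler_wpM2r; first exact: powR_ge0.
    apply: (@le_trans _ _ (\sum_(V : {set I}) 1 ^+ #|V| * (pr b V)%:R `^ (- sg))).
      rewrite big_mkcond; apply: ler_sum => V _; rewrite expr1n mul1r.
      by case: ifP => // _; exact: powR_ge0.
    by have := sum_sets_bound (A := 1) ler01 hS; rewrite mul1r.
  have t01 : 0 < t < 1 by rewrite t0 t1.
  have := hoelder_sum t01 (fun V _ => a0 V) (fun V _ => c0 V) A0 Cc0 sa sc.
  move=> /(ler_wpM2l _) H; apply: (le_trans (H _ _)).
    by rewrite !mulr_ge0 ?powR_ge0 ?exprn_ge0 ?mulr_ge0 ?(ltW K0).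
  rewrite !powRM ?powR_ge0 ?expR_ge0//; last lra.
  rewrite /C -!powRrM mulNr.
  have e1 : K2 `^ (1 - t) <= K2.
    by rewrite -[leRHS]powRr1; [apply: ler_powR => //; lra|lra].
  have e2 : expR S `^ t <= expR S.
    rewrite -[leRHS]powRr1 ?expR_ge0//; apply: ler_powR; last exact: ltW.
    by rewrite -expR0 ler_expR.
  (* This is where (k + 2) e <= s - sg enters: k e comes from the two interpolated bounds and 2 e
     from fp fq <= Z^2. *)
  have e3 : Z `^ (k%:R * e - s) * Z `^ (2 * e * (1 - t)) <= Z `^ (- sg).
    rewrite -powR_expD//; apply: ler_powR => //.
    have : 0 <= e * t by rewrite mulr_ge0 ?ltW.
    lra.
  set X := (3 * K) ^+ k; set Y := h%:R `^ _; set Tt := T `^ _.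
  have X0 : 0 <= X by rewrite exprn_ge0// mulr_ge0// ltW.
  have Y0 : 0 <= Y by exact: powR_ge0.
  have T0 : 0 <= Tt by exact: powR_ge0.
  rewrite [leLHS](_ : _ = (X * Y * Tt) * ((Z `^ (k%:R * e - s) * Z `^ (2 * e * (1 - t))) *
     (K2 `^ (1 - t) * expR S `^ t))); last by ring.
  rewrite [leRHS](_ : _ = (X * Y * Tt) * (Z `^ (- sg) * (K2 * expR S))); last by ring.
  apply: ler_wpM2l; first by rewrite !mulr_ge0.
  by apply: ler_pM; rewrite ?mulr_ge0 ?powR_ge0//; apply: ler_pM; rewrite ?powR_ge0.
apply: (le_trans (ler_sum _ (fun D _ => main D))); rewrite -mulr_sumr.
apply: (@le_trans _ _ (C * expR ((2 ^ k)%:R * S))).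
  by apply: ler_wpM2l => //; exact: sum_tuples_bound.
by rewrite /C le_eqVlt; apply/orP; left; apply/eqP; ring.
Qed.

End Eps.
End Fam.
End PairTotals.

(** * Case distinctions and totals over all denominators *)

Section Unpaired.
Import fintype boot.finset.
Variable R : realType.

Section Fam.
Variables (I : finType) (b : I -> nat).
Hypothesis hb : coprime_family b.
Variables (h k : nat) (i0 : 'I_k).
Implicit Types (D : {ffun 'I_k -> {set I}}).

Definition unpaired (r : {ffun 'I_k -> 'I_(Q b)}) : bool :=
  [forall j, (j != i0) ==> ~~ (Q b %| r i0 + r j)%N].

Definition multipaired (r : {ffun 'I_k -> 'I_(Q b)}) : bool :=
  (1 < #|[set j | (j != i0) && (Q b %| r i0 + r j)%N]|)%N.

(** By [covered], the sets D i0 :&: D j with j different from i0 cover D i0, so the largest of their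
    products, to the power k, is at least d_0. *)
Lemma large_gcd D : covered D -> (1 < pr b (D i0))%N ->
  exists2 j, j != i0 & (pr b (D i0) <= pr b (D i0 :&: D j) ^ k)%N.
Proof.
move=> /forallP cD d1.
pose F j : {set I} := if j == i0 then set0 else D i0 :&: D j.
have [j _ jmax] := @arg_maxnP _ i0 xpredT (fun j => pr b (F j)) isT.
have dF : (pr b (D i0) <= pr b (F j) ^ k)%N.
  apply: (@leq_trans (pr b (\bigcup_j F j))).
    apply: pr_le => //; apply/subsetP => a a0.
    have /forallP /(_ i0) /implyP /(_ a0) /existsP[l /andP[l0 al]] := cD a.
    by apply/bigcupP; exists l => //; rewrite /F (negbTE l0) inE a0.
  apply: (leq_trans (pr_bigcup_le hb F)).
  rewrite -[in leqRHS](card_ord k) -prod_nat_const; apply: leq_prod => l _; exact: jmax.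
(* F i0 is empty, with product 1, whereas d_0 > 1. *)
have j0 : j != i0.
  apply: contraTneq dF => j0; rewrite -ltnNge /F j0 eqxx /pr big_set0 exp1n//.
by exists j => //; move: dF; rewrite /F (negbTE j0).
Qed.

(** A common element of the two denominators either divides no other one or divides a third. *)
Lemma gcd_le_pair_triple D j : j != i0 ->
  (pr b (D i0 :&: D j) <= pr b (pairset i0 j D) * pr b (triple D))%N.
Proof.
move=> j0; apply: leq_trans (pr_setU_le hb _ _); apply: pr_le => //.
apply/subsetP => a; rewrite !inE => /andP[a0 aj]; rewrite a0 aj /=.
case: (boolP [forall i, _]) => //=; rewrite negb_forall => /existsP; case=> i.
rewrite !negb_imply => /and3P[i1 ij ai].
have {}ai : a \in D i by move: ai => /andP[].
rewrite /tmult; apply: (@leq_trans #|[set i0; j; i]|).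
  by rewrite -setUA !cardsU1 !inE cards1 negb_or eq_sym j0 eq_sym i1 eq_sym ij.
apply: subset_leq_card; apply/subsetP => l; rewrite !inE => /orP[/orP[]|] /eqP -> //.
Qed.

(* If d_0 is large then so is some gcd(d_0, d_j) by [large_gcd], hence also one of the
   two factors in [gcd_le_pair_triple]. *)
Lemma unpaired_cases D (T : R) : 1 <= T -> T ^+ (4 * k) <= h%:R -> (0 < k)%N -> (0 < h)%N ->
  tsum R b h D unpaired <=
    (if (pr b (D i0))%:R <= h%:R `^ 2^-1 :> R then tsum R b h D xpredT else 0) +
    (if T <= (pr b (triple D))%:R then tsum R b h D xpredT else 0) +
    \sum_(j | j != i0) (if T <= (pr b (pairset i0 j D))%:R
                        then tsum R b h D (notopp i0 j) else 0).
Proof.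
move=> T1 Th k0 h0.
have h1 : (1 : R) <= h%:R by rewrite ler1n.
have t0 P : 0 <= tsum R b h D P by exact: tsum_ge0.
have s0 : 0 <= \sum_(j | j != i0) (if T <= (pr b (pairset i0 j D))%:R
                        then tsum R b h D (notopp i0 j) else 0).
  by apply: sumr_ge0 => j _; case: ifP.
have le P : tsum R b h D P <= tsum R b h D xpredT by exact: tsum_le.
have := le unpaired; case: ifP => [_|/negbT]; first by case: ifP => _; have := t0 xpredT; lra.
rewrite -ltNge => dh; case: ifP => [_|/negbT]; first by lra.
rewrite -ltNge => WT _; rewrite !add0r.
have [cD|/tsum_uncovered ->//] := boolP (covered D).
have hh : (1 : R) <= h%:R `^ 2^-1 by apply: powR_ge1.
have d1 : (1 < pr b (D i0))%N by rewrite -(ltr_nat R); apply: le_lt_trans dh.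
have [j j0 dj] := large_gcd cD d1.
rewrite (bigD1 j)//=; set X := \sum_(i | _) _.
have X0 : 0 <= X by apply: sumr_ge0 => i _; case: ifP.
have -> : T <= (pr b (pairset i0 j D))%:R; last first.
  apply: (@le_trans _ _ (tsum R b h D (notopp i0 j))); last by rewrite lerDl.
  by apply: tsum_le => r /forallP /(_ j); rewrite j0.
rewrite leNgt; apply/negP => PT.
(* If both factors were below T, d_0 would be below T^(2k) <= h^(1/2), against [dh]. *)
have : (pr b (D i0))%:R < T ^+ (2 * k) :> R.
  apply: (@le_lt_trans _ _ ((pr b (D i0 :&: D j))%:R ^+ k)); first by rewrite -natrX ler_nat.
  rewrite exprM; have -> : T ^+ 2 = T * T by rewrite expr2.
  have TT : 0 <= T * T by rewrite mulr_ge0//; lra.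
  rewrite ltr_pXn2r ?nnegrE//.
  apply: (@le_lt_trans _ _ ((pr b (pairset i0 j D))%:R * (pr b (triple D))%:R)).
    by rewrite -natrM ler_nat gcd_le_pair_triple.
  by apply: ltr_pM.
apply/negP; rewrite -leNgt; apply: ltW; apply: le_lt_trans dh.
have Tk : 0 <= T ^+ (2 * k) by rewrite exprn_ge0//; lra.
rewrite -(powR_sqr_half Tk) -exprM (_ : (2 * k * 2 = 4 * k)%N); last by rewrite mulnAC.
by apply: ler_powR2; rewrite ?invr_ge0 ?exprn_ge0//; lra.
Qed.

(** Two frequencies cancelling the first one have its denominator, so all elements of D i0 have
    multiplicity at least three; and d_0 > h^(1/2) >= T. *)
Lemma multipaired_cases D (T : R) : 1 <= T -> T ^+ (4 * k) <= h%:R -> (0 < k)%N -> (0 < h)%N ->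
  tsum R b h D multipaired <=
    (if (pr b (D i0))%:R <= h%:R `^ 2^-1 :> R then tsum R b h D xpredT else 0) +
    (if T <= (pr b (triple D))%:R then tsum R b h D xpredT else 0).
Proof.
move=> T1 Th k0 h0.
have t0 P : 0 <= tsum R b h D P by exact: tsum_ge0.
have le P : tsum R b h D P <= tsum R b h D xpredT by exact: tsum_le.
have := le multipaired; case: ifP => [_|/negbT]; first by case: ifP => _; have := t0 xpredT; lra.
rewrite -ltNge => dh; case: ifP => [_|/negbT]; first by lra.
rewrite -ltNge => WT _; rewrite addr0.
rewrite /tsum big_pred0// => r; apply/negP => /and3P[/forallP rD Qr].
move=> /card_gt1P[j [l []]]; rewrite !inE => /andP[j0 Qj] /andP[l0 Ql] jl.
have same i : (Q b %| r i0 + r i)%N -> D i = D i0.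
  move=> Qi; rewrite -(eqP (rD i)) -(eqP (rD i0)); apply/setP => a; rewrite !inE.
  have bi : (b a %| r i0 + r i)%N by apply: dvdn_trans Qi; exact: b_dvd_Q.
  congr (~~ _); apply/idP/idP => h1.
    by rewrite -(dvdn_addl _ h1).
  by rewrite -(dvdn_addr _ h1).
have sub : D i0 \subset triple D.
  apply/subsetP => a a0; rewrite inE /tmult; apply: (@leq_trans #|[set i0; j; l]|).
    by rewrite -setUA !cardsU1 !inE cards1 negb_or eq_sym j0 eq_sym l0 jl.
  apply: subset_leq_card; apply/subsetP => i; rewrite !inE => /orP[/orP[]|] /eqP -> //.
    by rewrite (same j).
  by rewrite (same l).
have : (pr b (D i0))%:R < T.
  by apply: le_lt_trans WT; rewrite ler_nat pr_le.
apply/negP; rewrite -leNgt; apply: ltW; apply: le_lt_trans dh.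
have T0 : 0 <= T by lra.
rewrite -(powR_sqr_half T0).
apply: ler_powR2; rewrite ?invr_ge0 ?exprn_ge0//.
apply: le_trans Th; apply: ler_weXn2l => //.
by apply: (@leq_trans (4 * 1)%N) => //; rewrite leq_pmul2l.
Qed.

End Fam.

(** C is chosen before the family and depends on it only through S, the uniformity that the passage
    to the limit needs. The saving c0/k covers all tuples whose first frequency does not cancel with
    exactly one other. *)
Lemma tuple_totals (al : R) (k : nat) (et S : R) : 0 < al < 1 -> (0 < k)%N -> 0 < et ->
  et <= al * (1 - al) / 16 ->
  exists C, 0 <= C /\ forall (I : finType) (b : I -> nat), coprime_family b ->
  \sum_i (b i)%:R `^ (- (al + et / 2)) <= S ->
  forall (h : nat) (i0 : 'I_k), (0 < h)%N ->
  [/\ \sum_(r : {ffun 'I_k -> 'I_(Q b)} | (Q b %| \sum_i r i)%N) \prod_i wt R b h (r i)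
        <= C * h%:R `^ (k%:R * (al + et) / 2),
      \sum_(r : {ffun 'I_k -> 'I_(Q b)} | (Q b %| \sum_i r i)%N && unpaired i0 r)
         \prod_i wt R b h (r i)
        <= C * h%:R `^ (k%:R * (al + et) / 2 - al * (1 - al) / 16 / k%:R) &
      \sum_(r : {ffun 'I_k -> 'I_(Q b)} | (Q b %| \sum_i r i)%N && multipaired i0 r)
         \prod_i wt R b h (r i)
        <= C * h%:R `^ (k%:R * (al + et) / 2 - al * (1 - al) / 16 / k%:R)].
Proof.
move=> /andP[al0 al1] k0 et0 etc.
have aa : 0 < al * (1 - al) by rewrite mulr_gt0; lra.
set c0 := al * (1 - al) / 16 in etc *.
have c00 : 0 < c0 by rewrite /c0; lra.
have k1 : (1 : R) <= k%:R by rewrite ler1n.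
(* Makes (k + 2) e equal to s - sg = et / 2, the whole margin between the working exponent s and the
   exponent sg of the Dirichlet sum. *)
pose e : R := et / 2 / (k%:R + 2).
have e0 : 0 < e by rewrite !divr_gt0//; lra.
have eE : (k%:R + 2) * e = et / 2 by rewrite /e; field; lra.
have [K [K0 hK]] := coset_sum e0.
have [K2 [K21 hK2]] := pairsum_total e0.
(* s1 is the midpoint of al and 1, so that kap stays above a multiple of 1 - al; t is then forced by
   s1 t = s, which gives the right power of h after interpolation. *)
pose s := al + et; pose s1 : R := (1 + al) / 2; pose t := s / s1; pose sg := al + et / 2.
have al2 : al * (1 - al) <= 1 - al by nra.
have al3 : al * (1 - al) <= al by nra.
have s10 : 0 < s1 by rewrite /s1; lra.
have t0 : 0 < t by rewrite divr_gt0// /s; lra.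
have t1 : t < 1 by rewrite ltr_pdivrMr// mul1r /s /s1; rewrite /c0 in etc; lra.
have tal : al <= t.
  rewrite ler_pdivlMr//; apply: (@le_trans _ _ (al * 1)); last by rewrite /s; lra.
  by rewrite ler_wpM2l ?(ltW al0)// /s1; lra.
have st : s1 * t = s by rewrite /t; field; lra.
have s01 : 0 <= s <= 1 by rewrite /s /c0 in etc *; apply/andP; split; lra.
have s101 : 0 <= s1 <= 1 by rewrite /s1; apply/andP; split; lra.
pose kap := s1 - k%:R * e / t - sg.
have ke : k%:R * e <= et / 2 by lra.
have ket : k%:R * e / t <= (1 - al) / 32.
  rewrite ler_pdivrMr//; apply: (le_trans ke).
  apply: (@le_trans _ _ ((1 - al) / 32 * al)); first by rewrite /c0 in etc; lra.
  by apply: ler_wpM2l => //; lra.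
have kap1 : (1 - al) / 4 <= kap by rewrite /kap /sg /s1; rewrite /c0 in etc; lra.
have kap0 : 0 <= kap by lra.
have kR : (0 : R) < k%:R by rewrite ltr0n.
have exB : k%:R * e - s <= - sg by rewrite /s /sg; lra.
have hsg : (k%:R + 2) * e <= s - sg by rewrite eE /s /sg; lra.
(* The savings T^(-s/4) and T^(-kap t), with T = h^(1/(4k)), must both be at most h^(-c0/k); hence
   the 16 in [c0]. *)
have cs : c0 <= s / 16 by rewrite /s /c0; lra.
have ckt : c0 <= kap * t / 4.
  have : (1 - al) / 4 * al <= kap * t by apply: ler_pM => //; lra.
  by rewrite /c0; lra.
have s40 : - (s / 4) <= 0 by rewrite /s; lra.
have ck : - (s / 4) <= - (c0 / k%:R).
  have : c0 / k%:R <= c0 by rewrite ler_pdivrMr// ler_peMr// ltW.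
  by lra.
have K3 : 0 <= 3 * (1 + K) by lra.
have K20 : 0 <= K2 by lra.
have K'1 : 1 <= 1 + K by lra.
have K'0 : 0 < 1 + K by lra.
clear aa al2 al3 tal ke ket kap1 eE etc s10.
pose X : R := (3 * (1 + K)) ^+ k * K2 * expR S * expR ((2 ^ k)%:R * S).
pose X' : R := (3 * (1 + K)) ^+ k * expR ((2 ^ k)%:R * S).
have X0 : 0 <= X by rewrite !mulr_ge0 ?exprn_ge0 ?expR_ge0.
have X'0 : 0 <= X' by rewrite !mulr_ge0 ?exprn_ge0 ?expR_ge0.
(* One X' for a small first denominator, one for a large [triple], and one X for each partner j of
   the first coordinate. *)
exists (2 * X' + k%:R * X); split; first by apply: addr_ge0; apply: mulr_ge0.
move=> I b hb hS h i0 h0.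
(* K is raised to 1 + K because [pair_total] wants a constant at least 1. *)
have hK' (D E : {set I}) (u : nat) : E \subset D ->
  \sum_(r < Q b | (supp b r == D) && (pr b E %| u + r)%N) wt R b h r
   <= (1 + K) * (pr b D)%:R `^ e * Num.min 1 (h%:R / (pr b D)%:R + ((pr b E)%:R)^-1).
  move=> ED; apply: (le_trans (hK I b hb h D E u ED)).
  rewrite -!mulrA; apply: ler_wpM2r; last by rewrite lerDr.
  by rewrite mulr_ge0 ?powR_ge0// le_min ler01 addr_ge0 ?invr_ge0 ?divr_ge0.
have h1 : (1 : R) <= h%:R by rewrite ler1n.
pose T : R := h%:R `^ (4 * k%:R)^-1.
have k4 : (0 : R) < (4 * k%:R)^-1 by rewrite invr_gt0 mulr_gt0.
have T1 : 1 <= T by apply: powR_ge1 => //; exact: ltW.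
have Th : T ^+ (4 * k) <= h%:R.
  rewrite /T powR_exprn natrM mulVf ?powRr1//.
  by rewrite gt_eqF// mulr_gt0.
pose hh : R := h%:R `^ (k%:R * s / 2); pose sav : R := h%:R `^ (- (c0 / k%:R)).
have hh0 : 0 <= hh by exact: powR_ge0.
have sav0 : 0 <= sav by exact: powR_ge0.
have base (D : {ffun 'I_k -> {set I}}) : (pr b (tcup D))%:R `^ (k%:R * e - s) <= (pr b (tcup D))%:R `^ (- sg) :> R.
  by apply: ler_powR; [exact: pr_ge1|].
have total (P : pred {ffun 'I_k -> {set I}}) (w : R) : 0 <= w ->
   (forall D, P D -> tsum R b h D xpredT <= (3 * (1 + K)) ^+ k * hh * (pr b (tcup D))%:R `^ (k%:R * e - s) * w) ->
   \sum_(D | P D) tsum R b h D xpredT <= X' * hh * w.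
  move=> w0 hP; apply: (le_trans (ler_sum _ hP)).
  apply: (@le_trans _ _ (\sum_(D : {ffun 'I_k -> {set I}}) (3 * (1 + K)) ^+ k * hh * w * (pr b (tcup D))%:R `^ (- sg))).
    rewrite big_mkcond; apply: ler_sum => D _.
    have z0 : 0 <= (3 * (1 + K)) ^+ k * hh * w by rewrite !mulr_ge0 ?exprn_ge0.
    case: ifP => _; last by rewrite mulr_ge0 ?powR_ge0.
    rewrite [leLHS](_ : _ = (3 * (1 + K)) ^+ k * hh * w * (pr b (tcup D))%:R `^ (k%:R * e - s)); last by ring.
    exact: ler_wpM2l.
  rewrite -mulr_sumr [leRHS](_ : _ = (3 * (1 + K)) ^+ k * hh * w * expR ((2 ^ k)%:R * S)); last by rewrite /X'; ring.
  apply: ler_wpM2l; first by rewrite !mulr_ge0 ?exprn_ge0.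
  exact: sum_tuples_bound.
have tA : \sum_(D : {ffun 'I_k -> {set I}}) tsum R b h D xpredT <= X' * hh.
  rewrite -[leRHS]mulr1; apply: total => // D _; rewrite mulr1.
  by apply: (tsum_basic hb K'0 hK') => //; exact: ltW.
have tB : \sum_(D : {ffun 'I_k -> {set I}} | (pr b (D i0))%:R <= h%:R `^ 2^-1 :> R)
    tsum R b h D xpredT <= X' * hh * sav.
  apply: total => // D dh.
  apply: (le_trans (tsum_small hb K'0 hK' h0 (ltW e0) s01 dh)).
  apply: ler_wpM2l; first by rewrite !mulr_ge0 ?powR_ge0 ?exprn_ge0.
  exact: ler_powR.
have kk : 0 <= k%:R^-1 :> R by rewrite invr_ge0.
have tC : \sum_(D : {ffun 'I_k -> {set I}} | T <= (pr b (triple D))%:R)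
    tsum R b h D xpredT <= X' * hh * sav.
  apply: total => // D TD.
  apply: (le_trans (tsum_mid hb K'0 hK' D h0 (ltW e0) s01)).
  apply: ler_wpM2l; first by rewrite !mulr_ge0 ?powR_ge0 ?exprn_ge0.
  apply: (@le_trans _ _ (T `^ (- (s / 4)))).
    apply: ler_npowR2 => //; first exact: lt_le_trans T1.
    rewrite le_min TD /=; apply: le_trans Th; apply: ler_eXnr => //; by rewrite muln_gt0 k0.
  rewrite /T -powRrM; apply: ler_powR => //.
  rewrite invfM [_ * - (s / 4)](_ : _ = - (k%:R^-1 * (s / 16))); last by field; rewrite gt_eqF.
  by rewrite lerN2 mulrC ler_wpM2l.
have tD j : j != i0 -> \sum_(D : {ffun 'I_k -> {set I}} | T <= (pr b (pairset i0 j D))%:R)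
    tsum R b h D (notopp i0 j) <= X * hh * sav.
  move=> j0; have i0j : i0 != j by rewrite eq_sym.
  have t01 : 0 < t < 1 by rewrite t0 t1.
  have := pair_total hb i0j e0 K'1 hK' h0 t01 s101 K21 T1 (hK2 I b hb) hS.
  rewrite st -/kap -/sg => /(_ hsg kap0) /le_trans; apply.
  rewrite -/X -/hh; apply: ler_wpM2l; first by rewrite mulr_ge0.
  rewrite /T -powRrM; apply: ler_powR => //.
  rewrite invfM [_ * - (kap * t)](_ : _ = - (k%:R^-1 * (kap * t / 4))); last by field; rewrite gt_eqF.
  by rewrite lerN2 mulrC ler_wpM2l.
have savE : h%:R `^ (k%:R * (al + et) / 2 - c0 / k%:R) = hh * sav by rewrite powR_expD // ltr0n.
have kX : 0 <= k%:R * X by rewrite mulr_ge0.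
have CE : (2 * X' + k%:R * X) * (hh * sav) =
  X' * hh * sav + X' * hh * sav + k%:R * (X * hh * sav) by ring.
split.
- rewrite (eq_bigl (fun r : {ffun 'I_k -> 'I_(Q b)} => (Q b %| \sum_i r i)%N && xpredT r)); last by move=> r; rewrite andbT.
  rewrite tuple_sum_partition; apply: (le_trans tA); rewrite -/s -/hh.
  by apply: ler_wpM2r => //; rewrite mulr2n mulrDl mul1r -addrA lerDl addr_ge0.
- rewrite tuple_sum_partition savE.
  apply: (le_trans (ler_sum _ (fun D _ => unpaired_cases hb i0 D T1 Th k0 h0))).
  rewrite !big_split /= -!big_mkcond /= exchange_big /=.
  have tD' : \sum_(j | j != i0) \sum_(D : {ffun 'I_k -> {set I}})
     (if T <= (pr b (pairset i0 j D))%:R then tsum R b h D (notopp i0 j) else 0) <= k%:R * (X * hh * sav).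
    apply: (@le_trans _ _ (\sum_(j < k) X * hh * sav)).
      rewrite [leLHS]big_mkcond; apply: ler_sum => j _; case: ifP => [j0|_].
        by rewrite -big_mkcond tD.
      by apply: mulr_ge0 => //; exact: mulr_ge0.
    by rewrite sumr_const card_ord -[leLHS]mulr_natl.
  rewrite CE; apply: lerD => //; exact: lerD.
- rewrite tuple_sum_partition savE.
  apply: (le_trans (ler_sum _ (fun D _ => multipaired_cases hb i0 D T1 Th k0 h0))).
  rewrite !big_split /= -!big_mkcond /=.
  rewrite CE -[leLHS]addr0; apply: lerD; first exact: lerD.
  by apply: mulr_ge0 => //; apply: mulr_ge0 => //; exact: mulr_ge0.
Qed.

End Unpaired.

(** * Additive characters *)

Section Characters.
Import fintype boot.finset.
Local Open Scope complex_scope.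
Variable R : realType.

(** With z = y/2, the mean value theorem gives sin z >= z cos z, hence sin y >= 2 z cos(z)^2, and
    cos(z)^2 >= 1/2. The factor 1/2 is enough in [norm_1Bzeta] because pi >= 2. *)
Lemma sin_ge_half (y : R) : 0 <= y <= pi / 2 -> y / 2 <= sin y.
Proof.
move=> /andP[y0 y1]; pose z := y / 2.
have yE : y = z *+ 2 by rewrite /z mulr2n; field.
have pi0 := pi_gt0 R.
have z0 : 0 <= z by rewrite /z; lra.
have sz : z * cos z <= sin z.
  move: z0; rewrite le_eqVlt => /orP[/eqP <-|z0]; first by rewrite mul0r sin0.
  have ds x : x \in `]0, z[%R -> is_derive x 1 (@sin R) (cos x).
    by move=> _; exact: is_derive_sin.
  have cs : {within `[0, z], continuous (@sin R)}%classic.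
    by apply: continuous_subspaceT => x; exact: continuous_sin.
  have [x] := MVT z0 ds cs; rewrite in_itv /= => /andP[x0 xz].
  rewrite sin0 !subr0 => ->; rewrite mulrC ler_wpM2r ?(ltW z0)//.
  have zp : z <= pi by rewrite /z; lra.
  have mono := @ltr_cos R; apply: ltW; rewrite mono// in_itv /=; apply/andP; split; lra.
have cz : 1 / 2 <= cos z ^+ 2.
  have := cos_mulr2n z; rewrite -yE => cy.
  have : 0 <= cos y by apply: cos_ge0_pihalf; apply/andP; split; lra.
  by rewrite cy mulr2n; lra.
have cz0 : 0 <= cos z by apply: cos_ge0_pihalf; rewrite /z; apply/andP; split; lra.
rewrite yE sin_mulr2n mulr2n -/z.
have := ler_wpM2l cz0 sz; rewrite mulrCA -expr2 => h1.
have := ler_wpM2l z0 cz; lra.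
Qed.

Definition ee (x : R) : R[i] := cos x +i* sin x.

Lemma eeD x y : ee (x + y) = ee x * ee y.
Proof. by apply/eqP; rewrite eq_complex /= cosD sinD; apply/andP; split; apply/eqP; ring. Qed.

Lemma ee0 : ee 0 = 1.
Proof. by rewrite /ee cos0 sin0. Qed.

Lemma eeX x n : ee x ^+ n = ee (x *+ n).
Proof. by elim: n => [|n IH]; rewrite ?expr0 ?mulr0n ?ee0// exprS mulrS eeD IH. Qed.

Lemma norm_ee x : `|ee x| = 1.
Proof. by rewrite normc_def /= cos2Dsin2 sqrtr1. Qed.

Lemma norm_real (x : R) : `|x%:C| = `|x|%:C.
Proof. by rewrite normc_def /= expr0n /= addr0 sqrtr_sqr. Qed.

Lemma norm_1Bee (y : R) : `|1 - ee (y *+ 2)| = (2 * `|sin y|)%:C.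
Proof.
have -> : 1 - ee (y *+ 2) = (- (2 * sin y))%:C * ('i%C * ee y).
  apply/eqP; rewrite eq_complex /= sin_mulr2n cos_mulr2n.
  have := cos2Dsin2 y => h; apply/andP; split; apply/eqP; last by ring.
  by rewrite (_ : cos y ^+ 2 = 1 - sin y ^+ 2); [ring|rewrite -h; ring].
have ni : `|'i%C : R[i]| = 1 by rewrite normc_def /= expr0n /= add0r expr1n sqrtr1.
by rewrite normrM (normrM 'i%C) norm_ee ni mulr1 mulr1 norm_real normrN normrM (ger0_norm (ler0n _ 2)).
Qed.

Variable N : nat.
Hypothesis N0 : (0 < N)%N.

Definition zeta : R[i] := ee (pi *+ 2 / N%:R).

Lemma zetaX n : zeta ^+ n = ee ((pi * n%:R / N%:R) *+ 2).
Proof. by rewrite /zeta eeX; congr ee; rewrite -[LHS]mulr_natr -[pi *+ 2]mulr_natr -[RHS]mulr_natr; ring. Qed.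

Lemma zetaN : zeta ^+ N = 1.
Proof.
have NN : N%:R != 0 :> R by rewrite pnatr_eq0 -lt0n.
by rewrite zetaX mulfK// /ee cos2pi sin2pi.
Qed.

Lemma norm_zeta n : `|zeta ^+ n| = 1.
Proof. by rewrite zetaX norm_ee. Qed.

Lemma norm_1Bzeta r : (r < N)%N ->
  (2 * (minn r (N - r))%:R / N%:R)%:C <= `|1 - zeta ^+ r|.
Proof.
have Np : (0 : R) < N%:R by rewrite ltr0n.
have low r' : (r'.*2 <= N)%N -> (2 * r'%:R / N%:R)%:C <= `|1 - zeta ^+ r'|.
  move=> rN; rewrite zetaX norm_1Bee lecR.
  have pi0 := pi_gt0 R; have pi2 := pi_ge2 R.
  have q0 : (0 : R) <= r'%:R / N%:R by rewrite divr_ge0.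
  have q1 : r'%:R / N%:R <= 1 / 2 :> R.
    by rewrite ler_pdivrMr// -(ler_nat R) -muln2 natrM in rN *; lra.
  have := @sin_ge_half (pi * r'%:R / N%:R); rewrite -mulrA => h.
  have hh : 0 <= (pi : R) * (r'%:R / N%:R) <= pi / 2.
    by apply/andP; split; [rewrite mulr_ge0// ltW|nra].
  have := h hh.
  have := ler_norm (sin ((pi : R) * (r'%:R / N%:R))).
  have : 2 * (r'%:R / N%:R) <= (pi : R) * (r'%:R / N%:R) by apply: ler_wpM2r.
  rewrite -mulrA; lra.
move=> rN; have [h|h] := leqP (r.*2) N.
  rewrite (_ : minn r (N - r) = r); first exact: low.
  by rewrite -addnn in h; lia.
rewrite (_ : minn r (N - r) = N - r)%N; last by rewrite -addnn in h; lia.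
have -> : `|1 - zeta ^+ r| = `|1 - zeta ^+ (N - r)|.
  transitivity (`|1 - zeta ^+ r| * `|zeta ^+ (N - r)|); first by rewrite norm_zeta mulr1.
  rewrite -normrM mulrBl mul1r -exprD subnKC ?(ltnW rN)//.
  by rewrite zetaN distrC.
by apply: low; rewrite -addnn in h *; lia.
Qed.

Lemma zeta_eq1 n : (zeta ^+ n == 1) = (N %| n)%N.
Proof.
apply/idP/idP => [|/dvdnP[m ->]]; last by rewrite mulnC exprM zetaN expr1n.
rewrite {1}(divn_eq n N) exprD mulnC exprM zetaN expr1n mul1r => /eqP z1.
have rN : (n %% N < N)%N by rewrite ltn_mod.
have := norm_1Bzeta rN; rewrite z1 subrr normr0 lecR => h.
have Np : (0 : R) < N%:R by rewrite ltr0n.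
have : (minn (n %% N) (N - n %% N))%:R <= 0 :> R.
  have : 2 * (minn (n %% N) (N - n %% N))%:R / N%:R <= 0 :> R by [].
  by rewrite pmulr_lle0 ?invr_gt0// pmulr_rle0.
rewrite lern0 /dvdn => /eqP; lia.
Qed.

Lemma sum_zeta n : \sum_(j < N) zeta ^+ (j * n) = (if (N %| n)%N then N%:R else 0).
Proof.
rewrite (eq_bigr (fun j : 'I_N => (zeta ^+ n) ^+ j)); last by move=> j _; rewrite mulnC exprM.
case: ifP => [|/negbT] h.
  have -> : zeta ^+ n = 1 by apply/eqP; rewrite zeta_eq1.
  by under eq_bigr do rewrite expr1n; rewrite sumr_const card_ord.
rewrite -zeta_eq1 -subr_eq0 in h.
apply: (mulfI h); rewrite mulr0 -subrX1 -exprM mulnC exprM zetaN expr1n subrr//.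
Qed.

Lemma sum_dvd_zeta e c n : N = (e * c)%N ->
  \sum_(r < N | (c %| r)%N) zeta ^+ (n * r) = (if (e %| n)%N then e%:R else 0).
Proof.
move=> NE; have c0 : (0 < c)%N by move: N0; rewrite NE muln_gt0 => /andP[].
have e0 : (0 < e)%N by move: N0; rewrite NE muln_gt0 => /andP[].
have -> : \sum_(r < N | (c %| r)%N) zeta ^+ (n * r) = \sum_(j < e) (zeta ^+ (n * c)) ^+ j.
  rewrite -(big_mkord (fun r => (c %| r)%N) (fun r => zeta ^+ (n * r))).
  rewrite -(big_mkord xpredT (fun j => (zeta ^+ (n * c)) ^+ j)) NE.
  elim: (e) => [|m IH]; first by rewrite mul0n !big_geq.
  rewrite mulSnr (big_cat_nat (n := (m * c)%N)) ?leq_addr//= IH big_nat_recr//=; congr (_ + _).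
  have lt : (m * c < m * c + c)%N by rewrite -[ltnLHS]addn0 ltn_add2l.
  rewrite big_ltn_cond//.
  rewrite dvdn_mull// big_nat_cond big_pred0 ?addr0 => [|r]; first by rewrite -exprM mulnA mulnAC.
  apply/negP => /andP[/andP[r1 r2] /dvdnP[q rE]].
  move: r1 r2; rewrite rE ltn_pmul2r// -mulSnr ltn_pmul2r// ltnS => r1 r2.
  by rewrite leqNgt r1 in r2.
case: ifP => [/dvdnP[q ->]|/negbT h].
  rewrite -mulnA -NE mulnC exprM zetaN expr1n.
  by under eq_bigr do rewrite expr1n; rewrite sumr_const card_ord.
have w1 : zeta ^+ (n * c) - 1 != 0.
  by rewrite subr_eq0 zeta_eq1 NE dvdn_pmul2r.
apply: (mulfI w1); rewrite mulr0 -subrX1 -exprM -mulnA [(c * e)%N]mulnC -NE mulnC exprM.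
by rewrite zetaN expr1n subrr.
Qed.

End Characters.

(** * Fourier expansion of the moments *)

Section Fourier.
Import fintype boot.finset.
Local Open Scope complex_scope.
Variable R : realType.
Variables (I : finType) (b : I -> nat).
Hypothesis hb : coprime_family b.
Variable h : nat.

Local Notation z := (zeta R (Q b)).
Let Q0 : (0 < Q b)%N := Q_gt0 hb.

Definition sieveind (m : nat) : R := \prod_i (1 - (b i %| m)%N%:R).
(** Fourier coefficient of [sieveind] at r/Q: a factor 1 - 1/b for each b dividing r, and -1/b for
    the others. *)
Definition gcoef (r : nat) : R := \prod_i ((b i %| r)%N%:R - (b i)%:R^-1).

Lemma prod_dvd (J : {set I}) (m : nat) :
  \prod_(i in J) (b i %| m)%N%:R = (pr b J %| m)%N%:R :> R.
Proof.
rewrite pr_dvd//; have [/forall_inP h1|] := boolP [forall (i | i \in J), (b i %| m)%N].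
  by apply: big1 => i /h1 ->.
rewrite negb_forall => /existsP; case=> i; rewrite negb_imply => /andP[iJ /negbTE ni].
by rewrite (bigD1 i)//= ni mul0r.
Qed.

Lemma prod_ifin (J : {set I}) (F G : I -> R) :
  \prod_i (if i \in J then F i else G i) = (\prod_(i in J) F i) * \prod_(i in ~: J) G i.
Proof.
rewrite (bigID (mem J)) /=; congr (_ * _); first by apply: eq_bigr => i ->.
by apply: eq_big => [i|i /negbTE ->//]; rewrite inE.
Qed.

Lemma gcoefE r : gcoef r =
  \sum_(J : {set I}) (\prod_(i in J) - ((b i)%:R^-1)) * (pr b (~: J) %| r)%N%:R.
Proof.
rewrite /gcoef (eq_bigr (fun i => - (b i)%:R^-1 + (b i %| r)%N%:R)); last by move=> i _; rewrite addrC.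
rewrite bigA_distr; apply: eq_big => // J _.
by rewrite -prod_dvd -(prod_ifin J (fun i => - (b i)%:R^-1) (fun i => (b i %| r)%N%:R)).
Qed.

Lemma sieveindE m : sieveind m =
  \sum_(J : {set I}) (\prod_(i in J) - ((b i)%:R^-1)) * (if (pr b J %| m)%N then (pr b J)%:R else 0).
Proof.
rewrite /sieveind (eq_bigr (fun i => - (b i %| m)%N%:R + 1)); last by move=> i _; rewrite addrC.
rewrite bigA_distr; apply: eq_big => // J _.
rewrite -[LHS]/(\prod_i (if i \in J then - (b i %| m)%N%:R else 1)) prod_ifin.
rewrite [X in _ * X]big1// mulr1.
have -> : (if (pr b J %| m)%N then (pr b J)%:R else 0) = (pr b J)%:R * (pr b J %| m)%N%:R :> R.
  by case: ifP; rewrite ?mulr1 ?mulr0.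
rewrite -prod_dvd mulrA /pr natr_prod -!big_split /=; apply: eq_bigr => i _.
have bi : (b i)%:R != 0 :> R by rewrite pnatr_eq0 -lt0n b_gt0.
by rewrite mulNr mulVf// mulN1r.
Qed.

(** Both sides expand over subsets J with the same coefficients, and [sum_dvd_zeta] identifies pr J
    times the indicator of its multiples with the sum over the frequencies divisible by the
    complementary product. *)
Lemma sieve_fourier m : (sieveind m)%:C = \sum_(r < Q b) (gcoef r)%:C * z ^+ (m * r).
Proof.
transitivity (\sum_(J : {set I}) (\prod_(i in J) - ((b i)%:R^-1) : R)%:C *
    \sum_(r < Q b | (pr b (~: J) %| r)%N) z ^+ (m * r)).
  rewrite sieveindE rmorph_sum /=; apply: eq_bigr => J _.
  rewrite rmorphM /=; congr (_ * _); rewrite (@sum_dvd_zeta _ _ Q0 (pr b J)); last by rewrite prC.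
  by case: ifP => _; rewrite ?rmorph_nat ?rmorph0.
under eq_bigr do rewrite mulr_sumr big_mkcond /=.
rewrite exchange_big /=; apply: eq_bigr => r _.
rewrite gcoefE rmorph_sum mulr_suml; apply: eq_bigr => J _ /=.
rewrite rmorphM /=; case: ifP => _; first by rewrite rmorph1 mulr1.
by rewrite rmorph0 mulr0 mul0r.
Qed.

(** Fourier coefficient of [devi]; the one at 0 is the mean that [devi] subtracts. *)
Definition cf (r : 'I_(Q b)) : R[i] :=
  if r == 0%N :> nat then 0 else (gcoef r)%:C * \sum_(1 <= j < h.+1) z ^+ (j * r).

Definition devi (n : nat) : R :=
  \sum_(1 <= j < h.+1) sieveind (n + j) - h%:R * \prod_i (1 - (b i)%:R^-1).

Lemma devi_fourier n : (devi n)%:C = \sum_r cf r * z ^+ (n * r).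
Proof.
rewrite /devi rmorphB /= rmorph_sum /=.
under eq_bigr do rewrite sieve_fourier.
rewrite exchange_big /= (bigD1 (Ordinal Q0))//= [RHS](bigD1 (Ordinal Q0))//=.
rewrite {1}/cf /= mul0r add0r.
under eq_bigr do rewrite muln0 expr0 mulr1.
rewrite sumr_const_nat subn1 /= -[_ *+ h]mulr_natl rmorphM /= rmorph_nat.
have -> : gcoef 0 = \prod_i (1 - (b i)%:R^-1) by apply: eq_bigr => i _; rewrite dvdn0.
rewrite addrAC subrr add0r; apply: eq_bigr => r r0.
have {}r0 : (r == 0%N :> nat) = false by apply: contraNF r0 => /eqP r0; apply/eqP/val_inj.
rewrite /cf r0 -mulrA; under [LHS]eq_bigr do rewrite mulnDl exprD.
by rewrite -mulr_sumr -mulr_sumr mulrC [in RHS]mulrA mulrC mulrA mulrAC; congr (_ * _); rewrite mulrC.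
Qed.

Lemma gcoef_bound r : `|gcoef r| <= (pr b (supp b r))%:R^-1.
Proof.
rewrite /gcoef normr_prod (bigID (mem (supp b r))) /= -[leRHS]mulr1.
have bi i : (1 : R) <= (b i)%:R by rewrite ler1n b_gt0.
have bv0 i : 0 <= (b i)%:R^-1 :> R by rewrite invr_ge0.
have bv1 i : (b i)%:R^-1 <= 1 :> R by rewrite invf_le1// (lt_le_trans ltr01).
apply: ler_pM; rewrite ?prodr_ge0//.
  rewrite natr_prod -prodfV; apply: ler_prod => i; rewrite inE => /negbTE ->.
  by rewrite mulr0n sub0r normr_ge0 normrN ger0_norm ?lexx.
apply: (@le_trans _ _ (\prod_(i | i \notin supp b r) 1)); last by rewrite big1.
apply: ler_prod => i; rewrite inE negbK => ->; rewrite normr_ge0 /= ger0_norm; have := bv0 i; have := bv1 i; lra.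
Qed.

Lemma norm_ReC (x : R[i]) : exists2 a : R, 0 <= a & `|x| = a%:C.
Proof. by rewrite normc_def; eexists; last by []; exact: sqrtr_ge0. Qed.

(** [gcoef] is at most 1/d in absolute value, and the geometric sum is at most h and at most 2/|1 -
    z^r| <= d / numer r. *)
Lemma cf_bound (r : 'I_(Q b)) : `|cf r| <= (wt R b h r)%:C.
Proof.
rewrite /cf /wt; case: eqP => [_|/eqP r0]; first by rewrite normr0 lecR.
set S := \sum_(_ <= _ < _) _.
have Sh : `|S| <= (h%:R)%:C.
  apply: (le_trans (ler_norm_sum _ _ _)); under eq_bigr do rewrite norm_zeta.
  by rewrite sumr_const_nat subn1 /= rmorph_nat.
have S2 : `|S| * `|1 - z ^+ r| <= 2.
  rewrite -normrM (_ : S * (1 - z ^+ r) = z ^+ r - z ^+ (h.+1 * r)).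
    apply: (le_trans (ler_normB _ _)); rewrite !norm_zeta//.
  rewrite mulrBr mulr1 /S mulr_suml; under [X in _ - X]eq_bigr do rewrite -exprD -mulSnr.
  rewrite -[X in _ - X](big_add1 _ _ 1 h.+2 xpredT (fun j => z ^+ (j * r))).
  have E1 : \sum_(1 <= j < h.+2) z ^+ (j * r) = z ^+ r + \sum_(2 <= j < h.+2) z ^+ (j * r).
    by rewrite big_ltn// mul1n.
  have E2 : \sum_(1 <= j < h.+2) z ^+ (j * r) =
     \sum_(1 <= j < h.+1) z ^+ (j * r) + z ^+ (h.+1 * r) by rewrite big_nat_recr.
  by rewrite -[X in X - _](addrK (z ^+ (h.+1 * r))) -E2 E1; ring.
have [n0 nd rE] := numerE hb (ltn_ord r) r0.
set d := pr b (supp b r) in nd rE *; set m := pr b (~: supp b r) in rE.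
have QE : Q b = (d * m)%N by rewrite prC.
have d0 : (0 : R) < d%:R by rewrite ltr0n pr_gt0.
have m0 : (0 : R) < m%:R by rewrite ltr0n pr_gt0.
have nn0 : (0 : R) < (numer b r)%:R by rewrite ltr0n.
have mn : minn r (Q b - r) = (numer b r * m)%N.
  have : (minn (r %/ m) (d - r %/ m) * m = minn r (Q b - r))%N.
    rewrite minnMl mulnBl -QE divnK//; exact: supp_dvd.
  by move=> <-.
have low := norm_1Bzeta R Q0 (ltn_ord r).
rewrite mn in low.
have lE : 2 * (numer b r * m)%:R / (Q b)%:R = 2 * (numer b r)%:R / d%:R :> R.
  have -> : (Q b)%:R = d%:R * m%:R :> R by rewrite -natrM -QE.
  by rewrite natrM; field; rewrite !gt_eqF.
rewrite lE in low.
have [a a0 aE] := norm_ReC S; have [t t0 tE] := norm_ReC (1 - z ^+ r).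
rewrite tE lecR in low; rewrite aE lecR in Sh.
have at2 : a * t <= 2.
  by move: S2; rewrite aE tE -rmorphM /= -(rmorph_nat (real_complex R) 2) lecR.
rewrite normrM norm_real aE -rmorphM lecR le_min; apply/andP; split.
  by rewrite mulrC; apply: ler_pM => //; exact: gcoef_bound.
have ad : a <= d%:R / (numer b r)%:R.
  rewrite ler_pdivlMr//.
  have : a * (2 * (numer b r)%:R / d%:R) <= 2 by apply: le_trans at2; apply: ler_wpM2l.
  have -> : a * (2 * (numer b r)%:R / d%:R) = 2 * (a * (numer b r)%:R) / d%:R by ring.
  by rewrite ler_pdivrMr//; lra.
apply: (@le_trans _ _ (d%:R^-1 * (d%:R / (numer b r)%:R))).
  by apply: ler_pM => //; exact: gcoef_bound.
by rewrite mulrA mulVf ?mul1r// gt_eqF.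
Qed.

Definition mom (k : nat) : R := (Q b)%:R^-1 * \sum_(n < Q b) devi n ^+ k.

Definition csum (k : nat) : R[i] :=
  \sum_(r : {ffun 'I_k -> 'I_(Q b)} | (Q b %| \sum_i r i)%N) \prod_i cf (r i).

Lemma mom_fourier k : (mom k)%:C = csum k.
Proof.
have QC : (Q b)%:R != 0 :> R[i] by rewrite pnatr_eq0 -lt0n.
rewrite /mom rmorphM /= fmorphV /= rmorph_nat; apply: (mulfI QC); rewrite mulVKf//.
rewrite rmorph_sum /=.
transitivity (\sum_(n < Q b) \sum_(r : {ffun 'I_k -> 'I_(Q b)})
    (\prod_i cf (r i)) * z ^+ (n * \sum_i r i)).
  apply: eq_bigr => n _; rewrite rmorphXn /= devi_fourier.
  have -> : (\sum_r cf r * z ^+ (n * r)) ^+ k = \prod_(i < k) \sum_r cf r * z ^+ (n * r).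
    by rewrite prodr_const card_ord.
  rewrite bigA_distr_bigA /=; apply: eq_bigr => f _; rewrite big_split /=; congr (_ * _).
  by rewrite big_distrr /= -expr_sum.
rewrite exchange_big /= /csum mulr_sumr [RHS]big_mkcond /=; apply: eq_bigr => f _.
rewrite -mulr_sumr sum_zeta//; case: ifP => _; first by rewrite mulrC.
by rewrite mulr0.
Qed.

(** Once r_0 + r_j is divisible by Q, so is the sum of the remaining coordinates: the sum
    factors. *)
Lemma csum_pair k (j : 'I_k.+2) : j != ord0 ->
  \sum_(r : {ffun 'I_k.+2 -> 'I_(Q b)} | (Q b %| \sum_i r i)%N && (Q b %| r ord0 + r j)%N)
     \prod_i cf (r i) =
  (\sum_(x : 'I_(Q b)) \sum_(y : 'I_(Q b) | (Q b %| x + y)%N) cf x * cf y) * csum k.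
Proof.
move=> j0; have [j' jE] : exists j' : 'I_k.+1, j = lift ord0 j'.
  by case: (unliftP ord0 j) => [j' ->|E]; [exists j'|rewrite E eqxx in j0].
rewrite big_mkcond (sum_ins ord0) mulr_suml; apply: eq_bigr => x _.
rewrite (sum_ins j') mulr_suml [RHS]big_mkcond; apply: eq_bigr => y _.
transitivity (\sum_(g : {ffun 'I_k -> 'I_(Q b)})
  if (Q b %| x + y)%N && (Q b %| \sum_i g i)%N then cf x * cf y * \prod_i cf (g i) else 0).
  apply: eq_bigr => g _.
  rewrite jE ins_id ins_lift ins_id.
  have sE : (\sum_i ins ord0 x (ins j' y g) i = x + y + \sum_i g i)%N.
    rewrite big_ord_recl ins_id -addnA; congr (_ + _)%N.
    rewrite (eq_bigr (fun i : 'I_k.+1 => nat_of_ord (ins j' y g i))); last first.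
      by move=> i _; rewrite ins_lift.
    rewrite (bigD1_ord j')//= ins_id; congr (_ + _)%N.
    by apply: eq_bigr => i _; rewrite ins_lift.
  have pE : \prod_i cf (ins ord0 x (ins j' y g) i) = cf x * cf y * \prod_i cf (g i).
    rewrite big_ord_recl ins_id -mulrA; congr (_ * _).
    rewrite (eq_bigr (fun i : 'I_k.+1 => cf (ins j' y g i))); last first.
      by move=> i _; rewrite ins_lift.
    rewrite (bigD1_ord j')//= ins_id; congr (_ * _).
    by apply: eq_bigr => i _; rewrite ins_lift.
  rewrite sE pE andbC; case: (boolP (Q b %| x + y)%N) => //= dxy.
  by rewrite dvdn_addr.
case: ifP => _ /=; last by rewrite big1.
by rewrite -big_mkcond /= -mulr_sumr.
Qed.

Lemma csum0 : csum 0 = 1.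
Proof.
rewrite /csum (eq_bigl xpredT) => [|r]; last by rewrite big_ord0 dvdn0.
under eq_bigr do rewrite big_ord0.
by rewrite sumr_const card_ffun !card_ord expn0.
Qed.

Lemma csum1 : csum 1 = 0.
Proof.
rewrite /csum big1// => r; rewrite !big_ord1 => Qr; rewrite /cf.
case: eqP => // /eqP r0; move: Qr; rewrite gtnNdvd// lt0n//.
Qed.

Lemma csum2 : csum 2 = \sum_(x : 'I_(Q b)) \sum_(y : 'I_(Q b) | (Q b %| x + y)%N) cf x * cf y.
Proof.
have := @csum_pair 0 ord_max isT; rewrite csum0 mulr1 => <-.
apply: eq_bigl => r; rewrite !big_ord_recl big_ord0 addn0.
rewrite (_ : lift ord0 ord0 = ord_max) ?andbb//; exact: val_inj.
Qed.

Definition paircount k (r : {ffun 'I_k.+2 -> 'I_(Q b)}) : nat :=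
  #|[set j | (j != ord0) && (Q b %| r ord0 + r j)%N]|.

(* Summing [csum_pair] over j counts each tuple [paircount r] times. *)
Lemma csum_rec k : csum k.+2 - k.+1%:R * csum 2 * csum k =
  \sum_(r : {ffun 'I_k.+2 -> 'I_(Q b)} | (Q b %| \sum_i r i)%N)
     \prod_i cf (r i) * (1 - (paircount r)%:R).
Proof.
under [RHS]eq_bigr do rewrite mulrBr mulr1.
rewrite big_split /= sumrN; congr (_ - _).
transitivity (\sum_(j : 'I_k.+2 | j != ord0) csum 2 * csum k).
  rewrite sumr_const (_ : #|_| = k.+1); first by rewrite -mulrA mulr_natl.
  rewrite -[RHS]/(k.+2.-1) -[in RHS](card_ord k.+2) -(cardC1 (ord0 : 'I_k.+2)).
  exact: eq_card.
transitivity (\sum_(j : 'I_k.+2 | j != ord0)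
  \sum_(r : {ffun 'I_k.+2 -> 'I_(Q b)} | (Q b %| \sum_i r i)%N)
     \prod_i cf (r i) * ((Q b %| r ord0 + r j)%N)%:R).
  apply: eq_bigr => j j0; rewrite csum2 -(csum_pair j0) big_mkcondr /=.
  by apply: eq_bigr => r _; case: ifP; rewrite ?mulr1 ?mulr0.
rewrite exchange_big /=; apply: eq_bigr => r _; rewrite -mulr_sumr; congr (_ * _).
rewrite /paircount -sum1_card natr_sum big_mkcond [RHS]big_mkcond /=; apply: eq_bigr => j _.
by rewrite inE; case: (j != ord0) => //=; case: ifP.
Qed.

Lemma csum_bound k : `|csum k| <= (\sum_(r : {ffun 'I_k -> 'I_(Q b)} | (Q b %| \sum_i r i)%N)
  \prod_i wt R b h (r i))%:C.
Proof.
apply: (le_trans (ler_norm_sum _ _ _)); rewrite rmorph_sum /=; apply: ler_sum => r _.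
rewrite normr_prod rmorph_prod /=; apply: ler_prod => i _; rewrite normr_ge0; exact: cf_bound.
Qed.

(** The factor 1 - paircount vanishes when exactly one coordinate cancels the first. It is 1 on
    unpaired tuples and at most k + 1 in absolute value on multipaired ones. *)
Lemma csum_rec_bound k : `|csum k.+2 - k.+1%:R * csum 2 * csum k| <=
  (\sum_(r : {ffun 'I_k.+2 -> 'I_(Q b)} | (Q b %| \sum_i r i)%N && unpaired ord0 r)
     \prod_i wt R b h (r i) +
   k.+1%:R * \sum_(r : {ffun 'I_k.+2 -> 'I_(Q b)} | (Q b %| \sum_i r i)%N && multipaired ord0 r)
     \prod_i wt R b h (r i))%:C.
Proof.
rewrite csum_rec; apply: (le_trans (ler_norm_sum _ _ _)).
rewrite rmorphD rmorphM /= !rmorph_sum /= mulr_sumr big_mkcondr /= [X in _ + X]big_mkcondr /=.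
rewrite -big_split /=; apply: ler_sum => r _.
have w0 : 0 <= (\prod_i wt R b h (r i))%:C.
  by rewrite ler0c; apply: prodr_ge0 => i _; exact: wt_ge0.
have pw : `|\prod_i cf (r i)| <= (\prod_i wt R b h (r i))%:C.
  rewrite normr_prod rmorph_prod /=; apply: ler_prod => i _; rewrite normr_ge0; exact: cf_bound.
rewrite normrM.
have ple : (paircount r <= k.+1)%N.
  rewrite -[k.+1]/(k.+2.-1) -[in leqRHS](card_ord k.+2) -(cardC1 (ord0 : 'I_k.+2)).
  by apply: subset_leq_card; apply/subsetP => j; rewrite inE => /andP[].
case E: (paircount r) => [|[|c]].
- rewrite subr0 normr1 mulr1 (_ : unpaired ord0 r); last first.
    apply/forallP => j; apply/implyP => j0; apply/negP => Qj.
    move/eqP: E; rewrite /paircount cards_eq0 => /eqP/setP/(_ j).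
    by rewrite !inE j0 Qj.
  rewrite -[leLHS]addr0; apply: lerD => //; case: ifP => // _.
  by rewrite mulr_ge0// ler0c.
- rewrite subrr normr0 mulr0; apply: addr_ge0; case: ifP => // _.
  by rewrite mulr_ge0// ler0c.
- rewrite (_ : multipaired ord0 r); last by rewrite /multipaired -/(paircount r) E.
  rewrite -[leLHS]add0r; apply: lerD; first by case: ifP.
  rewrite mulrC; apply: ler_pM => //.
  rewrite -natr1 opprD addrCA subrr addr0 normrN normr_nat rmorph_nat ler_nat.
  by rewrite E in ple; apply: leq_trans ple; rewrite ltnW.
Qed.

End Fourier.

(** * Gaussian recursion *)

Lemma mu_rec j : mu_ j.+2 = (j.+1 * mu_ j)%N.
Proof.
rewrite /mu_ /= negbK; case: ifP => oj; first by rewrite muln0.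
case: j oj => [|j] oj; first by rewrite big_mkcond big_nat1 big_geq.
rewrite big_mkcond big_nat_recr//= big_nat_recr//= -big_mkcond /=.
by rewrite -[~~ odd j]/(odd j.+1) oj /= muln1 mulnC.
Qed.

Lemma half_pred_lt k : (0 < k./2)%N -> (2 * (k./2).-1 < k)%N.
Proof.
have := odd_double_half k; case: (k./2) => // q <- _ /=.
by apply: leq_trans (leq_addl _ _); rewrite mul2n doubleS.
Qed.

Section FiniteMoments.
Local Open Scope complex_scope.
Variable R : realType.
Variables (al et S : R).
Hypothesis al01 : 0 < al < 1.
Hypothesis et0 : 0 < et.
Hypothesis etc : et <= al * (1 - al) / 16.

Let c0 := al * (1 - al) / 16.

Definition small_family (I : finType) (b : I -> nat) : Prop :=
  coprime_family b /\ \sum_i (b i)%:R `^ (- (al + et / 2)) <= S.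

Lemma norm_le_complex (x y : R) (u : R[i]) :
  x%:C = u -> `|u| <= y%:C -> `|x| <= y.
Proof. by move=> <-; rewrite norm_real lecR. Qed.

Lemma mom_bound j : exists C, 0 <= C /\
  forall (I : finType) (b : I -> nat), small_family b -> forall h, (0 < h)%N ->
  `|mom R b h j| <= C * h%:R `^ (j%:R * (al + et) / 2).
Proof.
case: j => [|j].
  exists 1; split=> // I b [hb hS] h h0.
  apply: (norm_le_complex (mom_fourier R hb h 0)); rewrite csum0 normr1.
  by rewrite !mul0r powRr0 mulr1 lexx.
have [C [C0 hC]] := tuple_totals S al01 (ltn0Sn j) et0 etc.
exists C; split=> // I b [hb hS] h h0.
have [h1 _ _] := hC I b hb hS h ord0 h0.
apply: (norm_le_complex (mom_fourier R hb h j.+1)).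
by apply: (le_trans (csum_bound R hb h j.+1)); rewrite lecR.
Qed.

(** Induction in steps of two through the recursion. The saving is c0/k for every j <= k, not c0/j,
    so that it stays the same along the induction. *)
Lemma mom_gauss (k j : nat) : (j <= k)%N -> (0 < k)%N -> exists C, 0 <= C /\
  forall (I : finType) (b : I -> nat), small_family b -> forall h, (0 < h)%N ->
  `|mom R b h j - (mu_ j)%:R * mom R b h 2 ^+ j./2|
    <= C * h%:R `^ (j%:R * (al + et) / 2 - c0 / k%:R).
Proof.
move=> jk k0; have /andP[al0 al1] := al01.
have c00 : 0 < c0 by rewrite /c0 divr_gt0// mulr_gt0// subr_gt0.
have : forall m, (m <= j)%N -> (exists C, 0 <= C /\
  forall (I : finType) (b : I -> nat), small_family b -> forall h, (0 < h)%N ->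
  `|mom R b h m - (mu_ m)%:R * mom R b h 2 ^+ m./2|
    <= C * h%:R `^ (m%:R * (al + et) / 2 - c0 / k%:R)); last exact.
have kp : (0 : R) < k%:R by rewrite ltr0n.
elim/ltn_ind => -[_ _|[_ _|m IH mj]].
- exists 0; split=> // I b [hb hS] h h0.
  have -> : mom R b h 0 = 1.
    by apply: (@complexI R); rewrite mom_fourier// csum0.
  by rewrite /mu_ /= big_geq// mulr1 subrr normr0 mul0r.
- exists 0; split=> // I b [hb hS] h h0.
  have -> : mom R b h 1 = 0.
    by apply: (@complexI R); rewrite mom_fourier// csum1.
  by rewrite /mu_ /= mul0r subrr normr0 mul0r.
have [C1 [C10 h1]] := IH m (leqnSn m.+1) (leq_trans (leqW (leqnSn m)) mj).
have [C2 [C20 h2]] := mom_bound 2.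
have [C3 [C30 h3]] := tuple_totals S al01 (ltn0Sn m.+1) et0 etc.
exists (C3 + m.+1%:R * C3 + m.+1%:R * C2 * C1); split.
  by rewrite !addr_ge0 ?mulr_ge0.
move=> I b hbS h h0; have [hb hS] := hbS.
have H1 : (1 : R) <= h%:R by rewrite ler1n.
have H0 : (0 : R) < h%:R by rewrite ltr0n.
have [_ u1 u2] := h3 I b hb hS h ord0 h0.
have mom2 := h2 I b hbS h h0; have momm := h1 I b hbS h h0.
have recm : `|mom R b h m.+2 - m.+1%:R * mom R b h 2 * mom R b h m| <=
   (C3 + m.+1%:R * C3) * h%:R `^ (m.+2%:R * (al + et) / 2 - c0 / k%:R).
  have := csum_rec_bound R hb h m; rewrite -!mom_fourier// -(rmorph_nat (real_complex R)).
  rewrite -!rmorphM -rmorphB norm_real lecR => /le_trans; apply.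
  have sv : h%:R `^ (m.+2%:R * (al + et) / 2 - al * (1 - al) / 16 / m.+2%:R) <=
     h%:R `^ (m.+2%:R * (al + et) / 2 - c0 / k%:R) :> R.
    apply: ler_powR => //; rewrite lerD2l lerN2 -/c0 ler_wpM2l ?(ltW c00)//.
    by rewrite lef_pV2 ?posrE// ?ltr0n// ler_nat (leq_trans mj).
  rewrite mulrDl; apply: lerD.
    by apply: (le_trans u1); apply: ler_wpM2l.
  rewrite -[leRHS]mulrA; apply: ler_wpM2l => //.
  by apply: (le_trans u2); apply: ler_wpM2l.
have -> : mom R b h m.+2 - (mu_ m.+2)%:R * mom R b h 2 ^+ (m.+2)./2 =
  (mom R b h m.+2 - m.+1%:R * mom R b h 2 * mom R b h m) +
  m.+1%:R * mom R b h 2 * (mom R b h m - (mu_ m)%:R * mom R b h 2 ^+ m./2).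
  by rewrite mu_rec natrM /= exprS; ring.
apply: (le_trans (ler_normD _ _)); rewrite mulrDl; apply: lerD => //.
rewrite normrM normrM normr_nat -[leLHS]mulrA.
set E := h%:R `^ _; rewrite [leRHS](_ : _ = m.+1%:R * ((C2 * C1) * E)); last by ring.
apply: ler_wpM2l => //.
apply: (@le_trans _ _ ((C2 * h%:R `^ (2%:R * (al + et) / 2)) *
   (C1 * h%:R `^ (m%:R * (al + et) / 2 - c0 / k%:R)))); first exact: ler_pM.
rewrite mulrACA -powR_expD//; apply: ler_wpM2l; first exact: mulr_ge0.
rewrite le_eqVlt; apply/orP; left; apply/eqP; congr (_ `^ _).
by rewrite -[m.+2]addn2 natrD; field; rewrite gt_eqF.
Qed.

(* The moments about M H, where H need not be an integer: here [dl] is M (H - h). *)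
Definition shmom (I : finType) (b : I -> nat) (h : nat) (dl : R) (k : nat) : R :=
  (Q b)%:R^-1 * \sum_(n < Q b) (devi R b h n - dl) ^+ k.

Lemma shmom_expand (I : finType) (b : I -> nat) h dl k :
  shmom b h dl k = \sum_(i < k.+1) (-1) ^+ i * dl ^+ i *+ 'C(k, i) * mom R b h (k - i).
Proof.
rewrite /shmom; under eq_bigr do rewrite exprBn.
rewrite exchange_big mulr_sumr /=; apply: eq_bigr => i _.
rewrite /mom mulrCA; congr (_ * _); rewrite mulr_sumr; apply: eq_bigr => n _.
by rewrite mulrnAl mulrAC.
Qed.

(** A shift of at most 1 brings in only moments of order below k, smaller by at least h^(al/2), and
    c0/k <= al/2. *)
Lemma shmom_gauss (k : nat) : (0 < k)%N -> exists C, 0 <= C /\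
  forall (I : finType) (b : I -> nat), small_family b -> forall h, (0 < h)%N ->
  forall dl, 0 <= dl <= 1 ->
  `|shmom b h dl k - (mu_ k)%:R * shmom b h dl 2 ^+ k./2|
    <= C * h%:R `^ (k%:R * (al + et) / 2 - c0 / k%:R).
Proof.
move=> k0; have /andP[al0 al1] := al01; have et0' : 0 < et := et0.
have kp : (1 : R) <= k%:R by rewrite ler1n.
have aa : 0 < al * (1 - al) by rewrite mulr_gt0// subr_gt0.
have aa1 : al * (1 - al) <= al by rewrite ler_piMr; lra.
have c00 : 0 < c0 by rewrite /c0; lra.
have c0k : c0 / k%:R <= al / 2.
  apply: (@le_trans _ _ c0); last by rewrite /c0; lra.
  by rewrite ler_pdivrMr ?ler_peMr//; lra.
have [C1 [C10 h1]] := mom_gauss (leqnn k) k0.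
have [C2 [C20 h2]] := mom_bound 2.
have hj : forall j, exists C, 0 <= C /\
  forall (I : finType) (b : I -> nat), small_family b -> forall h, (0 < h)%N ->
  `|mom R b h j| <= C * h%:R `^ (j%:R * (al + et) / 2) by exact: mom_bound.
have {hj} [Cf hCf] := boolp.choice hj.
(* C4 collects the lower terms of the binomial expansion, C5 the change in the power of the second
   moment. *)
pose C4 : R := \sum_(i < k) ('C(k, i.+1))%:R * Cf (k - i.+1)%N.
have C40 : 0 <= C4 by apply: sumr_ge0 => i _; rewrite mulr_ge0// (hCf _).1.
pose C5 : R := (mu_ k)%:R * ((k./2)%:R * (C2 + 1) ^+ (k./2).-1).
have C50 : 0 <= C5 by rewrite !mulr_ge0 ?exprn_ge0 ?addr_ge0.
exists (C1 + C4 + C5); split; first by rewrite !addr_ge0.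
move=> I b hbS h h0 dl /andP[dl0 dl1]; have [hb hS] := hbS.
have H1 : (1 : R) <= h%:R by rewrite ler1n.
have H0 : (0 : R) < h%:R by rewrite ltr0n.
set E := h%:R `^ (k%:R * (al + et) / 2 - c0 / k%:R).
have m1 : mom R b h 1 = 0 by apply: (@complexI R); rewrite mom_fourier// csum1.
have m0 : mom R b h 0 = 1 by apply: (@complexI R); rewrite mom_fourier// csum0.
(* The first moment is zero, so the shift adds just dl^2 <= 1 to the second. *)
have s2 : shmom b h dl 2 = mom R b h 2 + dl ^+ 2.
  rewrite shmom_expand !big_ord_recl big_ord0 /= !subn0 subnn.
  rewrite (_ : (2 - bump 0 0)%N = 1%N)// m1 m0 !bin0 (_ : 'C(2, bump 0 (bump 0 0)) = 1%N)//.
  rewrite /bump /= !expr0 !mulr1n; ring.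
have low (j : nat) : (j < k)%N -> h%:R `^ (j%:R * (al + et) / 2) <= E.
  move=> jk; apply: ler_powR => //.
  have : j%:R + 1 <= k%:R :> R by rewrite natr1 ler_nat.
  have p0 : 0 <= (al + et) / 2 by lra.
  by move=> /(ler_wpM2r p0); lra.
have t1 : `|shmom b h dl k - mom R b h k| <= C4 * E.
  rewrite shmom_expand big_ord_recl /= !expr0 bin0 mulr1n !mul1r subn0 addrAC subrr add0r.
  rewrite /C4 mulr_suml; apply: (le_trans (ler_norm_sum _ _ _)); apply: ler_sum => i _.
  rewrite /bump /= add1n normrM -mulrA; apply: ler_pM => //.
    rewrite normrMn normrM !normrX normrN normr1 expr1n mul1r -[leLHS]mulr_natl ler_piMr//.
    by rewrite exprn_ile1// ger0_norm.
  apply: (le_trans ((hCf _).2 I b hbS h h0)); apply: ler_wpM2l; first exact: (hCf _).1.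
  by apply: low; rewrite ltn_subrL k0.
have t2 : `|(mu_ k)%:R * mom R b h 2 ^+ k./2 - (mu_ k)%:R * shmom b h dl 2 ^+ k./2| <= C5 * E.
  rewrite -mulrBr normrM normr_nat /C5 -mulrA; apply: ler_wpM2l => //.
  set M2 := mom R b h 2.
  have hs : h%:R `^ (2%:R * (al + et) / 2) = h%:R `^ (al + et) by congr (_ `^ _); field.
  have M2b : `|M2| <= C2 * h%:R `^ (al + et) by rewrite -hs; exact: h2.
  have hs1 : 1 <= h%:R `^ (al + et) :> R by apply: powR_ge1 => //; lra.
  have d2 : 0 <= dl ^+ 2 <= 1 by rewrite exprn_ge0//= exprn_ile1.
  have X1 : `|M2| <= (C2 + 1) * h%:R `^ (al + et) by lra.
  have X2 : `|shmom b h dl 2| <= (C2 + 1) * h%:R `^ (al + et).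
    rewrite s2 -/M2; apply: (le_trans (ler_normD _ _)); rewrite (@ger0_norm _ (dl ^+ 2)); lra.
  have [k2|k2] := posnP k./2.
    by rewrite k2 !expr0 subrr normr0 mul0r mul0r.
  rewrite subrXX normrM.
  apply: (@le_trans _ _ (1 * ((k./2)%:R * ((C2 + 1) * h%:R `^ (al + et)) ^+ (k./2).-1))).
    apply: ler_pM => //.
      by rewrite s2 opprD addNKr normrN ger0_norm; lra.
    apply: (le_trans (ler_norm_sum _ _ _)).
    apply: (@le_trans _ _ (\sum_(i < k./2) ((C2 + 1) * h%:R `^ (al + et)) ^+ (k./2).-1)); last first.
      by rewrite sumr_const card_ord -[leLHS]mulr_natl.
    apply: ler_sum => i _; rewrite normrM !normrX.
    have -> : (k./2).-1 = ((k./2).-1 - i + i)%N by rewrite subnK// -ltnS prednK.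
    rewrite exprD; apply: ler_pM; rewrite ?exprn_ge0//.
      by rewrite addnK; apply: lerXn2r; rewrite ?nnegrE// (le_trans _ X1).
    by apply: lerXn2r; rewrite ?nnegrE// (le_trans _ X1).
  rewrite mul1r exprMn -!mulrA; apply: ler_wpM2l => //; apply: ler_wpM2l.
    by rewrite exprn_ge0// addr_ge0.
  rewrite powR_exprn.
  have kk := half_pred_lt k2.
  apply: le_trans (low _ kk); rewrite natrM le_eqVlt; apply/orP; left; apply/eqP.
  by congr (_ `^ _); field.
have -> : shmom b h dl k - (mu_ k)%:R * shmom b h dl 2 ^+ k./2 =
  (mom R b h k - (mu_ k)%:R * mom R b h 2 ^+ k./2) + (shmom b h dl k - mom R b h k) +
  ((mu_ k)%:R * mom R b h 2 ^+ k./2 - (mu_ k)%:R * shmom b h dl 2 ^+ k./2) by ring.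
rewrite !mulrDl; apply: (le_trans (ler_normD _ _)); apply: lerD => //.
apply: (le_trans (ler_normD _ _)); apply: lerD => //; exact: h1.
Qed.

End FiniteMoments.

Local Open Scope classical_set_scope.
Local Open Scope ring_scope.

(** * Mean values *)

Section MeanValues.
Variable R : realType.

Lemma count_in_sum (J : set nat) (n : nat) (H : R) : 0 <= H ->
  count_in J n%:R (n%:R + H) = (\sum_(1 <= j < (Num.truncn H).+1) (n + j \in J))%N.
Proof.
move=> H0; set h := Num.truncn H.
pose s := [seq (n + j)%N | j <- iota 1 h & (n + j \in J)%N].
have us : uniq s.
  by rewrite map_inj_uniq ?filter_uniq ?iota_uniq// => i j /addnI.
rewrite /count_in (_ : [set m : nat | _] = [set` seq_fset tt s]).
  rewrite set_fsetK size_seq_fset undup_id// size_map size_filter.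
  rewrite -sum1_count /index_iota subn1 /= big_mkcond /=.
  by apply: eq_bigr => j _; case: (_ \in _).
apply/seteqP; split => m.
  move=> [Jm /andP[nm mH]]; suff : m \in seq_fset tt s by [].
  rewrite seq_fsetE; rewrite ltr_nat in nm.
  apply/mapP; exists (m - n)%N; last by rewrite subnKC// ltnW.
  rewrite mem_filter subnKC ?(ltnW nm)// mem_set//= mem_iota subn_gt0 nm add1n ltnS.
  by rewrite /h truncn_ge_nat// natrB ?(ltnW nm)// lerBlDl.
move=> ms; have : m \in seq_fset tt s by [].
rewrite seq_fsetE => /mapP[j]; rewrite mem_filter mem_iota add1n ltnS => /and3P[Jj j1 jh] ->.
split; first exact/set_mem.
by rewrite ltr_nat -[ltnLHS]addn0 ltn_add2l j1 natrD lerD2l -truncn_ge_nat.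
Qed.

(** [C_] is a bare [lim], so the existence of the limit must come out of the argument: f is Cauchy
    at infinity, being eventually within eps of a constant for every eps. *)
Lemma lim_approx (f : R -> R) (A : nat -> R) :
  (forall eps, 0 < eps -> exists y0, forall y, (y0 <= y)%N ->
     \forall X \near +oo, `|f X - A y| <= eps) ->
  A y @[y --> \oo] --> lim (f X @[X --> +oo]).
Proof.
move=> hA.
have cf : cvg (f X @[X --> +oo]).
  apply/cauchy_cvgP; apply: cauchy_exP => eps e0.
  have e20 : 0 < eps / 2 by lra.
  have [y0 /(_ y0 (leqnn _)) hy] := hA _ e20; exists (A y0).
  near=> X; rewrite /ball /= /ball_ distrC.
  by apply: (@le_lt_trans _ _ (eps / 2)); [near: X|lra].
apply/cvgrPdist_le => eps e0.
have e20 : 0 < eps / 2 by lra.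
have [y0 hy] := hA _ e20; exists y0 => // y /= y0y.
have /cvgrPdist_le /(_ _ e20) hL := cf.
have [X [h1 h2]] := filter_ex (filterI (hy y y0y) hL).
rewrite -(subrK (f X) (lim _)) -addrA; apply: (le_trans (ler_normD _ _)).
rewrite [leRHS](_ : eps = eps / 2 + eps / 2); last by field.
exact: lerD.
Unshelve. all: by end_near. Qed.

Lemma periodic_sum (a : nat -> R) (P q r : nat) : (forall n, a (n + P)%N = a n) ->
  \sum_(0 <= n < q * P + r) a n = q%:R * \sum_(0 <= n < P) a n + \sum_(0 <= n < r) a n.
Proof.
move=> aP; elim: q => [|q IH]; first by rewrite mul0n add0n mul0r add0r.
rewrite mulSn -addnA (big_cat_nat (n := P)) ?leq_addr//=.
rewrite -{2}[P]add0n big_addn addKn; under [X in _ + X]eq_bigr do rewrite aP.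
by rewrite IH -natr1 mulrDl mul1r addrCA addrA.
Qed.

(** The incomplete last period and the rounding of X/P each cost at most P M before division by
    X. *)
Lemma periodic_mean (a : nat -> R) (P : nat) (M eps : R) : (0 < P)%N ->
  (forall n, a (n + P)%N = a n) -> (forall n, `|a n| <= M) -> 0 < eps ->
  \forall X \near +oo,
    `|X^-1 * (\sum_(1 <= n < (Num.truncn X).+1) a n) - P%:R^-1 * \sum_(n < P) a n| <= eps.
Proof.
move=> P0 aP aM e0.
have M0 : 0 <= M by apply: le_trans (aM 0%N).
have Pp : (0 : R) < P%:R by rewrite ltr0n.
have P1 : (1 : R) <= P%:R by rewrite ler1n.
near=> X.
have X1 : 1 <= X by near: X; exact: nbhs_pinfty_ge.
have X0 : 0 < X by lra.
have XE : 2 * P%:R * M / eps <= X by near: X; apply: nbhs_pinfty_ge; rewrite num_real.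
set N := Num.truncn X.
have /andP[NX XN] := truncn_itv (ltW X0); rewrite -/N in NX XN.
pose a' n := a n.+1.
have a'P n : a' (n + P)%N = a' n by rewrite /a' -addSn aP.
rewrite big_add1 /= -/a' {1}(divn_eq N P) periodic_sum//.
have SE : \sum_(0 <= n < P) a' n = \sum_(n < P) a n.
  case: (P) P0 aP => // p _ ap.
  rewrite big_nat_recr//= big_mkord big_ord_recl /= addrC; congr (_ + _).
  by rewrite /a' -[in RHS](ap 0%N).
rewrite SE; set S := \sum_(n < P) a n.
set T := \sum_(0 <= n < N %% P) a' n.
have SM : `|S| <= P%:R * M.
  apply: (le_trans (ler_norm_sum _ _ _)); apply: (@le_trans _ _ (\sum_(n < P) M)); first exact: ler_sum.
  by rewrite sumr_const card_ord -[leLHS]mulr_natl.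
have TM : `|T| <= P%:R * M.
  apply: (le_trans (ler_norm_sum _ _ _)); apply: (@le_trans _ _ (\sum_(0 <= n < N %% P) M)).
    by apply: ler_sum => n _; exact: aM.
  rewrite sumr_const_nat subn0 -[leLHS]mulr_natl; apply: ler_wpM2r => //.
  by rewrite ler_nat ltnW// ltn_mod.
have -> : X^-1 * ((N %/ P)%:R * S + T) - P%:R^-1 * S =
  X^-1 * (((N %/ P)%:R - X / P%:R) * S + T) by field; rewrite !gt_eqF.
rewrite normrM gtr0_norm ?invr_gt0// ler_pdivrMl//.
apply: (@le_trans _ _ (2 * P%:R * M)); last by rewrite ler_pdivrMr// in XE.
apply: (le_trans (ler_normD _ _)).
have qX : `|(N %/ P)%:R - X / P%:R| <= 1.
  have NE : N%:R = (N %/ P)%:R * P%:R + (N %% P)%:R :> R by rewrite -natrM -natrD -divn_eq.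
  have rP : (N %% P)%:R + 1 <= P%:R :> R by rewrite natr1 ler_nat ltn_mod.
  have r0 : (0 : R) <= (N %% P)%:R by [].
  have u1 : X / P%:R <= (N %/ P)%:R + 1.
    by rewrite ler_pdivrMr// mulrDl mul1r; move: XN; rewrite -natr1 NE; lra.
  have u2 : (N %/ P)%:R <= X / P%:R by rewrite ler_pdivlMr//; move: NX; rewrite NE; lra.
  by rewrite ler_norml; apply/andP; split; lra.
have : `|((N %/ P)%:R - X / P%:R) * S| <= 1 * (P%:R * M) by rewrite normrM; exact: ler_pM.
lra.
Unshelve. all: by end_near. Qed.

End MeanValues.

(** * Truncation of the sieving set *)

Section Truncation.
Variable R : realType.
Variable B : set nat.
Hypothesis B2 : forall b, B b -> (2 <= b)%N.
Hypothesis Bcop : forall a b, B a -> B b -> a != b -> coprime a b.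

Local Notation below y := {i : 'I_y | (i : nat) \in B}.
Definition bfam (y : nat) (i : below y) : nat := val i.

Lemma big_below (T : Type) (idx : T) (op : Monoid.com_law idx) y (F : nat -> T) :
  \big[op/idx]_(i : below y) F (bfam i) = \big[op/idx]_(0 <= b < y | b \in B) F b.
Proof.
rewrite big_mkord.
rewrite [RHS](@reindex_omap _ _ _ _ _ (val : below y -> 'I_y) insub) => [|i iB].
  by apply: eq_bigl => i; rewrite valK eqxx (valP i).
by case: insubP => [u _ /= <-//|]; rewrite iB.
Qed.

Lemma bfam_coprime y : coprime_family (@bfam y).
Proof.
have Bi (i : below y) : B (bfam i) by apply/set_mem; exact: (valP i).
split=> [i|i j ij]; first exact: B2.
apply: Bcop => //; apply: contra ij => /eqP ij; exact/eqP/val_inj/val_inj.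
Qed.

Definition Mtrunc (n : nat) : R := \prod_(0 <= b < n | b \in B) (1 - b%:R^-1).

Lemma Mtrunc_factor b : b \in B -> 0 <= 1 - (b%:R^-1 : R) <= 1.
Proof.
move=> /set_mem /B2 b2; have b1 : (1 : R) <= b%:R by rewrite ler1n ltnW.
have : b%:R^-1 <= 1 :> R by rewrite invf_le1// (lt_le_trans ltr01).
have : 0 <= b%:R^-1 :> R by rewrite invr_ge0.
by move=> *; apply/andP; split; lra.
Qed.

Lemma Mtrunc01 y : 0 <= Mtrunc y <= 1.
Proof.
rewrite /Mtrunc; elim/big_rec: _ => [|b x /Mtrunc_factor /andP[b0 b1] /andP[x0 x1]].
  by rewrite ler01 lexx.
by rewrite mulr_ge0//= mulr_ile1.
Qed.

Lemma Mtrunc_cvg : Mtrunc y @[y --> \oo] --> M_ R B.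
Proof.
apply: nonincreasing_is_cvgn => [m n mn|]; last first.
  by exists 0 => _ [y _ <-]; have /andP[] := Mtrunc01 y.
rewrite /Mtrunc (big_cat_nat (n := m) (m := 0%N) (p := n))//=.
apply: ler_piMr; first by have /andP[] := Mtrunc01 m.
elim/big_rec: _ => // b x bB x1; have /andP[b0 b1] := Mtrunc_factor bB.
have [x0|x0] := leP 0 x; first by rewrite mulr_ile1.
by apply: (@le_trans _ _ 0) => //; rewrite mulr_ge0_le0// ltW.
Qed.

Lemma sieveind01 y m : sieveind R (@bfam y) m =
  ([forall i : below y, ~~ (bfam i %| m)%N])%:R.
Proof.
rewrite /sieveind; case: (boolP [forall _, _]) => [/forallP h|].
  by apply: big1 => i _; rewrite (negbTE (h i)) subr0.
rewrite negb_forall => /existsP; case=> i; rewrite negbK => bi.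
by rewrite (bigD1 i)//= bi subrr mul0r.
Qed.

Definition bind (m : nat) : R := (m \in Bfree B)%:R.

(** If the two indicators differ, some b >= y of B divides m, and b <= m. *)
Lemma bind_sieve y m : (0 < m)%N -> `|bind m - sieveind R (@bfam y) m| <=
  \sum_(y <= b < m.+1 | b \in B) (b %| m)%N%:R.
Proof.
move=> m0; rewrite sieveind01 /bind.
have s0 : 0 <= \sum_(y <= b < m.+1 | b \in B) (b %| m)%N%:R :> R by apply: sumr_ge0.
have Bi (i : below y) : B (bfam i) by apply/set_mem; exact: (valP i).
have [mB|mB] := boolP (m \in Bfree B).
  have [_ hm] := set_mem mB.
  by rewrite (_ : [forall i, _]) ?subrr ?normr0//; apply/forallP => i; exact/hm/Bi.
case: (boolP [forall i : below y, _]) => [/forallP fr|_]; last by rewrite subrr normr0.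
rewrite sub0r normrN normr1.
have [b [Bb bm]] : exists b, B b /\ (b %| m)%N.
  apply: contrapT => nb; move/negP: mB; apply; apply/mem_set; split=> // b Bb.
  by apply/negP => bm; apply: nb; exists b.
have yb : (y <= b)%N.
  rewrite leqNgt; apply/negP => by_.
  have bB : (Ordinal by_ : nat) \in B by exact: mem_set.
  by have := fr (exist _ (Ordinal by_) bB); rewrite /bfam /= bm.
have bm1 : (b < m.+1)%N by rewrite ltnS dvdn_leq.
rewrite (big_cat_nat (n := b))//=; last exact: ltnW.
rewrite [X in _ <= _ + X]big_ltn_cond// (mem_set Bb) bm.
have a0 : 0 <= \sum_(y <= i < b | i \in B) (i %| m)%N%:R :> R by apply: sumr_ge0.
have c0 : 0 <= \sum_(b.+1 <= i < m.+1 | i \in B) (i %| m)%N%:R :> R by apply: sumr_ge0.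
by rewrite mulr1n; lra.
Qed.

Section Tail.
Variables (s S : R).
Hypothesis s1 : s < 1.
Hypothesis hS : forall y, \sum_(1 <= b < y | b \in B) b%:R `^ (- s) <= S.

Lemma S_ge0 : 0 <= S.
Proof. by have := hS 0; rewrite big_geq. Qed.

(** For b >= y, 1/b = b^(-s) b^(s-1) <= b^(-s) y^(s-1), because s < 1. *)
Lemma tail_bound y n : (0 < y)%N ->
  \sum_(y <= b < n | b \in B) b%:R^-1 <= S * y%:R `^ (s - 1).
Proof.
move=> y0; have yp : (0 : R) < y%:R by rewrite ltr0n.
have [yn|ny] := leqP y n; last first.
  by rewrite big_geq ?(ltnW ny)// mulr_ge0 ?powR_ge0 ?S_ge0.
apply: (@le_trans _ _ (\sum_(y <= b < n | b \in B) b%:R `^ (- s) * y%:R `^ (s - 1))).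
  rewrite big_nat_cond [leRHS]big_nat_cond; apply: ler_sum => b /andP[/andP[yb _] _].
  have bp : (0 : R) < b%:R by rewrite ltr0n (leq_trans y0).
  have -> : b%:R^-1 = b%:R `^ (- s) * b%:R `^ (s - 1) :> R.
    by rewrite -powR_expD// (_ : - s + (s - 1) = -1) ?powR_inv1 ?(ltW bp)//; ring.
  apply: ler_wpM2l; first exact: powR_ge0.
  by apply: ler_npowR2 => //; [rewrite subr_le0 ltW|rewrite ler_nat].
rewrite -mulr_suml; apply: ler_wpM2r; first exact: powR_ge0.
apply: le_trans (hS n); rewrite (big_cat_nat (m := 1%N) (n := y) (p := n))//= lerDr.
by apply: sumr_ge0 => *; exact: powR_ge0.
Qed.

Lemma tail_small (c eps : R) : 0 <= c -> 0 < eps -> exists y0, (0 < y0)%N /\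
  forall y, (y0 <= y)%N -> c * (S * y%:R `^ (s - 1)) <= eps.
Proof.
move=> c0 e0; have S0 := S_ge0; have s1' : 0 < 1 - s by rewrite subr_gt0.
pose w : R := ((c * S + 1) / eps) `^ (1 - s)^-1.
have cS : 0 <= c * S by rewrite mulr_ge0.
exists (Num.truncn w).+1; split=> // y wy.
have wy' : w <= y%:R.
  by apply: ltW; apply: lt_le_trans (truncnS_gt _) _; rewrite ler_nat.
have yp : (0 : R) < y%:R by rewrite ltr0n (leq_trans _ wy).
have : (c * S + 1) / eps <= y%:R `^ (1 - s).
  have -> : (c * S + 1) / eps = w `^ (1 - s).
    by rewrite /w -powRrM mulVf ?gt_eqF// powRr1// divr_ge0 ?addr_ge0// ltW.
  by apply: ler_powR2; rewrite ?powR_ge0 ?(ltW s1').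
have -> : y%:R `^ (s - 1) = (y%:R `^ (1 - s))^-1 :> R by rewrite -powRN opprB.
move=> h1; rewrite ler_pdivrMr// in h1.
rewrite mulrA ler_pdivrMr; last exact: powR_gt0.
by rewrite [leRHS]mulrC; lra.
Qed.

Variables (H : R).
Hypothesis H1 : 1 <= H.
Let h := Num.truncn H.

Lemma h_itv : h%:R <= H < h%:R + 1.
Proof. by rewrite natr1; apply: truncn_itv; exact: le_trans H1. Qed.

Definition bdev (n : nat) : R := \sum_(1 <= j < h.+1) bind (n + j) - M_ R B * H.
Definition ydev (y n : nat) : R :=
  \sum_(1 <= j < h.+1) sieveind R (@bfam y) (n + j) - Mtrunc y * H.

Lemma M01 : 0 <= M_ R B <= 1.
Proof.
have c := Mtrunc_cvg; apply/andP; split.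
  by rewrite /M_; apply: limr_ge; [exact: cvgP c|]; near=> y; have /andP[] := Mtrunc01 y.
by rewrite /M_; apply: limr_le; [exact: cvgP c|]; near=> y; have /andP[] := Mtrunc01 y.
Unshelve. all: by end_near. Qed.

Lemma dev_bound (F : nat -> R) (M : R) n : (forall m, 0 <= F m <= 1) -> 0 <= M <= 1 ->
  `|\sum_(1 <= j < h.+1) F (n + j)%N - M * H| <= H.
Proof.
move=> F01 /andP[M0 M1].
have /andP[hH _] := h_itv.
have s0 : 0 <= \sum_(1 <= j < h.+1) F (n + j)%N by apply: sumr_ge0 => j _; have /andP[] := F01 (n + j)%N.
have s1' : \sum_(1 <= j < h.+1) F (n + j)%N <= h%:R.
  apply: (@le_trans _ _ (\sum_(1 <= j < h.+1) 1)).
    by apply: ler_sum => j _; have /andP[] := F01 (n + j)%N.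
  by rewrite sumr_const_nat subn1.
have H0 : 0 <= H by have := H1; lra.
have m0 : 0 <= M * H by rewrite mulr_ge0.
have m1 : M * H <= H by rewrite ler_piMl.
by rewrite ler_norml; apply/andP; split; lra.
Qed.

Lemma bind01 m : 0 <= bind m <= 1.
Proof. by rewrite /bind; case: (_ \in _); rewrite ?lexx ?ler01. Qed.

Lemma sieve01 y m : 0 <= sieveind R (@bfam y) m <= 1.
Proof. by rewrite sieveind01; case: [forall _, _]; rewrite ?lexx ?ler01. Qed.

Lemma ler_normXB (k : nat) (u v c : R) : `|u| <= c -> `|v| <= c ->
  `|u ^+ k - v ^+ k| <= k%:R * c ^+ k.-1 * `|u - v|.
Proof.
move=> uc vc; have c0 : 0 <= c by apply: le_trans uc.
case: k => [|k]; first by rewrite !expr0 subrr normr0 !mul0r.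
rewrite subrXX normrM mulrC; apply: ler_wpM2r => //=.
apply: (le_trans (ler_norm_sum _ _ _)).
apply: (@le_trans _ _ (\sum_(i < k.+1) c ^+ k)); last first.
  by rewrite sumr_const card_ord -[leLHS]mulr_natl.
apply: ler_sum => i _; rewrite normrM !normrX.
have ik : (i <= k)%N by rewrite -ltnS ltn_ord.
rewrite -[in leRHS](subnK ik) exprD.
by apply: ler_pM; rewrite ?exprn_ge0//; apply: lerXn2r; rewrite ?nnegrE.
Qed.

Lemma dvd_count b N j : (j <= h)%N -> (0 < b)%N ->
  \sum_(1 <= n < N.+1) (b %| n + j)%N%:R <= (N + h)%:R * b%:R^-1 :> R.
Proof.
move=> jh b0; have bp : (0 : R) < b%:R by rewrite ltr0n.
rewrite -natr_sum ler_pdivlMr// -natrM ler_nat.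
apply: leq_trans (leq_trunc_div (N + h) b); rewrite leq_mul2r; apply/orP; right.
rewrite divn_count_dvd.
have -> : (\sum_(1 <= n < N.+1) (b %| n + j) = \sum_(j.+1 <= m < (N + j).+1) (b %| m))%N.
  by rewrite -[j.+1]add1n big_addn -addSn addnK.
rewrite (@leq_trans (\sum_(1 <= m < (N + j).+1) (b %| m))%N)//.
  by rewrite [leqRHS](big_cat_nat (n := j.+1))//= ?leq_addl// ltnS leq_addl.
by rewrite [leqRHS](big_cat_nat (n := (N + j).+1))//= ?leq_addr// ltnS leq_add2l.
Qed.

(** Uniform in X. The number of triples n <= N, j <= h, b >= y with b dividing n + j is at most h (N
    + h) times the tail of the sum of 1/b, and N + h <= X (1 + h) since X >= 1. *)
Lemma avg_diff (k y : nat) (X : R) : (0 < y)%N -> 1 <= X ->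
  `|X^-1 * (\sum_(1 <= n < (Num.truncn X).+1) bdev n ^+ k) -
    X^-1 * (\sum_(1 <= n < (Num.truncn X).+1) ydev y n ^+ k)| <=
  k%:R * H ^+ k.-1 * (h%:R * (1 + h%:R)) * (S * y%:R `^ (s - 1)) +
  k%:R * H ^+ k * `|M_ R B - Mtrunc y|.
Proof.
move=> y0 X1; have X0 : 0 < X by lra.
have H0 : 0 < H by apply: lt_le_trans H1.
set N := Num.truncn X; have /andP[NX _] := truncn_itv (ltW X0); rewrite -/N in NX.
set c := k%:R * H ^+ k.-1; have c0 : 0 <= c by rewrite mulr_ge0 ?exprn_ge0 ?(ltW H0).
pose dM : R := `|M_ R B - Mtrunc y|; rewrite -/dM.
have pt n : `|bdev n ^+ k - ydev y n ^+ k| <=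
   c * (\sum_(1 <= j < h.+1) \sum_(y <= b < (N + h).+1 | b \in B) (b %| n + j)%N%:R + dM * H) \/ (N < n)%N.
  have [nN|] := leqP n N; [left|by right].
  apply: (@le_trans _ _ (c * `|bdev n - ydev y n|)).
    by apply: ler_normXB; apply: dev_bound; rewrite ?M01 ?Mtrunc01// => m; rewrite ?bind01 ?sieve01.
  apply: ler_wpM2l => //.
  have -> : bdev n - ydev y n = \sum_(1 <= j < h.+1) (bind (n + j) - sieveind R (@bfam y) (n + j))
     + (Mtrunc y - M_ R B) * H by rewrite /bdev /ydev sumrB; ring.
  apply: (le_trans (ler_normD _ _)); apply: lerD; last first.
    by rewrite normrM (gtr0_norm H0) distrC.
  apply: (le_trans (ler_norm_sum _ _ _)); rewrite big_nat [leRHS]big_nat; apply: ler_sum => j /andP[j1 jh].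
  have nj : (0 < n + j)%N by rewrite addn_gt0 j1 orbT.
  apply: (le_trans (bind_sieve y nj)).
  have le : ((n + j).+1 <= (N + h).+1)%N by rewrite ltnS leq_add.
  have [yn|ny] := leqP y (n + j).+1; last by rewrite big_geq ?(ltnW ny)//; apply: sumr_ge0.
  by rewrite [leRHS](big_cat_nat (n := (n + j).+1))//= lerDl sumr_ge0.
rewrite -mulrBr -sumrB normrM gtr0_norm ?invr_gt0// ler_pdivrMl//.
apply: (le_trans (ler_norm_sum _ _ _)).
apply: (@le_trans _ _ (\sum_(1 <= n < N.+1)
   c * (\sum_(1 <= j < h.+1) \sum_(y <= b < (N + h).+1 | b \in B) (b %| n + j)%N%:R + dM * H))).
  rewrite big_nat [leRHS]big_nat; apply: ler_sum => n /andP[_ nN].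
  by case: (pt n) => // Nn; rewrite ltnS leqNgt Nn in nN.
rewrite -mulr_sumr big_split /= sumr_const_nat subn1 /= -[_ *+ N]mulr_natl.
have dbl : \sum_(1 <= n < N.+1) \sum_(1 <= j < h.+1) \sum_(y <= b < (N + h).+1 | b \in B) (b %| n + j)%N%:R
   <= h%:R * ((N + h)%:R * (S * y%:R `^ (s - 1))) :> R.
  rewrite exchange_big /=.
  apply: (@le_trans _ _ (\sum_(1 <= j < h.+1) (N + h)%:R * (S * y%:R `^ (s - 1)))); last first.
    by rewrite sumr_const_nat subn1 /= -[leLHS]mulr_natl.
  rewrite big_nat [leRHS]big_nat; apply: ler_sum => j /andP[j1 jh].
  rewrite exchange_big /=.
  apply: (@le_trans _ _ (\sum_(y <= b < (N + h).+1 | b \in B) (N + h)%:R * b%:R^-1)).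
    by apply: ler_sum => b /set_mem /B2 b2; apply: dvd_count => //; exact: ltnW.
  by rewrite -mulr_sumr; apply: ler_wpM2l => //; exact: tail_bound.
have t0 : 0 <= S * y%:R `^ (s - 1) by rewrite mulr_ge0 ?powR_ge0 ?S_ge0.
have NhX : (N + h)%:R <= X * (1 + h%:R) :> R.
  rewrite natrD mulrDr mulr1; apply: lerD => //; exact: ler_peMl.
have d0 : 0 <= dM * H by apply: mulr_ge0; [exact: normr_ge0|exact: ltW].
apply: (@le_trans _ _ (c * (h%:R * (X * (1 + h%:R) * (S * y%:R `^ (s - 1))) + X * (dM * H)))).
  apply: ler_wpM2l => //; apply: lerD; last exact: ler_wpM2r.
  by apply: (le_trans dbl); apply: ler_wpM2l => //; apply: ler_wpM2r.
rewrite le_eqVlt; apply/orP; left; apply/eqP.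
have -> : k%:R * H ^+ k = c * H.
  by rewrite /c; case: (k) => [|k']; rewrite ?mul0r// exprSr mulrA.
ring.
Qed.

(** For fixed y the truncated deviation is periodic, so its averages over X converge to [shmom]; the
    uniformity in [avg_diff] allows the two limits to be exchanged through [lim_approx]. *)
Lemma C_cvg (k : nat) :
  shmom (@bfam y) h (Mtrunc y * (H - h%:R)) k @[y --> \oo] --> C_ k B H.
Proof.
have H0 : 0 <= H by apply: le_trans H1.
have -> : C_ k B H = lim ((X^-1 * \sum_(1 <= n < (Num.truncn X).+1) bdev n ^+ k) @[X --> +oo]).
  rewrite /C_; have -> // : (fun X : R => X^-1 * \sum_(1 <= n < (Num.truncn X).+1)
      ((N_free B n H)%:R - M_ R B * H) ^+ k) =
    (fun X => X^-1 * \sum_(1 <= n < (Num.truncn X).+1) bdev n ^+ k).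
  apply/funext => X; congr (_ * _); apply: eq_bigr => n _.
  by rewrite /N_free count_in_sum// natr_sum.
apply: lim_approx => eps e0.
have e40 : 0 < eps / 4 by lra.
have c0 : 0 <= k%:R * H ^+ k.-1 * (h%:R * (1 + h%:R)) by rewrite !mulr_ge0 ?exprn_ge0 ?addr_ge0.
have [y1 [y10 hy1]] := tail_small c0 e40.
have Hk0 : 0 <= k%:R * H ^+ k by rewrite mulr_ge0 ?exprn_ge0.
have e50 : 0 < eps / 4 / (k%:R * H ^+ k + 1) by rewrite divr_gt0// ltr_pwDr.
have /cvgrPdist_le /(_ _ e50) [y2 _ hy2] := Mtrunc_cvg.
exists (maxn y1 y2) => y; rewrite geq_max => /andP[yy1 yy2].
have y0 : (0 < y)%N by exact: leq_trans yy1.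
have per n : ydev y (n + Q (@bfam y)) ^+ k = ydev y n ^+ k.
  congr (_ ^+ _); rewrite /ydev; congr (_ - _); apply: eq_bigr => j _.
  rewrite /sieveind; apply: eq_bigr => i _; rewrite addnAC dvdn_addl//; exact: b_dvd_Q (bfam_coprime y) i.
have bd n : `|ydev y n ^+ k| <= H ^+ k.
  rewrite normrX; apply: lerXn2r; rewrite ?nnegrE//.
  by apply: dev_bound; rewrite ?Mtrunc01// => m; exact: sieve01.
have pm := periodic_mean (Q_gt0 (bfam_coprime y)) per bd e40.
have shE : shmom (@bfam y) h (Mtrunc y * (H - h%:R)) k =
   (Q (@bfam y))%:R^-1 * \sum_(n < Q (@bfam y)) ydev y n ^+ k.
  rewrite /shmom; congr (_ * _); apply: eq_bigr => n _; congr (_ ^+ _).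
  have Me : \prod_(i : below y) (1 - (bfam i)%:R^-1) = Mtrunc y.
    exact: (big_below _ y (fun b => 1 - b%:R^-1 : R)).
  by rewrite /devi /ydev Me; ring.
rewrite shE.
near=> X.
have X1 : 1 <= X by near: X; exact: nbhs_pinfty_ge.
have := avg_diff k y0 X1; have := hy1 y yy1; have := hy2 y yy2 => /= dM tl ad.
have pX : `|X^-1 * (\sum_(1 <= n < (Num.truncn X).+1) ydev y n ^+ k) -
   (Q (@bfam y))%:R^-1 * \sum_(n < Q (@bfam y)) ydev y n ^+ k| <= eps / 4 by near: X.
have dM2 : k%:R * H ^+ k * `|M_ R B - Mtrunc y| <= eps / 4.
  apply: (@le_trans _ _ ((k%:R * H ^+ k + 1) * (eps / 4 / (k%:R * H ^+ k + 1)))).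
    by apply: ler_pM => //; lra.
  by rewrite mulrC divfK// gt_eqF// ltr_pwDr.
apply: (le_trans (ler_distD (X^-1 * \sum_(1 <= n < (Num.truncn X).+1) ydev y n ^+ k) _ _)).
have := lerD ad pX; lra.
Unshelve. all: by end_near. Qed.

End Tail.
End Truncation.

(** * From the index to a Dirichlet sum, and the conclusion *)

Lemma sub_mul_semigroup (B : set nat) : B `<=` mul_semigroup B.
Proof. exact: sub_smallest. Qed.

Lemma index_growth (R : realType) (J : set nat) (al s : R) : has_index J al -> al < s ->
  exists x0 : R, 1 <= x0 /\ forall x, x0 <= x -> (N_le J x)%:R <= x `^ s.
Proof.
move=> [e [e0 Ne]] als.
have se : 0 < s - al by rewrite subr_gt0.
have /cvgrPdist_le /(_ _ se) e1 := e0.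
have : \forall x \near +oo, (N_le J x)%:R <= x `^ s :> R.
  near=> x; have x1 : 1 <= x by near: x; exact: nbhs_pinfty_ge.
  have -> : (N_le J x)%:R = x `^ (al + e x) by near: x.
  apply: ler_powR => //.
  have : `|0 - e x| <= s - al by near: x.
  by rewrite sub0r normrN => /(le_trans (ler_norm _)); lra.
move=> [M [_ hM]]; exists (Num.max 1 (M + 1)); split; first by rewrite le_max lexx.
by move=> x; rewrite ge_max => /andP[_ Mx]; apply: hM; lra.
Unshelve. all: by end_near. Qed.

Lemma index_dirichlet (R : realType) (J B : set nat) (al s : R) :
  0 < al -> has_index J al -> B `<=` J -> al < s ->
  exists S : R, 0 <= S /\ forall y, \sum_(1 <= b < y | b \in B) b%:R `^ (- s) <= S.
Proof.
move=> al0 hJ BJ als.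
pose t := (al + s) / 2; have als' : al < t by rewrite /t; lra.
have ts : t < s by rewrite /t; lra.
have [x0 [x01 hx0]] := index_growth hJ als'.
(* For 2^j >= x0 the count is at most x^t + 1, the 1 accounting for n = 0; below x0 the trivial
   count is at most x0. Both are within (1 + x0) x^t. *)
apply: (@dirichlet_sum_bounded R (fun n => n \in B) (1 + x0) s t) => //; first by lra.
move=> j; set x : R := (2 ^ j)%:R.
have x1 : 1 <= x by rewrite /x ler1n expn_gt0.
have p1 : 1 <= x `^ t by apply: powR_ge1 => //; lra.
have [lx|gx] := leP x0 x.
  have : (\sum_(0 <= n < 2 ^ j | n \in B) 1 <= (N_le J x).+1)%N.
    have -> : N_le J x = (\sum_(1 <= n < (2 ^ j).+1) (n \in J))%N.
      rewrite /N_le -[x]add0r -[0]/(0%:R : R) count_in_sum ?(le_trans ler01)//.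
      by rewrite /x natrK.
    rewrite (@leq_trans (\sum_(0 <= n < 2 ^ j) (n \in J))%N)//.
      rewrite big_mkcond /=; apply: leq_sum => n _; case: ifP => // /set_mem /BJ nJ.
      by rewrite mem_set.
    rewrite big_ltn ?expn_gt0// big_nat_recr ?expn_gt0//=.
    by rewrite -[leqRHS]add1n leq_add ?leq_b1 ?leq_addr.
  rewrite -(ler_nat R) => /le_trans; apply.
  have := hx0 _ lx; rewrite -natr1 => hN.
  have : 0 <= (x0 - 1) * x `^ t by apply: mulr_ge0; lra.
  by lra.
apply: (@le_trans _ _ x); last first.
  have : 0 <= (x `^ t - 1) * x0 by apply: mulr_ge0; lra.
  by lra.
rewrite /x ler_nat.
apply: (@leq_trans (\sum_(0 <= n < 2 ^ j) 1)%N); last by rewrite sum_nat_const_nat muln1 subn0.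
by rewrite big_mkcond; apply: leq_sum => n _; case: ifP.
Qed.

(* The loss k et / 2 from replacing al by al + et is half of the saving c0 / k. *)
Lemma exponent_choice (R : realType) (al k : R) : 0 < al < 1 -> 1 <= k ->
  let c0 := al * (1 - al) / 16 in let et := c0 / k ^+ 2 in
  [/\ 0 < et, et <= c0, al + et / 2 < 1,
    k * (al + et) / 2 - c0 / k = k * al / 2 - al * (1 - al) / 32 / k &
    0 <= k * al / 2 - al * (1 - al) / 32 / k].
Proof.
move=> /andP[al0 al1] k1 c0 et.
have c00 : 0 < c0 by rewrite /c0 !mulr_gt0 ?subr_gt0.
have c01 : c0 <= (1 - al) / 16.
  by rewrite /c0; apply: ler_wpM2r => //; rewrite ler_piMl ?subr_ge0 ?(ltW al1).
have c02 : c0 <= al / 16.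
  by rewrite /c0; apply: ler_wpM2r => //; rewrite ler_piMr; lra.
have k0 : 0 < k by lra.
have kk : 1 <= k ^+ 2 by rewrite exprn_ege1.
have et0 : 0 < et by rewrite divr_gt0// exprn_gt0.
have ec : et <= c0 by rewrite /et ler_pdivrMr ?exprn_gt0// ler_peMr// ltW.
split=> //; first by lra.
  by rewrite /et /c0; field; rewrite gt_eqF.
have -> : al * (1 - al) / 32 / k = c0 / 2 / k by rewrite /c0; field; rewrite gt_eqF.
have : c0 / 2 / k <= al / 2.
  by rewrite ler_pdivrMr//; have : al / 2 <= al / 2 * k; [rewrite ler_peMr; lra|lra].
have : al / 2 <= k * al / 2 by rewrite ler_pdivrMr// divfK// ler_peMl// ltW.
lra.
Qed.

Lemma cvg_exprn (R : realType) (u : nat -> R) (a : R) (n : nat) :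
  u y @[y --> \oo] --> a -> u y ^+ n @[y --> \oo] --> a ^+ n.
Proof.
move=> ua; elim: n => [|n IH].
  by rewrite expr0; under eq_fun do rewrite expr0; exact: cvg_cst.
by rewrite exprS; under eq_fun do rewrite exprS; exact: cvgM.
Qed.

Theorem theorem1p10 (R : realType) (alpha : R) (halpha : 0 < alpha < 1) :
  exists c : R, 0 < c /\
    forall B : set nat, sieving_set R B -> has_index (mul_semigroup B) alpha ->
    forall k : nat, (0 < k)%N ->
    exists K : R, forall H : R, 1 <= H ->
      `|C_ k B H - (mu_ k)%:R * C_ 2 B H `^ (k%:R / 2)|
        <= K * H `^ (k%:R * alpha / 2 - c / k%:R).
Proof.
(* Half of the 1/16 in [tuple_totals]; the other half pays for alpha + et. *)
exists (alpha * (1 - alpha) / 32); split.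
  by have /andP[a0 a1] := halpha; rewrite !mulr_gt0 ?subr_gt0.
move=> B [_ B2 Bcop _] hB k k0.
have k1 : 1 <= k%:R :> R by rewrite ler1n.
have [] := exponent_choice halpha k1; set et := _ / _ ^+ 2 => et0 etc ae1 exE ex0.
have /andP[al0 al1] := halpha.
have as_ : alpha < alpha + et / 2 by lra.
have [S [S0 hS]] := index_dirichlet al0 hB (@sub_mul_semigroup B) as_.
have sf y : small_family alpha et S (@bfam B y).
  split; first exact: bfam_coprime.
  rewrite (big_below B _ y (fun b => b%:R `^ (- (alpha + et / 2)))).
  apply: le_trans (hS y); case: y => [|y]; first by rewrite !big_geq.
  rewrite big_ltn_cond//; case: ifP => // /set_mem /B2; by [].
have [C [C0 hC]] := shmom_gauss S halpha et0 etc k0.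
exists C => H H1; set ex := (X in H `^ X).
have H0 : 0 <= H by lra.
have /andP[hH Hh] := h_itv H1.
(* The count only sees the integer part h; the remainder M (H - h) of the mean becomes the shift
   [dl]. *)
set h := Num.truncn H in hH Hh.
have h0 : (0 < h)%N by rewrite truncn_gt0.
pose dl y : R := Mtrunc R B y * (H - h%:R).
have dl01 y : 0 <= dl y <= 1.
  have /andP[m0 m1] := Mtrunc01 R B2 y.
  by rewrite /dl mulr_ge0 ?subr_ge0//= mulr_ile1 ?subr_ge0//; lra.
have bd y : `|shmom (@bfam B y) h (dl y) k -
    (mu_ k)%:R * shmom (@bfam B y) h (dl y) 2 ^+ k./2| <= C * H `^ ex.
  apply: (le_trans (hC _ _ (sf y) _ h0 _ (dl01 y))); rewrite exE.
  (* The exponent is nonnegative by [exponent_choice], so h <= H allows h to be replaced by H. *)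
  by apply: ler_wpM2l => //; apply: ler_powR2; rewrite ?ler0n.
have ck := @C_cvg _ _ B2 Bcop _ _ ae1 hS _ H1 k.
have c2 := @C_cvg _ _ B2 Bcop _ _ ae1 hS _ H1 2%N.
have C20 : 0 <= C_ 2 B H.
  apply: (cvgr_to_ge c2); near=> y.
  rewrite /shmom mulr_ge0 ?invr_ge0// sumr_ge0// => n _; exact: sqr_ge0.
(* For odd k the factor [mu_ k] is zero; for even k the real power is an integer power because C_2
   >= 0. *)
have -> : (mu_ k)%:R * C_ 2 B H `^ (k%:R / 2) = (mu_ k)%:R * C_ 2 B H ^+ k./2.
  have [ok|ek] := boolP (odd k); first by rewrite /mu_ ok !mul0r.
  have -> : k%:R / 2 = k./2%:R :> R.
    by rewrite -[in LHS](even_halfK ek) -mul2n natrM mulrC mulKf.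
  by rewrite powR_mulrn.
have cc : `|shmom (@bfam B y) h (dl y) k -
    (mu_ k)%:R * shmom (@bfam B y) h (dl y) 2 ^+ k./2| @[y --> \oo] -->
    `|C_ k B H - (mu_ k)%:R * C_ 2 B H ^+ k./2|.
  apply: cvg_norm; apply: cvgB => //; apply: cvgM; first exact: cvg_cst.
  exact: cvg_exprn.
by apply: (cvgr_to_le cc); near=> y.
Unshelve. all: by end_near. Qed.
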